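(* Let $X$ be a proper geodesic $\delta$-hyperbolic space which is upper Gromov product bounded by above, and assume that the Gromov boundary $\partial X$ is endowed with visual metrics $(d_x^{\epsilon})_{x\in X}$ of visual parameter $0<\epsilon\le 1$. Let $\Gamma$ be a (nonelementary) discrete quasi-convex cocompact group of isometries of $X$ with critical exponent $\alpha(\Gamma)<\infty$, and let $\mu=(\mu_x)_{x\in X}$ be a $\Gamma$-invariant continuous quasi-conformal density of dimension $\alpha=\alpha(\Gamma)$. Then for each $x\in X$ and every $f\in L^{1}(\partial X,\mu_x)$, the function $\mathcal{P}_0 f$ has weak nontangential limit $f(v)$ at $v$ for $\mu_x$-almost every $v$.
   Context: **Hyperbolicity.** $(y,z)_x=\frac12(d(x,y)+d(x,z)-d(y,z))$ is the Gromov product; $(X,d)$ is $\delta$-hyperbolic if $(y,z)_x\ge\min\{(y,u)_x,(u,z)_x\}-\delta$ for all $x,y,z,u\in X$. $\partial X$ is the Gromov boundary, $\overline X=X\cup\partial X$ with its usual (compact) topology. The Gromov product is extended to $v,w\in\overline X$ by $(v,w)_x=\sup\liminf_{i,j}(a_i,b_j)_x$, the sup over sequences in $X$ with $a_i\to v$, $b_j\to w$. The Busemann function is $\beta_v(x,y)=2(v,y)_x-d(x,y)$. A visual metric of parameter $\epsilon$ based at $x$ is a metric $d_x^\epsilon$ on $\partial X$ with $c_m^{-1}e^{-\epsilon(v,w)_x}\le d_x^\epsilon(v,w)\le c_m e^{-\epsilon(v,w)_x}$ for some constant $c_m>0$. **Upper Gromov product bounded by above.** There exist $x\in X$ and $c>0$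 such that $\sup_{v\in\partial X}(y,v)_x\ge d(x,y)-c$ for all $y\in X$ (if this holds for one $x$ it holds for every $x$ with another $c$). Given $x$, one then fixes for each $y\in X$ a point $w_x^y\in\partial X$ with $(y,w_x^y)_x\ge d(x,y)-c$, $c$ being independent of $y$. **Group.** $\alpha(\Gamma)=\inf\{s>0:\sum_{\gamma\in\Gamma}e^{-s d(\gamma x,x)}<\infty\}$. The limit set is $\Lambda_\Gamma=\overline{\Gamma x}\cap\partial X$. $GH(\Lambda_\Gamma)$ is the union of all geodesics in $X$ with both endpoints in $\Lambda_\Gamma$. $\Gamma$ is quasi-convex cocompact if it acts cocompactly on $GH(\Lambda_\Gamma)$. **Quasi-conformal density.** A $\Gamma$-invariant quasi-conformal density of dimension $\alpha$ is a map $x\in X\mapsto\mu_x$ into positive finite measures on $\overline X$ such that: there is $C_q>0$ such that for all $x,y\in X$ the measures $\mu_x,\mu_y$ are equivalent and $C_q^{-1}e^{\alpha\beta_v(x,y)}\le\frac{d\mu_y}{d\mu_x}(v)\le C_q e^{\alpha\beta_v(x,y)}$ almost everywhere; and $\gamma_*\mu_x=\mu_{\gamma x}$ for all $\gamma\in\Gamma$, $x\in X$. It is continuous if $(x,y,v)\in X\times X\times\partial X\mapsto\frac{d\mu_y}{d\mu_x}(v)$ is continuous. **Normalized square root of the Poisson kernel.** $P(x,y,v)=\big(\frac{d\mu_y}{d\mu_x}(v)\big)^{1/\alpha}$. Fixing the origin $x$, for $f\in L^1(\partial X,\mu_x)$ and $y\in X$, $$\mathcal P_0f(y)=\frac{\int_{\partial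 X}P(x,y,v)^{\alpha/2}f(v)\,d\mu_x(v)}{\int_{\partial X}P(x,y,v)^{\alpha/2}\,d\mu_x(v)}.$$ **Weak nontangential limit.** For $v\in\Lambda_\Gamma$ and $C>0$, $$\Omega_C(v)=\{y\in GH(\Lambda_\Gamma): d_x^\epsilon(w_x^y,v)\le C\,d(x,y)^{\epsilon/\alpha}e^{-\epsilon d(x,y)}\}.$$ A function $F:X\to\mathbb C$ has weak nontangential limit $L$ at $v$ if for all $C>0$, $F(y)\to L$ as $y\to v$ (in the topology of $\overline X$) with $y\in\Omega_C(v)$. *)

(* Defs.v *)
From HB Require Import structures.
From mathcomp Require Import all_boot all_order all_algebra.
From mathcomp Require Import all_classical all_reals all_analysis.
From mathcomp Require Import complex.

Set Implicit Arguments.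
Unset Strict Implicit.
Unset Printing Implicit Defensive.

Import Order.TTheory GRing.Theory Num.Theory.
Import numFieldNormedType.Exports.

Local Open Scope classical_set_scope.
Local Open Scope ring_scope.

(* Measurable types of the library are pointed, hence the distinguished point,
   which only says that the space is nonempty. *)
#[short(type="pmetricType")]
HB.structure Definition PointedMetric (K : numDomainType) :=
  { M of Metric K M & Pointed M }.

Section metric_spaces.
Context {R : realType}.

Definition proper_space (X : metricType R) :=
  forall (x : X) (r : R), compact [set y | mdist x y <= r].

Definition geodesic_space (X : metricType R) :=
  forall x y : X, exists c : R -> X,
    [/\ c 0 = x, c (mdist x y) = y &
        forall s t, 0 <= s <= mdist x y -> 0 <= t <= mdist x y ->
          mdist (c s) (c t) = `|s - t|].

Definition gromov {X : metricType R} (x y z : X) : R :=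
  (mdist x y + mdist x z - mdist y z) / 2.

Definition hyperbolic (delta : R) (X : metricType R) :=
  forall x y z u : X,
    Num.min (gromov x y u) (gromov x u z) - delta <= gromov x y z.

Definition gequiv {X : metricType R} (a b : nat -> X) :=
  forall x, gromov x (a ij.1) (b ij.2) @[ij --> filter_prod \oo \oo] --> +oo.

Definition gclass {X : metricType R} (a : nat -> X) : set (nat -> X) :=
  [set b | gequiv b b /\ gequiv a b].

End metric_spaces.

(* The Gromov boundary: the classes, for gequiv, of the sequences that converge
   to infinity. gequiv is an equivalence relation on those sequences as soon as
   X is hyperbolic. *)
Definition gbdry (R : realType) (X : metricType R) :=
  {C : set (nat -> X) | exists2 a, gequiv a a & C = gclass a}.
Arguments gbdry {R} X.

HB.instance Definition _ (R : realType) (X : metricType R) :=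
  gen_eqMixin (gbdry X).
HB.instance Definition _ (R : realType) (X : metricType R) :=
  gen_choiceMixin (gbdry X).

Definition gbar (R : realType) (X : metricType R) := (X + gbdry X)%type.
Arguments gbar {R} X.

Definition inX {R : realType} {X : metricType R} (y : X) : gbar X := inl y.
Definition inB {R : realType} {X : metricType R} (v : gbdry X) : gbar X := inr v.

HB.instance Definition _ (R : realType) (X : metricType R) :=
  Choice.copy (gbar X) (X + gbdry X)%type.

Section compactification.
Context {R : realType} {X : metricType R}.

Definition seq_tends (a : nat -> X) (p : gbar X) : Prop :=
  match p with
  | inl y => a @ \oo --> y
  | inr v => sval v a
  end.

Definition gprod (x : X) (p q : gbar X) : \bar R :=
  ereal_sup [set limf_einf (fun ij : nat * nat =>
                   (gromov x (a ij.1) (b ij.2))%:E) (filter_prod \oo \oo)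
            | a in [set a | seq_tends a p] & b in [set b | seq_tends b q]].

Definition busemann (p : gbar X) (x y : X) : R :=
  2 * fine (gprod x p (inX y)) - mdist x y.

(* The usual topology: X is open in gbar X and keeps its own topology, and the
   sets {p | gprod x (inB v) p > r} form a basis of neighbourhoods of a boundary
   point v when X is hyperbolic. The choice of x is immaterial. *)
Definition gbar_open (U : set (gbar X)) :=
  open (inX @^-1` U) /\
  forall v, U (inB v) -> forall x, exists r : R,
    forall p, (r%:E < gprod x (inB v) p)%E -> U p.

Lemma gbar_openT : gbar_open setT.
Proof.
split; first by rewrite preimage_setT; exact: openT.
by move=> v _ x; exists 0.
Qed.

Lemma gbar_openI : setI_closed gbar_open.
Proof.
move=> U V [oU hU] [oV hV]; split.
  by rewrite preimage_setI; exact: openI.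
move=> v [Uv Vv] x.
have [r hr] := hU v Uv x; have [s hs] := hV v Vv x.
exists (Num.max r s) => p rsp; split.
  by apply/hr/(le_lt_trans _ rsp); rewrite lee_fin le_max lexx.
by apply/hs/(le_lt_trans _ rsp); rewrite lee_fin le_max lexx orbT.
Qed.

Lemma gbar_open_bigU (I : Type) (f : I -> set (gbar X)) :
  (forall i, gbar_open (f i)) -> gbar_open (\bigcup_i f i).
Proof.
move=> of_; split.
  by rewrite preimage_bigcup; apply: bigcup_open => i _; exact: (of_ i).1.
move=> v [i _ fiv] x; have [r hr] := (of_ i).2 v fiv x.
by exists r => p /hr fip; exists i.
Qed.

End compactification.

HB.instance Definition _ (R : realType) (X : metricType R) :=
  @isOpenTopological.Build (gbar X) gbar_open gbar_openT gbar_openI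
    (@gbar_open_bigU R X).

HB.instance Definition _ (R : realType) (X : metricType R) :=
  Topological.copy (gbdry X) (initial_topology (@inB R X)).

HB.instance Definition _ (R : realType) (X : pmetricType R) :=
  isPointed.Build (gbar X) (inX point).

Definition borel_gbar (R : realType) (X : pmetricType R) :=
  g_sigma_algebraType (@open (gbar X)).
Arguments borel_gbar {R} X.

Section boundary.
Context {R : realType} {X : metricType R}.

Definition is_metric (T : Type) (d : T -> T -> R) :=
  [/\ forall v w, 0 <= d v w,
      forall v w, d v w = 0 <-> v = w,
      forall v w, d v w = d w v &
      forall u v w, d u w <= d u v + d v w].

Definition visual_metric (x : X) (eps : R) (d : gbdry X -> gbdry X -> R) :=
  is_metric d /\
  exists2 cm : R, 0 < cm &
    forall v w,
      let e := expeR (- (eps%:E * gprod x (inB v) (inB w)))%E in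
      (cm^-1%:E * e <= (d v w)%:E <= cm%:E * e)%E.

Definition upper_gromov_bounded :=
  exists x : X, exists2 c : R, 0 < c &
    forall y, ((mdist x y - c)%:E <=
               ereal_sup [set gprod x (inX y) (inB v) | v in [set: gbdry X]])%E.

Definition boundary_choice (x : X) (w : X -> gbdry X) :=
  exists2 c : R, 0 < c &
    forall y, ((mdist x y - c)%:E <= gprod x (inX y) (inB (w y)))%E.

End boundary.
Arguments upper_gromov_bounded {R} X.

Section groups.
Context {R : realType} {X : metricType R}.
Implicit Types (Gamma : set (X -> X)) (x : X).

Definition isometry_group Gamma :=
  [/\ forall g, Gamma g -> forall y z, mdist (g y) (g z) = mdist y z,
      Gamma id,
      forall g h, Gamma g -> Gamma h -> Gamma (g \o h) &
      forall g, Gamma g -> exists2 h, Gamma h & cancel g h /\ cancel h g].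

Definition discrete_group Gamma :=
  Gamma `<=` isolated (Gamma : set {compact-open, X -> X}).

Definition critical_exponent Gamma x : \bar R :=
  ereal_inf [set s%:E | s in [set s : R | 0 < s /\
    (\esum_(g in Gamma) (expR (- s * mdist (g x) x))%:E < +oo)%E]].

Definition limit_set Gamma x : set (gbdry X) :=
  [set v | closure [set inX (g x) | g in Gamma] (inB v)].

Definition nonelementary Gamma x := ~ (limit_set Gamma x #<= `I_2)%card.

Definition geodesic_hull Gamma x : set X :=
  [set y | exists c : R -> X,
    [/\ forall s t, mdist (c s) (c t) = `|s - t|,
        exists2 v, limit_set Gamma x v & inX (c t) @[t --> -oo] --> inB v,
        exists2 w, limit_set Gamma x w & inX (c t) @[t --> +oo] --> inB w &
        exists t, c t = y]].

Definition quasiconvex_cocompact Gamma x :=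
  exists K : set X, [/\ compact K, K `<=` geodesic_hull Gamma x &
    geodesic_hull Gamma x `<=` \bigcup_(g in Gamma) (g @` K)].

(* For a bijective isometry g of a hyperbolic space, the set below is a
   singleton and xget does not use its default value. *)
Definition gbdry_map (g : X -> X) (v : gbdry X) : gbdry X :=
  xget v [set w | forall a, sval v a -> sval w (g \o a)].

Definition gbar_map (g : X -> X) (p : gbar X) : gbar X :=
  match p with inl y => inX (g y) | inr v => inB (gbdry_map g v) end.

End groups.

Section densities.
Context {R : realType} {X : pmetricType R}.
Variable mu : X -> {finite_measure set (borel_gbar X) -> \bar R}.

Definition density (x y : X) : borel_gbar X -> \bar R :=
  Radon_Nikodym (charge_of_finite_measure (mu y)) (mu x).

Definition quasiconformal_density (Gamma : set (X -> X)) (alpha : R) :=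
  (exists2 Cq : R, 0 < Cq & forall x y,
    [/\ mu x `<< mu y, mu y `<< mu x &
        \forall p \ae mu x,
          ((Cq^-1 * expR (alpha * busemann p x y))%:E <= density x y p
            <= (Cq * expR (alpha * busemann p x y))%:E)%E]) /\
  (forall g x A, Gamma g -> measurable A ->
    pushforward (mu x) (gbar_map g : borel_gbar X -> borel_gbar X) A =
    mu (g x) A).

(* A density is a class of functions modulo almost everywhere equality; its
   continuity is that of a suitable representative. *)
Definition continuous_density :=
  exists2 D : X * X * gbdry X -> R, continuous D &
    forall x y, \forall p \ae mu x,
      forall v, p = inB v -> density x y p = (D (x, y, v))%:E.

Definition bdry_set : set (borel_gbar X) := range inB.

Definition poisson (alpha : R) (x y : X) (p : borel_gbar X) : R :=
  fine (density x y p) `^ alpha^-1.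

Definition extend0 (f : gbdry X -> R[i]) (p : borel_gbar X) : R[i] :=
  match p with inl _ => 0 | inr v => f v end.

Definition L1_bdry (x : X) (f : gbdry X -> R[i]) :=
  (mu x).-integrable bdry_set (fun p => (complex.Re (extend0 f p))%:E) /\
  (mu x).-integrable bdry_set (fun p => (complex.Im (extend0 f p))%:E).

Definition bdry_cintegral (x : X) (F : borel_gbar X -> R[i]) : R[i] :=
  ((\int[mu x]_(p in bdry_set) complex.Re (F p)) +i*
   (\int[mu x]_(p in bdry_set) complex.Im (F p)))%C.

Definition P0 (alpha : R) (x : X) (f : gbdry X -> R[i]) (y : X) : R[i] :=
  bdry_cintegral x
    (fun p => (poisson alpha x y p `^ (alpha / 2))%:C%C * extend0 f p) /
  (\int[mu x]_(p in bdry_set) poisson alpha x y p `^ (alpha / 2))%:C%C.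

End densities.

Section limits.
Context {R : realType} {X : metricType R}.
Variables (Gamma : set (X -> X)) (eps alpha : R) (x : X).
Variables (d : gbdry X -> gbdry X -> R) (w : X -> gbdry X).

Definition Omega (C : R) (v : gbdry X) : set X :=
  [set y | geodesic_hull Gamma x y /\
    d (w y) v <= C * mdist x y `^ (eps / alpha) * expR (- eps * mdist x y)].

Definition approach (v : gbdry X) : set_system X :=
  filter_from (nbhs (inB v)) (fun U => inX @^-1` U).

Definition weak_nontangential_limit (F : X -> R[i]) (v : gbdry X) (L : R[i]) :=
  limit_set Gamma x v /\
  forall C : R, 0 < C ->
    F y @[y --> within (Omega C v) (approach v)] --> (L : R[i]^o).

End limits.

(* Main.v *)
Require Import Defs.
From mathcomp Require Import all_boot all_order all_algebra.
From mathcomp Require Import all_classical all_reals all_analysis.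
From mathcomp Require Import complex measurable_realfun.
From mathcomp Require Import lra ring.

Set Implicit Arguments.
Unset Strict Implicit.
Unset Printing Implicit Defensive.

Import Order.TTheory GRing.Theory Num.Theory.
Import numFieldNormedType.Exports.

Local Open Scope classical_set_scope.
Local Open Scope ring_scope.

(** Write [d] for the distance from [x] to [y], [D = alpha / eps], and [rho] for the
    visual metric. The orbit branches, so [alpha > 0], and quasi-convexity makes the
    Poincare series diverge at [alpha]; wandering subsets of the boundary are therefore
    null, and [mu x] lives on the limit set, where the action on shadows makes it
    Ahlfors regular of dimension [D]. The square root of the Poisson kernel is
    comparable with [exp (alpha d / 2)] on the ball of radius [exp (- eps d)] around
    [w y] and with [exp (- alpha d / 2) * rho (w y) u `^ (- D)] outside: each of the
    roughly [d] dyadic annuli contributes [exp (- alpha d / 2)] to its integral, which is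
    of order [d * exp (- alpha d / 2)].
    In the approach region of [v], annuli around [w y] at scales above
    [d `^ (1 / D) * exp (- eps d)] are comparable with annuli around [v], on which, at a
    Lebesgue point [v], the function [|f - f v|] contributes [o(exp (- alpha d / 2))];
    at that scale the ball around [v] has mass [O(d * exp (- alpha d))] and its
    contribution is [o(d * exp (- alpha d / 2))]. *)

(** * Gromov products of points of the compactification *)

(** The measures live on the whole compactification, and visual balls are controlled only around
    limit points. The two halves of Ahlfors regularity have different sources: the upper one
    compares a ball, blown up by a group element, with the total mass of the boundary; the lower one
    needs a definite mass outside every shadow, hence the exclusion of Dirac masses. Differentiation
    is arranged to use the upper half alone; the lower half enters only through the denominator of
    [P0]. The factor [d] of that denominator also absorbs whatever is far from [v], since its
    contribution is a fixed multiple of [exp (- alpha d / 2)]. Gromov products at boundary points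
    are stable only up to additive errors, so estimates carry existential constants, and the order
    in which these are chosen matters. *)

Section gromov_product.
Context {R : realType} {X : metricType R}.
Implicit Types (x y z : X) (a b : nat -> X) (p q : gbar X).

Lemma gromovC x y z : gromov x y z = gromov x z y.
Proof. by rewrite /gromov (metric_sym y z); lra. Qed.

Lemma gromov_ge0 x y z : 0 <= gromov x y z.
Proof.
have := metric_triangle y x z; rewrite (metric_sym y x) /gromov; lra.
Qed.

Lemma gromov_le x y z : gromov x y z <= mdist x z.
Proof.
have := metric_triangle x z y; rewrite (metric_sym z y) /gromov; lra.
Qed.

Lemma gromov_base x x' y z : gromov x y z - mdist x x' <= gromov x' y z.
Proof.
have := metric_triangle x x' y; have := metric_triangle x x' z.
rewrite /gromov; lra.
Qed.

Lemma gromov_lipr x y z z' : gromov x y z - mdist z z' <= gromov x y z'.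
Proof.
have := metric_triangle x z' z; have := metric_triangle y z z'.
rewrite (metric_sym z' z) /gromov; lra.
Qed.

Lemma gromov_swap x y z : gromov x z y + gromov y z x = mdist x y.
Proof. by rewrite /gromov (metric_sym z y) (metric_sym z x) (metric_sym y x); lra. Qed.

(* [gge x p q t] means [(p, q)_x >= t] along all sequences converging to [p] and [q];
   up to additive constants it amounts to [t <= gprod x p q] ([gprod_gge] and
   [gge_gprod]), and it obeys the usual rules without any loss. *)
Variant gge x p q (t : R) : Prop := Gge of
  forall a b, seq_tends a p -> seq_tends b q ->
  exists N, forall i j, (N <= i)%N -> (N <= j)%N -> t <= gromov x (a i) (b j).

Lemma gge_le x p q t s : gge x p q t -> s <= t -> gge x p q s.
Proof.
move=> [h] st; split=> a b ha hb; have [N hN] := h a b ha hb.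
by exists N => i j Ni Nj; exact: le_trans st (hN i j Ni Nj).
Qed.

Lemma gge_sym x p q t : gge x p q t -> gge x q p t.
Proof.
move=> [h]; split=> a b ha hb; have [N hN] := h b a hb ha.
by exists N => i j Ni Nj; rewrite gromovC; exact: hN.
Qed.

Lemma gge_base x x' p q t : gge x p q t -> gge x' p q (t - mdist x x').
Proof.
move=> [h]; split=> a b ha hb; have [N hN] := h a b ha hb; exists N => i j Ni Nj.
by have := hN i j Ni Nj; have := gromov_base x x' (a i) (b j); lra.
Qed.

Lemma gge0 x p q : gge x p q 0.
Proof. by split=> a b _ _; exists 0%N => i j _ _; exact: gromov_ge0. Qed.

Lemma cvg_mdist a y : a @ \oo --> y ->
  forall e, 0 < e -> exists N, forall i, (N <= i)%N -> mdist y (a i) < e.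
Proof.
move=> ay e e0; have [N _ hN] := (metricType_numDomainType.cvgr_dist_lt ay e0).
by exists N => i Ni; exact: hN.
Qed.

Lemma gequivP a b : gequiv a b <-> forall x M, exists N, forall i j,
  (N <= i)%N -> (N <= j)%N -> M <= gromov x (a i) (b j).
Proof.
split=> [h x M|h x].
  have /cvgryPge/(_ M) [[P Q] [[n1 _ h1] [n2 _ h2]] PQ] := h x.
  exists (maxn n1 n2) => i j; rewrite !geq_max => /andP[i1 i2] /andP[j1 j2].
  by apply: (PQ (i, j)); split; [exact: h1|exact: h2].
apply/cvgryPge => M; have [N hN] := h x M.
exists ([set i | (N <= i)%N], [set i | (N <= i)%N]) => /=; first by split; exists N.
by move=> [i j] [/= Ni Nj]; exact: hN.
Qed.

Lemma seq_tends_ex p : exists a, seq_tends a p.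
Proof.
case: p => [y|[C [a aa CE]]]; first by exists (fun=> y); exact: cvg_cst.
by exists a; rewrite /= CE; split.
Qed.

Lemma seq_tends_cst y : seq_tends (fun=> y) (inX y).
Proof. exact: cvg_cst. Qed.
Arguments seq_tends_cst : clear implicits.

Lemma gge_pt x y z t : gge x (inX y) (inX z) t -> t <= gromov x y z.
Proof.
by move=> [/(_ _ _ (seq_tends_cst y) (seq_tends_cst z))[N]]; apply; exact: leqnn.
Qed.

Lemma gge_ub x p y t : gge x p (inX y) t -> t <= mdist x y.
Proof.
have [a ha] := seq_tends_ex p.
move=> [/(_ _ _ ha (seq_tends_cst y))[N] /(_ N N (leqnn _) (leqnn _)) /le_trans].
by apply; exact: gromov_le.
Qed.

(** Sequences tending to [y] and [z] end up within 1/2 of them, and each displacement costs at most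
    its length; hence the unit of slack. *)
Lemma pt_gge x y z t : t + 1 <= gromov x y z -> gge x (inX y) (inX z) t.
Proof.
move=> h; split=> a b ha hb; have e : 0 < 2^-1 :> R by rewrite invr_gt0.
have [N hN] := cvg_mdist ha e; have [N' hN'] := cvg_mdist hb e.
exists (maxn N N') => i j; rewrite !geq_max => /andP[/hN i1 _] /andP[_ /hN' j2].
have := gromov_lipr x y z (b j); have := gromov_lipr x (b j) y (a i).
rewrite (gromovC x (b j) y) (gromovC x (b j) (a i)); lra.
Qed.

Lemma gprod_gge x p q t : gge x p q t -> (t%:E <= gprod x p q)%E.
Proof.
move=> [h]; have [a ha] := seq_tends_ex p; have [b hb] := seq_tends_ex q.
have [N hN] := h a b ha hb; apply: le_trans (ereal_sup_ubound _); last first.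
  by exists a => //; exists b.
rewrite limf_einfE; apply: le_trans (ereal_sup_ubound _); last first.
  exists ([set i | (N <= i)%N] `*` [set i | (N <= i)%N]); last reflexivity.
  by exists ([set i | (N <= i)%N], [set i | (N <= i)%N]) => //=; split; exists N.
by apply: le_ereal_inf_tmp => _ [[i j] [/= Ni Nj] <-]; rewrite lee_fin; exact: hN.
Qed.

Lemma gprod_ub x p y : (gprod x p (inX y) <= (mdist x y)%:E)%E.
Proof.
apply: ge_ereal_sup => _ [a ha [b hb <-]]; rewrite limf_einfE.
apply: ge_ereal_sup => _ [V [[P Q] [[n1 _ h1] [n2 _ h2]] PQ] <-].
apply/lee_addgt0Pr => e e0; have [N hN] := cvg_mdist hb e0.
pose i := maxn n1 (maxn n2 N).
have Vi : V (i, i).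
  apply: PQ; split; [apply: h1|apply: h2] => /=; rewrite /i; first exact: leq_maxl.
  exact: leq_trans (leq_maxl _ _) (leq_maxr _ _).
apply: (le_trans (ereal_inf_lbound _)); first by exists (i, i).
rewrite /= -EFinD lee_fin; have := gromov_le x (a i) (b i).
have := metric_triangle x y (b i).
have := hN i (leq_trans (leq_maxr _ _) (leq_maxr _ _)); lra.
Qed.

Lemma gprod_fin x p y : ((fine (gprod x p (inX y)))%:E = gprod x p (inX y))%E.
Proof.
apply: fineK; rewrite ge0_fin_numE; last exact/gprod_gge/gge0.
exact: le_lt_trans (gprod_ub x p y) (ltry _).
Qed.

Section hyperbolic.
Variable delta : R.
Hypothesis hX : hyperbolic delta X.

Lemma hyperbolic_ge0 x : 0 <= delta.
Proof.
have := hX x x x x; rewrite minxx /gromov !metric_structure.mdistxx; lra.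
Qed.

Lemma hyperbolicP x y z u s : s <= gromov x y u -> s <= gromov x u z ->
  s - delta <= gromov x y z.
Proof.
move=> h1 h2; apply: le_trans (hX x y z u); rewrite lerD2r.
by rewrite le_min h1.
Qed.

Lemma gge_tri x p q r s : gge x p q s -> gge x q r s -> gge x p r (s - delta).
Proof.
move=> [h1] [h2]; split=> a b ha hb; have [c hc] := seq_tends_ex q.
have [N hN] := h1 a c ha hc; have [N' hN'] := h2 c b hc hb.
exists (maxn N N') => i j; rewrite !geq_max => /andP[i1 i2] /andP[j1 j2].
by apply: (hyperbolicP (u := c (maxn N N')));
  [apply: hN|apply: hN'] => //; rewrite ?leq_maxl ?leq_maxr.
Qed.

Lemma gequiv_sym a b : gequiv a b -> gequiv b a.
Proof.
move=> /gequivP h; apply/gequivP => x M; have [N hN] := h x M.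
by exists N => i j Ni Nj; rewrite gromovC; exact: hN.
Qed.

Lemma gequiv_trans a b c : gequiv a b -> gequiv b c -> gequiv a c.
Proof.
move=> /gequivP h1 /gequivP h2; apply/gequivP => x M.
have [N hN] := h1 x (M + delta); have [N' hN'] := h2 x (M + delta).
exists (maxn N N') => i j; rewrite !geq_max => /andP[i1 i2] /andP[j1 j2].
rewrite -(addrK delta M); apply: (hyperbolicP (u := b (maxn N N')));
  [apply: hN|apply: hN'] => //; rewrite ?leq_maxl ?leq_maxr //.
Qed.

Lemma gbdry_gequiv (v : gbdry X) a b : sval v a -> sval v b -> gequiv a b.
Proof.
case: v => C /= [c cc ->] [_ ca] [_ cb].
exact: gequiv_trans (gequiv_sym ca) cb.
Qed.

Lemma gge_diag x (v : gbdry X) t : gge x (inB v) (inB v) t.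
Proof. by split=> a b ha hb; have /gequivP := gbdry_gequiv ha hb; exact. Qed.

(** Two sequences with the same limit are eventually within distance 1 if the limit is in [X], and
    have large mutual Gromov products if it is at infinity. The loss is 1 in the first case and
    [delta] in the second. *)
Lemma seq_tends_change x p a a' b t : seq_tends a p -> seq_tends a' p ->
  (exists N, forall i j, (N <= i)%N -> (N <= j)%N -> t <= gromov x (a i) (b j)) ->
  exists N, forall i j, (N <= i)%N -> (N <= j)%N ->
    t - delta - 1 <= gromov x (a' i) (b j).
Proof.
move=> ha ha' [N hN]; have d0 := hyperbolic_ge0 x; case: p ha ha' => [y|v] ha ha'.
  have e : 0 < 2^-1 :> R by rewrite invr_gt0.
  have [M hM] := cvg_mdist ha e; have [M' hM'] := cvg_mdist ha' e.
  exists (maxn N (maxn M M')) => i j.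
  rewrite !geq_max => /and3P[i1 i2 i3] /andP[j1 _].
  have := hN i j i1 j1; have := hM i i2; have := hM' i i3.
  have := metric_triangle (a i) y (a' i).
  rewrite (metric_sym (a i) y).
  have := gromov_lipr x (b j) (a i) (a' i); rewrite !(gromovC x (b j)); lra.
have /gequivP/(_ x t)[M hM] := gbdry_gequiv ha' ha.
exists (maxn N M) => i j; rewrite !geq_max => /andP[i1 i2] /andP[j1 j2].
have := hyperbolicP (hM i i i2 i2) (hN i j i1 j1); lra.
Qed.

Lemma gge_rep x p q a b t : seq_tends a p -> seq_tends b q ->
  (exists N, forall i j, (N <= i)%N -> (N <= j)%N -> t <= gromov x (a i) (b j)) ->
  gge x p q (t - 2 * delta - 2).
Proof.
move=> ha hb h; split=> a' b' ha' hb'.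
have [N hN] := seq_tends_change ha ha' h.
have [|N' hN'] := @seq_tends_change x q b b' a' (t - delta - 1) hb hb'.
  by exists N => i j Ni Nj; rewrite gromovC; exact: hN.
exists N' => i j Ni Nj; have := hN' j i Nj Ni; rewrite gromovC; lra.
Qed.

Lemma gge_gprod x p q t : (t%:E <= gprod x p q)%E ->
  gge x p q (t - 2 * delta - 3).
Proof.
(* The supremum in [gprod] need not be attained: one unit is given up to find a pair of sequences,
   and [gge_rep] then costs [2 * delta + 2]. *)
move=> h; have : ((t - 1)%:E < gprod x p q)%E.
  by apply: lt_le_trans h; rewrite lte_fin; lra.
move=> /ereal_sup_gt[_ [a ha [b hb <-]]]; rewrite limf_einfE.
move=> /ereal_sup_gt[_ [V [[P Q] [[n1 _ h1] [n2 _ h2]] PQ] <-] hV].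
rewrite (_ : t - _ - 3 = (t - 1) - 2 * delta - 2); last by lra.
apply: (gge_rep ha hb); exists (maxn n1 n2) => i j.
rewrite !geq_max => /andP[i1 i2] /andP[j1 j2].
have Vij : V (i, j) by apply: (PQ (i, j)); split; [exact: h1|exact: h2].
rewrite -lee_fin; apply: (le_trans (ltW hV)).
by apply: ereal_inf_lbound; exists (i, j).
Qed.

(* [s] is the value of [gromov x (a i) y] along a sequence [a] converging to [p]: it
   oscillates by a bounded amount, and [gromov y (a i) x] is complementary to it. *)
Lemma gge_swap p x y : exists s,
  gge x p (inX y) (s - 3 * delta - 3) /\
  gge y p (inX x) (mdist x y - s - 3 * delta - 3).
Proof.
have d0 := hyperbolic_ge0 x.
suff [a ha [s h]] : exists2 a, seq_tends a p & exists s, exists N, forall i,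
    (N <= i)%N -> s - delta - 1 <= gromov x (a i) y /\
                  mdist x y - s - delta - 1 <= gromov y (a i) x.
  have [N hN] := h; exists s; split.
    rewrite (_ : s - _ - 3 = (s - delta - 1) - 2 * delta - 2); last by lra.
    apply: (gge_rep ha (seq_tends_cst y)).
    by exists N => i j /hN[].
  rewrite (_ : _ - _ - 3 = (mdist x y - s - delta - 1) - 2 * delta - 2); last by lra.
  apply: (gge_rep ha (seq_tends_cst x)).
  by exists N => i j /hN[].
case: p => [z|v].
  exists (fun=> z); first exact: seq_tends_cst.
  exists (gromov x z y); exists 0%N => i _; have := gromov_swap x y z; lra.
have [a ha] := seq_tends_ex (inB v); exists a => //.
have /gequivP h := gbdry_gequiv ha ha.
have [N hN] := h x (mdist x y); have [N' hN'] := h y (mdist y x).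
pose M := maxn N N'; have NM : (N <= M)%N by exact: leq_maxl.
have NM' : (N' <= M)%N by exact: leq_maxr.
exists (gromov x (a M) y); exists M => i Mi.
have := hyperbolicP (le_trans (gromov_le x (a M) y) (hN i M (leq_trans NM Mi) NM)) (lexx _).
have := hyperbolicP (le_trans (gromov_le y (a M) x) (hN' i M (leq_trans NM' Mi) NM')) (lexx _).
have := gromov_swap x y (a M); lra.
Qed.

End hyperbolic.
End gromov_product.
Arguments seq_tends_cst {R X} y.

(** * Topology of the compactification and action of isometries *)

Section boundary_topology.
Context {R : realType} {X : metricType R}.
Variable delta : R.
Hypothesis hX : hyperbolic delta X.
Implicit Types (x y z : X) (a b : nat -> X) (p q : gbar X) (u v : gbdry X).

Lemma gge_lip x p y z t : gge x p (inX y) t ->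
  gge x p (inX z) (t - mdist y z - 1).
Proof.
move=> [h]; split=> a b ha hb; have [N hN] := h a _ ha (seq_tends_cst y).
have [N' hN'] := cvg_mdist hb (@ltr01 R).
exists (maxn N N') => i j; rewrite !geq_max => /andP[i1 _] /andP[j1 j2].
have := hN i j i1 j1; have := hN' j j2; have := gromov_lipr x (a i) y (b j).
have := metric_triangle y z (b j); lra.
Qed.

Lemma nbhs_inBP v (A : set (gbar X)) x :
  nbhs (inB v) A <-> exists t, forall p, gge x (inB v) p t -> A p.
Proof.
split=> [|[t ht]].
  rewrite nbhsE => -[U [[_ oU] Uv] UA]; have [r hr] := oU v Uv x.
  exists (r + 1) => p /gprod_gge h; apply/UA/hr/(lt_le_trans _ h).
  by rewrite lte_fin ltrDl.
(* The set of all [p] with [gge x (inB v) p t] need not be open. [U] is its interior, written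
   separately on [X] and on the boundary; hyperbolicity shows that it is open. *)
pose U : set (gbar X) := fun p => match p with
  | inl y => interior [set y | gge x (inB v) (inX y) t] y
  | inr u => exists s, forall q, gge x (inB u) q s -> gge x (inB v) q t end.
have d0 := hyperbolic_ge0 hX x.
have oU : gbar_open U.
  split; first exact: open_interior.
  move=> u [s hs] x'.
  exists (s + mdist x x' + 3 * delta + 5) => p /ltW/(gge_gprod hX).
  move=> /(@gge_base _ _ _ x); rewrite (metric_sym x' x) => h.
  have {}h : gge x (inB u) p (s + delta + 2) by refine (gge_le h _); lra.
  case: p h => [y|u'] h /=; last first.
    exists (s + delta) => q hq; apply: hs; rewrite -(addrK delta s).
    by refine (gge_tri hX (gge_le (s := s + delta) h _) hq); rewrite lerDl.
  apply/(metricType_numDomainType.nbhs_mdistP); exists 1 => //= z yz.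
  apply: hs; refine (gge_le (gge_lip z h) _); move: yz => /=; lra.
rewrite nbhsE; exists U; last first.
  move=> [y /interior_subset hy|u [s hs]]; apply: ht; first exact: hy.
  exact: hs (gge_diag hX x u s).
split; first exact: oU.
by exists t.
Qed.

Lemma gbdry_inj u v a : sval u a -> sval v a -> u = v.
Proof.
case: u v => [C [c cc CE]] [D [e ee DE]] /=; subst C D => -[aa ca] [_ ea].
apply: eq_exist; apply/seteqP; split=> b [bb h]; split=> //.
  exact (gequiv_trans hX ea (gequiv_trans hX (gequiv_sym ca) h)).
exact (gequiv_trans hX ca (gequiv_trans hX (gequiv_sym ea) h)).
Qed.

Section isometry.
Variable g : X -> X.
Hypothesis giso : forall y z, mdist (g y) (g z) = mdist y z.

Lemma gromov_isom x y z : gromov (g x) (g y) (g z) = gromov x y z.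
Proof. by rewrite /gromov !giso. Qed.

Lemma gequiv_isom a b : gequiv a b -> gequiv (g \o a) (g \o b).
Proof.
move=> /gequivP h; apply/gequivP => x M.
have [N hN] := h x (M + mdist (g x) x); exists N => i j Ni Nj.
have := gromov_base (g x) x (g (a i)) (g (b j)).
rewrite gromov_isom; have := hN i j Ni Nj; rewrite /=; lra.
Qed.

Lemma gbdry_mapP v a : sval v a -> sval (gbdry_map g v) (g \o a).
Proof.
rewrite /gbdry_map; case: xgetP => [w _ hw|none]; first exact: hw.
case: v none => C [c cc CE] /= none; subst C; exfalso.
have cgc : exists2 b, gequiv b b & gclass (g \o c) = gclass b.
  by exists (g \o c) => //; exact: gequiv_isom.
apply: (none (exist _ _ cgc)) => b [bb cb] /=; split; exact: gequiv_isom.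
Qed.

Lemma seq_tends_isom p a : seq_tends a p -> seq_tends (g \o a) (gbar_map g p).
Proof.
case: p => [y|v] ha; last exact: gbdry_mapP.
apply/metricType_numDomainType.cvgrPdist_lt => e e0.
have [N hN] := cvg_mdist ha e0; exists N => // i Ni; rewrite /= giso; exact: hN.
Qed.

(** Sequences converging to the image points need not be images under [g]; one pair that is suffices
    by [gge_rep], at the cost of its loss. *)
Lemma gge_isom x p q t : gge x p q t ->
  gge (g x) (gbar_map g p) (gbar_map g q) (t - 2 * delta - 2).
Proof.
move=> [h]; have [a ha] := seq_tends_ex p; have [b hb] := seq_tends_ex q.
apply: (gge_rep hX (seq_tends_isom ha) (seq_tends_isom hb)).
have [N hN] := h a b ha hb; exists N => i j Ni Nj.
rewrite gromov_isom; exact: hN.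
Qed.

Lemma continuous_gbar_map : continuous (gbar_map g : gbar X -> gbar X).
Proof.
apply/continuousP => U [oU hU]; split.
  rewrite (_ : inX @^-1` _ = g @^-1` (inX @^-1` U)) //.
  apply: open_comp oU => y _.
  apply/metricType_numDomainType.cvgrPdist_lt => e e0.
  apply/metricType_numDomainType.nbhs_mdistP; exists e => //= z.
  by rewrite giso.
move=> v Ugv x; have [r hr] := hU _ Ugv (g x).
exists (r + 1 + 4 * delta + 5) => p /ltW/(gge_gprod hX)/gge_isom/gprod_gge h.
by apply/hr/(lt_le_trans _ h); rewrite lte_fin; lra.
Qed.

End isometry.

End boundary_topology.

(** * Geodesics and orbits *)

Section geodesic_lines.
Context {R : realType} {X : metricType R}.
Variable delta : R.
Hypothesis hX : hyperbolic delta X.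
Hypothesis properX : proper_space X.
Hypothesis geodesicX : geodesic_space X.
Implicit Types (x y z : X) (a b : nat -> X) (v w : gbdry X).

Lemma four_points x p y z :
  mdist x p + mdist y z <=
  Num.max (mdist x y + mdist p z) (mdist x z + mdist p y) + 2 * delta.
Proof.
have := hX x y z p; rewrite /gromov; set M := Num.max _ _.
have h1 : mdist x y + mdist p z <= M by rewrite le_max lexx.
have h2 : mdist x z + mdist p y <= M by rewrite le_max lexx orbT.
rewrite (metric_sym y p).
set m := Num.min _ _ => h.
have [E|E] : m = (mdist x y + mdist x p - mdist p y) / 2 \/
    m = (mdist x p + mdist x z - mdist p z) / 2.
- by rewrite /m /Num.min; case: ifP; [left|right].
- by lra.
- by lra.
Qed.

(* Arzela-Ascoli: an ultrafilter finer than [\oo] makes all the pointwise limits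
   exist at once. *)
Lemma pointwise_limit (c : nat -> R -> X) x (C : R -> R) :
  (forall t, \forall i \near \oo, mdist x (c i t) <= C t) ->
  exists c0 : R -> X, forall s t e, 0 < e -> forall P : set nat,
    (\forall i \near \oo, P i) ->
    exists i, [/\ P i, mdist (c0 s) (c i s) < e & mdist (c0 t) (c i t) < e].
Proof.
move=> hC; have [F [FU oF]] := ultraFilterLemma eventually_filter.
have FP : ProperFilter F by exact: (@ultra_proper _ F FU).
suff [c0 hc0] : exists c0 : R -> X, forall t e, 0 < e ->
    F [set i | mdist (c0 t) (c i t) < e].
  exists c0 => s t e e0 P /oF FP'.
  have : F (P `&` ([set i | mdist (c0 s) (c i s) < e] `&`
                   [set i | mdist (c0 t) (c i t) < e])).
    by apply: filterI => //; apply: filterI; exact: hc0.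
  by move=> /filter_ex[i [? [? ?]]]; exists i.
suff /choice[c0 hc0] : forall t, exists y, forall e, 0 < e ->
    F [set i | mdist y (c i t) < e] by exists c0.
move=> t; have FK : (c ^~ t @ F) [set y | mdist x y <= C t] by exact: oF (hC t).
have [y [_ yF]] := @properX x (C t) (c ^~ t @ F) _ FK.
exists y => e e0.
have [//|Fn] := in_ultra_setVsetC [set i | mdist y (c i t) < e] FU.
have ny : nbhs y [set z | mdist y z < e].
  by apply/metricType_numDomainType.nbhs_mdistP; exists e.
by have [z [/= ? ?]] := yF [set z | ~ (mdist y z < e)] _ Fn ny.
Qed.

(** Geodesics joining the terms of two sequences that tend to [v] and [w] all pass near [x], because
    the Gromov products of these terms stay bounded. Parametrized from a point near [x], they have a
    limit line. *)
Lemma geodesic_line x v w r : ~ gge x (inB v) (inB w) r ->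
  exists c : R -> X, [/\ forall s t, mdist (c s) (c t) = `|s - t|,
    mdist x (c 0) <= r + 6 * delta + 3,
    forall t, 0 <= t -> gge x (inB v) (inX (c t)) (t - r - 9 * delta - 6) &
    forall t, 0 <= t -> gge x (inB w) (inX (c (- t))) (t - r - 9 * delta - 6)].
Proof.
move=> nvw; have d0 := hyperbolic_ge0 hX x.
have [a ha] := seq_tends_ex (inB v); have [b hb] := seq_tends_ex (inB w).
(* A late pair with product at least [t0] would force all late pairs above [t0 - 2 * delta], and
   then [gge_rep] would give level [r]. *)
pose t0 := r + 4 * delta + 2.
have /gequivP/(_ x) aa := gbdry_gequiv hX ha ha.
have /gequivP/(_ x) bb := gbdry_gequiv hX hb hb.
have [N hN] : exists N, forall i j, (N <= i)%N -> (N <= j)%N ->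
    gromov x (a i) (b j) < t0.
  have [N1 hN1] := aa t0; have [N2 hN2] := bb t0.
  pose N := maxn N1 N2; have N1N : (N1 <= N)%N := leq_maxl _ _.
  have N2N : (N2 <= N)%N := leq_maxr _ _.
  exists N => i j Ni Nj; rewrite ltNge; apply/negP => hij; apply: nvw.
  apply: (@gge_le _ _ _ _ _ (r + 2 * delta + 2 - 2 * delta - 2)); last lra.
  apply: (gge_rep hX ha hb); exists N => i' j' Ni' Nj'.
  have h1 := hyperbolicP hX (hN1 i' i (leq_trans N1N Ni') (leq_trans N1N Ni)) hij.
  have h2 := hN2 j j' (leq_trans N2N Nj) (leq_trans N2N Nj').
  have := hyperbolicP hX h1 (le_trans _ h2); rewrite /t0; lra.
have Gdist M : exists N, forall i, (N <= i)%N -> M <= mdist x (a i) /\ M <= mdist x (b i).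
  have [N1 hN1] := aa M; have [N2 hN2] := bb M; exists (maxn N1 N2) => i.
  rewrite geq_max => /andP[i1 i2]; have := hN1 i i i1 i1; have := hN2 i i i2 i2.
  have := gromov_le x (a i) (a i); have := gromov_le x (b i) (b i); lra.
have /choice[sg hsg] := fun i => geodesicX (a i) (b i).
(* [s i] locates, on the side from [a i] to [b i], the internal point of the triangle with third
   vertex [x]. That point becomes [c i 0], and positive times go towards [a i]. *)
pose s i := gromov (a i) x (b i).
pose L i := mdist (a i) (b i).
pose c i t := sg i (s i - t).
have sE i : s i = mdist x (a i) - gromov x (a i) (b i).
  rewrite /s /gromov (metric_sym (a i) x); lra.
have LE i : L i - s i = mdist x (b i) - gromov x (a i) (b i).
  rewrite /s /L /gromov (metric_sym (a i) x); lra.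
have s_ge M : exists N, forall i, (N <= i)%N -> M <= s i /\ M <= L i - s i.
  have [N' hN'] := Gdist (M + t0); exists (maxn N N') => i.
  rewrite geq_max => /andP[i1 i2]; have := hN' i i2; have := hN i i i1 i1.
  rewrite LE sE; lra.
have c_dist i t u : `|t| <= s i -> `|t| <= L i - s i -> `|u| <= s i ->
    `|u| <= L i - s i -> mdist (c i t) (c i u) = `|t - u|.
  rewrite !ler_norml => /andP[? ?] /andP[? ?] /andP[? ?] /andP[? ?].
  have [_ _ ->] := hsg i; first by rewrite -normrN; congr `|_|; lra.
    by rewrite -/(L i); apply/andP; split; lra.
  by rewrite -/(L i); apply/andP; split; lra.
have c_a i t : `|t| <= s i -> `|t| <= L i - s i -> mdist (c i t) (a i) = s i - t.
  rewrite !ler_norml => /andP[? ?] /andP[? ?].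
  have [h0 _ h] := hsg i; rewrite -{1}h0 /c h ?subr0 ?lexx ?mdist_ge0 //.
    by rewrite ger0_norm //; lra.
  by rewrite -/(L i); apply/andP; split; lra.
have c_b i t : `|t| <= s i -> `|t| <= L i - s i -> mdist (c i t) (b i) = L i - s i + t.
  rewrite !ler_norml => /andP[? ?] /andP[? ?].
  have [_ h0 h] := hsg i; rewrite -{1}h0 /c h ?lexx ?mdist_ge0 //.
    by rewrite -/(L i) ler0_norm //; lra.
  by rewrite -/(L i); apply/andP; split; lra.
have c0x i : (N <= i)%N -> 0 <= s i -> 0 <= L i - s i ->
    mdist x (c i 0) <= t0 + 2 * delta.
  (* For the internal point the two competing sums of [four_points] are equal, which leaves
     [mdist x (c i 0)] at most the Gromov product of [a i] and [b i] plus [2 * delta]. *)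
  move=> Ni s0 Ls0; have := four_points x (c i 0) (a i) (b i).
  rewrite c_a ?normr0 // c_b ?normr0 // addr0 subr0 LE sE -/(L i).
  have := hN i i Ni Ni; set M := Num.max _ _ => ? h.
  have : M <= mdist x (a i) + mdist x (b i) - gromov x (a i) (b i).
    by rewrite ge_max; apply/andP; split; lra.
  have : L i = mdist x (a i) + mdist x (b i) - 2 * gromov x (a i) (b i).
    by rewrite /L /gromov; lra.
  lra.
have near_s M : \forall i \near \oo, [/\ (N <= i)%N, M <= s i & M <= L i - s i].
  have [N' hN'] := s_ge M; exists (maxn N N') => // i /=.
  by rewrite geq_max => /andP[i1 /hN'[]].
have cb t : \forall i \near \oo, mdist x (c i t) <= t0 + 2 * delta + `|t|.
  apply: filterS (near_s `|t|) => i [Ni si Li].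
  have := metric_triangle x (c i 0) (c i t).
  have := c0x i Ni (le_trans (normr_ge0 t) si) (le_trans (normr_ge0 t) Li).
  rewrite c_dist ?normr0 ?(le_trans (normr_ge0 t) si) ?(le_trans (normr_ge0 t) Li) //.
  rewrite sub0r normrN; lra.
have [c0 hc0] := pointwise_limit cb.
have c0_x : mdist x (c0 0) <= t0 + 2 * delta.
  apply/ler_addgt0Pr => e e0.
  have [i [[Ni si Li] hi _]] := hc0 0 0 e e0 _ (near_s 0).
  have := metric_triangle x (c i 0) (c0 0); have := c0x i Ni si Li.
  rewrite (metric_sym (c i 0)); lra.
exists c0; split.
- move=> t u; apply/eqP; rewrite -subr_eq0 -normr_le0; apply/ler_addgt0Pr => e e0.
  rewrite add0r; have e2 : 0 < e / 2 by rewrite divr_gt0.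
  have [i [[Ni si Li] h1 h2]] := hc0 t u _ e2 _ (near_s (Num.max `|t| `|u|)).
  move: si Li; rewrite !ge_max => /andP[? ?] /andP[? ?].
  have E : mdist (c i t) (c i u) = `|t - u| by exact: c_dist.
  have := metric_triangle (c0 t) (c i t) (c0 u).
  have := metric_triangle (c i t) (c i u) (c0 u).
  have := metric_triangle (c i t) (c0 t) (c i u).
  have := metric_triangle (c0 t) (c0 u) (c i u).
  rewrite (metric_sym (c i t) (c0 t)) (metric_sym (c i u) (c0 u)) E => *.
  by rewrite ler_norml; apply/andP; split; lra.
- rewrite /t0 in c0_x; lra.
- move=> t t_ge0.
  apply: (@gge_le _ _ _ _ _ ((t - t0 - 3 * delta - 1) - 2 * delta - 2)); last by rewrite /t0; lra.
  apply: (gge_rep hX ha (seq_tends_cst _)).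
  have [N1 hN1] := aa t; exists N1 => k _ N1k _.
  have near1 : \forall i \near \oo, (N1 <= i)%N by exists N1.
  have [i [[N1i [Ni si Li]] h1 _]] := hc0 t t _ ltr01 _ (filterI near1 (near_s t)).
  have tE : `|t| = t by rewrite ger0_norm.
  have s0 := le_trans t_ge0 si; have L0 := le_trans t_ge0 Li.
  have g1 : t - (t0 + 2 * delta) <= gromov x (c i t) (a i).
    have := gromov_base (c i 0) x (c i t) (a i).
    rewrite {1}/gromov c_dist ?normr0 ?tE // !c_a ?normr0 ?tE // sub0r normrN tE.
    have := c0x i Ni s0 L0; rewrite (metric_sym x); lra.
  have g2 : t - t0 - 2 * delta - 1 <= gromov x (a i) (c0 t).
    have := gromov_lipr x (a i) (c i t) (c0 t).
    rewrite (gromovC x (a i) (c i t)) (metric_sym (c i t)); lra.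
  have h3 : t - t0 - 2 * delta - 1 <= gromov x (a k) (a i).
    by have := hN1 k i N1k N1i; have := mdist_ge0 x (c0 0); lra.
  have := hyperbolicP hX h3 g2; lra.
- move=> t t_ge0.
  apply: (@gge_le _ _ _ _ _ ((t - t0 - 3 * delta - 1) - 2 * delta - 2)); last by rewrite /t0; lra.
  apply: (gge_rep hX hb (seq_tends_cst _)).
  have [N1 hN1] := bb t; exists N1 => k _ N1k _.
  have near1 : \forall i \near \oo, (N1 <= i)%N by exists N1.
  have [i [[N1i [Ni si Li]] h1 _]] := hc0 (- t) (- t) _ ltr01 _ (filterI near1 (near_s t)).
  have tE : `|t| = t by rewrite ger0_norm.
  have s0 := le_trans t_ge0 si; have L0 := le_trans t_ge0 Li.
  have g1 : t - (t0 + 2 * delta) <= gromov x (c i (- t)) (b i).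
    have := gromov_base (c i 0) x (c i (- t)) (b i).
    rewrite {1}/gromov c_dist ?normr0 ?normrN ?tE // !c_b ?normr0 ?normrN ?tE //.
    rewrite sub0r opprK tE.
    have := c0x i Ni s0 L0; rewrite (metric_sym x); lra.
  have g2 : t - t0 - 2 * delta - 1 <= gromov x (b i) (c0 (- t)).
    have := gromov_lipr x (b i) (c i (- t)) (c0 (- t)).
    rewrite (gromovC x (b i) (c i (- t))) (metric_sym (c i (- t))); lra.
  have h3 : t - t0 - 2 * delta - 1 <= gromov x (b k) (b i).
    by have := hN1 k i N1k N1i; have := mdist_ge0 x (c0 0); lra.
  have := hyperbolicP hX h3 g2; lra.
Qed.

End geodesic_lines.

(** * Limit set, geodesic hull and quasi-convexity of the orbit *)

Section orbit_geometry.
Context {R : realType} {X : metricType R}.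
Variable delta : R.
Hypothesis hX : hyperbolic delta X.
Hypothesis properX : proper_space X.
Hypothesis geodesicX : geodesic_space X.
Variables (Gamma : set (X -> X)) (x : X).
Hypothesis GammaI : isometry_group Gamma.
Implicit Types (y z : X) (p q : gbar X) (u v w : gbdry X) (g h : X -> X).

Lemma isometryG g : Gamma g -> forall y z, mdist (g y) (g z) = mdist y z.
Proof. by case: GammaI => + _ _ _; apply. Qed.

Lemma idG : Gamma id. Proof. by case: GammaI. Qed.

Lemma compG g h : Gamma g -> Gamma h -> Gamma (g \o h).
Proof. by case: GammaI => _ _ + _; apply. Qed.

Lemma invG g : Gamma g -> exists h, [/\ Gamma h, cancel g h & cancel h g].
Proof. by case: GammaI => _ _ _ + Gg => /(_ g Gg)[h ? [? ?]]; exists h. Qed.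

Lemma limit_setP v : limit_set Gamma x v <->
  forall t, exists2 g, Gamma g & gge x (inB v) (inX (g x)) t.
Proof.
split=> [vL t|vL A /(nbhs_inBP hX v A x)[t At]].
  have nv : nbhs (inB v) [set p | gge x (inB v) p t].
    by apply/(nbhs_inBP hX v _ x); exists t.
  by have [_ [[g Gg <-] /= ?]] := vL _ nv; exists g.
by have [g Gg /At ?] := vL t; exists (inX (g x)); split => //; exists g.
Qed.

Lemma limit_set_isom g v : Gamma g -> limit_set Gamma x v ->
  limit_set Gamma x (gbdry_map g v).
Proof.
move=> Gg /limit_setP vL; apply/limit_setP => t.
have [h Gh] := vL (t + mdist (g x) x + 2 * delta + 2).
move=> /(gge_isom hX (isometryG Gg))/(@gge_base _ _ _ x) hh.
exists (g \o h); first exact: compG.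
by refine (gge_le hh _); lra.
Qed.

Lemma hull_isom g y : Gamma g -> geodesic_hull Gamma x y ->
  geodesic_hull Gamma x (g y).
Proof.
move=> Gg [c [ci [v vL cv] [w wL cw] [t ct]]].
have gc := continuous_gbar_map hX (isometryG Gg).
exists (g \o c); split.
- by move=> s s'; rewrite /= (isometryG Gg).
- exists (gbdry_map g v); first exact: limit_set_isom.
  exact: (cvg_comp _ _ cv (gc (inB v))).
- exists (gbdry_map g w); first exact: limit_set_isom.
  exact: (cvg_comp _ _ cw (gc (inB w))).
- by exists t; rewrite /= ct.
Qed.

Lemma gge_eq v w : (forall t, gge x (inB v) (inB w) t) -> v = w.
Proof.
move=> vw; have [a ha] := seq_tends_ex (inB v).
have [b hb] := seq_tends_ex (inB w).
suff vb : sval v b by exact: (gbdry_inj hX vb hb).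
case: v vw ha => C [c cc CE] /= vw ha; move: vw; subst C => vw; split.
  exact (gbdry_gequiv hX hb hb).
have bb : gequiv a b.
  apply/gequivP => y M; have [/(_ a b ha hb)[N hN]] := vw (M + mdist x y).
  exists N => i j Ni Nj; have := hN i j Ni Nj.
  have := gromov_base x y (a i) (b j); lra.
by case: ha => _ ca; exact (gequiv_trans hX ca bb).
Qed.

Lemma gge_neq v w : v <> w -> exists r, ~ gge x (inB v) (inB w) r.
Proof. by move=> vw; apply/not_existsP => h; apply/vw/gge_eq => t; apply: contrapT. Qed.

Lemma limit_line v w r : limit_set Gamma x v -> limit_set Gamma x w ->
  ~ gge x (inB v) (inB w) r ->
  exists c : R -> X, [/\ forall t, geodesic_hull Gamma x (c t),
    forall s t, mdist (c s) (c t) = `|s - t|, mdist x (c 0) <= r + 6 * delta + 3 &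
    forall t, 0 <= t -> gge x (inB v) (inX (c t)) (t - r - 9 * delta - 6)].
Proof.
move=> vL wL /(geodesic_line hX properX geodesicX)[c [ci c0 cv cw]].
exists c; split => // t; exists c; split => //; last by exists t.
  exists w => // A /(nbhs_inBP hX w A x)[s hs].
  exists (- Num.max 0 (s + r + 9 * delta + 6)); split; first exact: num_real.
  move=> y; rewrite ltrNr gt_max => /andP[y0 ys].
  have := cw (- y) (ltW y0); rewrite opprK => h.
  by apply: hs; refine (gge_le h _); lra.
exists v => // A /(nbhs_inBP hX v A x)[s hs].
exists (Num.max 0 (s + r + 9 * delta + 6)); split; first exact: num_real.
move=> y; rewrite gt_max => /andP[y0 ys].
by apply: hs; refine (gge_le (cv y (ltW y0)) _); lra.
Qed.

Lemma continuous_mdist y : continuous (mdist y : X -> R).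
Proof.
move=> z; apply/cvgrPdist_lt => e e0.
apply/metricType_numDomainType.nbhs_mdistP; exists e => //= z' zz'.
rewrite ltr_norml; have := metric_triangle y z z'; have := metric_triangle y z' z.
by move: zz'; rewrite /= (metric_sym z' z) => *; apply/andP; split; lra.
Qed.

Lemma compact_mdist_bounded y (K : set X) : compact K ->
  exists2 C, 0 <= C & forall z, K z -> mdist y z <= C.
Proof.
move=> cK; have : compact (mdist y @` K).
  apply: continuous_compact => //; exact: continuous_subspaceT (@continuous_mdist y).
move=> /compact_bounded[M [_ hM]]; exists (Num.max 0 (M + 1)).
  by rewrite le_max lexx.
move=> z Kz; have M1 : M < M + 1 by rewrite ltrDl.
have := hM _ M1 (mdist y z); rewrite /= ger0_norm ?mdist_ge0 // => h.
by rewrite le_max h ?orbT //; exists z.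
Qed.

(* Both endpoints of a geodesic line through [y] cannot be on the same side of [y] as
   seen from [x]. *)
Lemma hull_endpoint y : geodesic_hull Gamma x y ->
  exists2 v, limit_set Gamma x v & gge x (inB v) (inX y) (mdist x y - 2 * delta - 2).
Proof.
move=> [c [ci [v vL cv] [w wL cw] [t0 ct0]]].
have d0 := hyperbolic_ge0 hX x.
have far u : nbhs (inB u) [set p | gge x (inB u) p (mdist x y)].
  by apply/(nbhs_inBP hX u _ x); exists (mdist x y).
have [M1 [_ hM1]] := cv _ (far v); have [M2 [_ hM2]] := cw _ (far w).
pose s := Num.min (M1 - 1) t0; pose t := Num.max (M2 + 1) t0.
have sM1 : s < M1 by rewrite gt_min; apply/orP; left; rewrite ltrBlDr ltrDl.
have tM2 : M2 < t by rewrite lt_max ltrDl ltr01.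
have st0 : s <= t0 by rewrite ge_min lexx orbT.
have tt0 : t0 <= t by rewrite le_max lexx orbT.
have g0 : gromov y (c s) (c t) = 0.
  rewrite /gromov -ct0 !ci (@ger0_norm _ (t0 - s)) ?subr_ge0 //.
  by rewrite (distrC t0) (distrC s) !ger0_norm ?subr_ge0 // ?(le_trans st0) //; lra.
have := hX y (c s) (c t) x; rewrite g0 /Num.min.
have E1 := gromov_swap x y (c s); have E2 := gromov_swap x y (c t).
have mem z : mdist x y - delta <= gromov x z y ->
    gge x (inX z) (inX y) (mdist x y - delta - 1) by move=> ?; apply: pt_gge; lra.
case: ifP => _ h.
  exists v => //; have h1 := hM1 s sM1; rewrite /= in h1.
  have h2 : gge x (inX (c s)) (inX y) (mdist x y - delta - 1) by apply: mem; lra.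
  have h1' : gge x (inB v) (inX (c s)) (mdist x y - delta - 1).
    by refine (gge_le h1 _); lra.
  by refine (gge_le (gge_tri hX h1' h2) _); lra.
exists w => //; have h1 := hM2 t tM2; rewrite /= in h1.
have h2 : gge x (inX (c t)) (inX y) (mdist x y - delta - 1).
  by apply: mem; rewrite (gromovC y) in h; lra.
have h1' : gge x (inB w) (inX (c t)) (mdist x y - delta - 1).
  by refine (gge_le h1 _); lra.
by refine (gge_le (gge_tri hX h1' h2) _); lra.
Qed.

Section cocompact.
Hypothesis qc : quasiconvex_cocompact Gamma x.
Variables (v1 v2 : gbdry X).
Hypothesis v1L : limit_set Gamma x v1.
Hypothesis v2L : limit_set Gamma x v2.
Hypothesis v12 : v1 <> v2.

(** Two separated limit points cannot both be close to [v]. The uniform [r] makes it possible to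
    draw, towards any limit point, a line of the hull that passes at bounded distance from [x]. *)
Lemma limit_set_partner : exists r, forall v, exists2 w, limit_set Gamma x w &
  ~ gge x (inB v) (inB w) r.
Proof.
have [r hr] := gge_neq v12; exists (r + delta) => v; apply: contrapT => h.
apply: hr; rewrite -(addrK delta r); apply: (gge_tri hX (q := inB v)).
  by apply: gge_sym; apply: contrapT => h1; apply: h; exists v1.
by apply: contrapT => h1; apply: h; exists v2.
Qed.

Lemma hull_near_orbit : exists2 C, 0 <= C & forall y, geodesic_hull Gamma x y ->
  exists2 g, Gamma g & mdist y (g x) <= C.
Proof.
have [K [cK _ hK]] := qc; have [C C0 hC] := compact_mdist_bounded x cK.
exists C => // y /hK[g Gg [k Kk <-]]; exists g => //.
by rewrite (isometryG Gg) metric_sym hC.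
Qed.

(** Limit points are conical, uniformly in [v] and in the time [t]: the line from [v] to a partner
    lies in the hull, hence close to the orbit. *)
Lemma limit_point_conical : exists2 C, 0 <= C & forall v t, limit_set Gamma x v ->
  0 <= t -> exists g, [/\ Gamma g, mdist x (g x) <= t + C &
    gge x (inB v) (inX (g x)) (t - C)].
Proof.
have [C C0 hC] := hull_near_orbit; have [r0 hr] := limit_set_partner.
pose r := Num.max 0 r0; have r_ge0 : 0 <= r by rewrite le_max lexx.
have d0 := hyperbolic_ge0 hX x.
exists (C + r + 9 * delta + 7) => [|v t vL t0]; first lra.
have [w wL nvw] := hr v.
have {}nvw : ~ gge x (inB v) (inB w) r.
  by move=> h; apply: nvw; refine (gge_le h _); rewrite le_max lexx orbT.
have [c [ch ci c0 cv]] := limit_line vL wL nvw.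
have [g Gg gC] := hC (c t) (ch t); exists g; split => //.
  have := metric_triangle x (c 0) (c t); have := metric_triangle x (c t) (g x).
  rewrite ci sub0r normrN ger0_norm //; lra.
refine (gge_le (gge_lip (g x) (cv t t0)) _); lra.
Qed.

Lemma orbit_endpoint : exists2 C, 0 <= C & forall g, Gamma g ->
  exists2 v, limit_set Gamma x v & gge x (inB v) (inX (g x)) (mdist x (g x) - C).
Proof.
have [C C0 hC] := hull_near_orbit; have d0 := hyperbolic_ge0 hX x.
have [r hr] := limit_set_partner; have [w wL nvw] := hr v1.
have [c [ch _ _ _]] := limit_line v1L wL nvw.
have [h Gh hC'] := hC _ (ch 0).
exists (2 * C + 2 * delta + 3) => [|g Gg]; first lra.
have [h' [Gh' hh' h'h]] := invG Gh.
(* [h x] is near the hull point [c 0], so [h' (c 0)] is a hull point near [x], and [g] carries it to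
   a hull point near [g x]. *)
pose k := g (h' (c 0)).
have hk : geodesic_hull Gamma x k by apply: hull_isom => //; exact: hull_isom.
have kC : mdist k (g x) <= C.
  by rewrite (isometryG Gg) -(isometryG Gh) h'h.
have [v vL hv] := hull_endpoint hk; exists v => //.
refine (gge_le (gge_lip (g x) hv) _).
have := metric_triangle x k (g x); lra.
Qed.

(** Seen from [x], some limit point [v] lies behind [g x]. The orbit point found at time [t] on the
    way to [v] is then also on the way to [g x]. *)
Lemma orbit_quasiconvex : exists2 C, 0 <= C & forall g t, Gamma g ->
  0 <= t <= mdist x (g x) -> exists h, [/\ Gamma h, `|mdist x (h x) - t| <= C &
    mdist (h x) (g x) <= mdist x (g x) - t + C].
Proof.
have [C1 C10 hC1] := limit_point_conical; have [C2 C20 hC2] := orbit_endpoint.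
have d0 := hyperbolic_ge0 hX x.
exists (3 * C1 + 2 * C2 + 2 * delta) => [|g t Gg /andP[t0 tg]]; first lra.
have [v vL hv] := hC2 g Gg; have [h [Gh h1 h2]] := hC1 v t vL t0.
exists h.
have hv' : gge x (inX (g x)) (inB v) (t - C1 - C2).
  by apply: gge_sym; refine (gge_le hv _); lra.
have h2' : gge x (inB v) (inX (h x)) (t - C1 - C2).
  by refine (gge_le h2 _); lra.
have := gge_pt (gge_tri hX hv' h2'); have := gromov_le x (g x) (h x).
rewrite /gromov (metric_sym (g x) (h x)) => ? ?.
by split=> //; rewrite ?ler_norml; [apply/andP; split; lra|lra].
Qed.

End cocompact.
End orbit_geometry.

Lemma three_points (T : eqType) (A : set T) : ~ (A #<= `I_2)%card ->
  exists u v w, [/\ A u, A v & A w] /\ [/\ u <> v, v <> w & u <> w].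
Proof.
move=> nA; apply: contrapT => h; apply: nA.
have [[u Au]|nA] := pselect (exists u, A u); last first.
  rewrite (_ : A = set0); first exact: card_ge0.
  by apply/seteqP; split=> u // Au; case: nA; exists u.
have [[v [Av uv]]|nv] := pselect (exists v, A v /\ u <> v); last first.
  apply: (@card_le_trans _ _ _ ((fun=> u) @` `I_2)) (card_image_le _ _).
  apply: subset_card_le => w Aw; exists 0%N => //.
  by apply: contrapT => uw; apply: nv; exists w.
apply: (@card_le_trans _ _ _ ((fun n => if n == 0%N then u else v) @` `I_2))
   (card_image_le _ _).
apply: subset_card_le => w Aw; apply: contrapT => nw; apply: h.
exists u, v, w; split=> //; split=> // [vw|uw]; apply: nw.
  by exists 1%N.
by exists 0%N.
Qed.

(** * The Poincare series *)

Section esum_complements.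
Context {R : realType}.
Local Open Scope ereal_scope.

Lemma esum_subset (T : choiceType) (A B : set T) (a : T -> \bar R) :
  A `<=` B -> (forall t, 0 <= a t) ->
  \esum_(t in A) a t <= \esum_(t in B) a t.
Proof.
move=> AB a0; rewrite (esumID A B) //.
rewrite (_ : B `&` A = A); last by rewrite setIC; apply/setIidPl.
by rewrite leeDl // esum_ge0.
Qed.

Lemma esumZl_le (T : choiceType) (A : set T) (a : T -> \bar R) (c : R) :
  (0 <= c)%R -> (forall t, 0 <= a t) ->
  \esum_(t in A) (c%:E * a t) <= c%:E * \esum_(t in A) a t.
Proof.
move=> c0 a0; apply: ge_ereal_sup => _ [F FA <-].
rewrite -ge0_mule_fsumr // lee_wpmul2l ?lee_fin //.
by apply: ereal_sup_ubound; exists F.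
Qed.

Lemma esum_image_le (T T' : choiceType) (A : set T) (B : set T') (f : T -> T')
    (a : T' -> \bar R) :
  B `<=` f @` A -> (forall t, 0 <= a t) ->
  \esum_(t in B) a t <= \esum_(t in A) a (f t).
Proof.
move=> BfA a0.
have [[y0 By0]|nB] := pselect (exists y, B y); last first.
  rewrite (_ : B = set0) ?esum_set0 ?esum_ge0 //.
  by apply/seteqP; split=> // y By; case: nB; exists y.
have [t0 _ _] := BfA _ By0.
have /choice[g hg] : forall t', exists t, B t' -> A t /\ f t = t'.
  move=> t'; have [/BfA[t At ft]|nB] := pselect (B t'); first by exists t.
  by exists t0.
have gi : set_inj B g.
  move=> y z /set_mem By /set_mem Bz yz.
  by have [_ <-] := hg y By; have [_ <-] := hg z Bz; rewrite yz.
rewrite (@eq_esum _ _ B a (fun y => a (f (g y)))); last first.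
  by move=> y By; have [_ ->] := hg y By.
rewrite -(@esum_image _ _ _ B g (a \o f)) //.
by apply: esum_subset => [_ [y By <-]|t]; [have [] := hg y By|exact: a0].
Qed.

Lemma esumU_le (T : choiceType) (A B : set T) (a : T -> \bar R) :
  (forall t, 0 <= a t) ->
  \esum_(t in A `|` B) a t <= \esum_(t in A) a t + \esum_(t in B) a t.
Proof.
move=> a0; rewrite (esumID A) //; apply: leeD; apply: esum_subset => //.
by move=> t [[]].
Qed.

Lemma esumU_disjoint (T : choiceType) (A B : set T) (a : T -> \bar R) :
  (forall t, 0 <= a t) -> A `&` B = set0 ->
  \esum_(t in A) a t + \esum_(t in B) a t = \esum_(t in A `|` B) a t.
Proof.
move=> a0 AB; rewrite (esumID A (A `|` B)) //; congr (_ + _).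
  by congr esum; rewrite setUK.
congr esum; rewrite setIUl setICr set0U; apply/esym/setIidPl => t Bt At.
by suff : (A `&` B) t by rewrite AB.
Qed.

Lemma esum_tail (T : choiceType) (A : set T) (a : T -> \bar R) (e : R) :
  (forall t, 0 <= a t) -> \esum_(t in A) a t < +oo -> (0 < e)%R ->
  exists F : set T, [/\ finite_set F, F `<=` A &
    forall B, B `<=` A -> B `&` F = set0 -> \esum_(t in B) a t <= e%:E].
Proof.
move=> a0 Afin e0; have fA : \esum_(t in A) a t \is a fin_num.
  by rewrite ge0_fin_numE // esum_ge0.
have : \esum_(t in A) a t - e%:E < \esum_(t in A) a t.
  by rewrite lteBlDr // lteDl // lte_fin.
move=> /ereal_sup_gt[_ [F [finF FA] <-]] hF; exists F; split => // B BA BF.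
have eF : \sum_(t \in F) a t = \esum_(t in F) a t by rewrite esum_fset.
have := esum_subset (_ : F `|` B `<=` A) a0.
rewrite -esumU_disjoint // 1?setIC // -eF => /(_ _)/wrap[|h]; first by rewrite subUset.
move: hF; rewrite lteBlDr // => hF.
have fF : \sum_(t \in F) a t \is a fin_num.
  rewrite eF ge0_fin_numE ?esum_ge0 //; apply: le_lt_trans Afin.
  exact: esum_subset.
by have := le_lt_trans h hF; rewrite lteD2lE // => /ltW.
Qed.

Lemma finite_set_ub (T : choiceType) (F : set T) (f : T -> R) : finite_set F ->
  exists M, forall t, F t -> (f t <= M)%R.
Proof.
move=> finF; exists (\sum_(t <- finmap.enum_fset (fset_set F)) `|f t|)%R => t Ft.
rewrite (le_trans (ler_norm _)) // (big_rem t) /= ?lerDl ?sumr_ge0 //.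
by rewrite in_fset_set // inE.
Qed.

End esum_complements.

Section poincare_series.
Context {R : realType} {X : metricType R}.
Variable delta : R.
Hypothesis hX : hyperbolic delta X.
Hypothesis properX : proper_space X.
Hypothesis geodesicX : geodesic_space X.
Variables (Gamma : set (X -> X)) (x : X) (alpha : R).
Hypothesis GammaI : isometry_group Gamma.
Hypothesis crit : critical_exponent Gamma x = alpha%:E.
Implicit Types (y z : X) (u v w : gbdry X) (g h : X -> X) (s t : R).

Let len g := mdist x (g x).
Let psum (A : set (X -> X)) s := (\esum_(g in A) (expR (- s * len g))%:E)%E.

Let psum_term_ge0 s g : (0 <= (expR (- s * len g))%:E :> \bar R)%E.
Proof. by rewrite lee_fin expR_ge0. Qed.

Lemma poincare_fin s : alpha < s -> (psum Gamma s < +oo)%E.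
Proof.
move=> als; have : (critical_exponent Gamma x < s%:E)%E by rewrite crit lte_fin.
move=> /ereal_inf_lt[_ [s' [s'0 s'fin] <-]]; rewrite lte_fin => s's.
apply: le_lt_trans s'fin; apply: le_esum => g _; rewrite lee_fin ler_expR.
by rewrite /len (metric_sym x) !mulNr lerN2 ler_wpM2r ?mdist_ge0 // ltW.
Qed.

Lemma poincare_infty s : 0 < s -> s < alpha -> psum Gamma s = +oo%E.
Proof.
move=> s0 sal; apply/eqP; rewrite -leye_eq leNgt; apply/negP => sfin.
have : (critical_exponent Gamma x <= s%:E)%E.
  apply: ereal_inf_lbound; exists s => //; split => //.
  rewrite (@eq_esum _ _ _ _ (fun g => (expR (- s * len g))%:E)) // => g _.
  by rewrite /len metric_sym.
by rewrite crit lee_fin leNgt sal.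
Qed.

Lemma critical_exponent_ge0 : 0 <= alpha.
Proof.
rewrite -lee_fin -crit; apply: le_ereal_inf_tmp => _ [s [s0 _] <-].
by rewrite lee_fin ltW.
Qed.

Section cocompact.
Hypothesis qc : quasiconvex_cocompact Gamma x.
Variables (v1 v2 : gbdry X).
Hypothesis v1L : limit_set Gamma x v1.
Hypothesis v2L : limit_set Gamma x v2.
Hypothesis v12 : v1 <> v2.

(** If the series converged at [alpha], its shell around some length [L] would be very small, and
    would remain small at an exponent [s] slightly below [alpha]. Factoring long elements through
    that shell bounds the whole series at [s], against the definition of the critical exponent. *)
Lemma poincare_diverges : 0 < alpha -> psum Gamma alpha = +oo%E.
Proof.
move=> al0; apply/eqP; rewrite -leye_eq leNgt; apply/negP => Pfin.
have [C C0 hC] := orbit_quasiconvex hX properX geodesicX GammaI qc v1L v2L v12.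
(* The exponential pays for the defect [2 * C] of the factorization, and 1/4 becomes 1/2 after a
   factor 2 is lost in passing from [alpha] to [s] on the shell. *)
have e0 : 0 < expR (- (2 * C * alpha)) / 4 by rewrite divr_gt0 ?expR_gt0.
have [F [finF FG hF]] := esum_tail (psum_term_ge0 alpha) Pfin e0.
have [M hM] := finite_set_ub len finF.
pose L := Num.max C (M + C + 1).
have CL : C <= L by rewrite le_max lexx.
have L0 : 0 <= L by lra.
pose SL := [set g | Gamma g /\ `|len g - L| <= C].
have SLF : SL `&` F = set0.
  apply/seteqP; split => // g [[_ /=]]; rewrite ler_norml => /andP[gL _] /hM gM.
  have : M + C + 1 <= L by rewrite le_max lexx orbT.
  lra.
have {hF}bal := hF SL (fun g => @proj1 _ _) SLF.
have LC0 : 0 < L + C + 1 by lra.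
(* The first bound keeps [s] positive; the second keeps [expR (e * (L + C))] below 2. *)
pose e := Num.min (alpha / 2) ((L + C + 1)^-1 / 2).
have e_gt0 : 0 < e by rewrite lt_min !divr_gt0 ?invr_gt0.
have eal : e <= alpha / 2 by rewrite ge_min lexx.
have eLC : e * (L + C) <= 2^-1.
  have eL : e <= (L + C + 1)^-1 / 2 by rewrite ge_min lexx orbT.
  have : e * (L + C + 1) <= (L + C + 1)^-1 / 2 * (L + C + 1).
    by rewrite ler_wpM2r // ltW.
  rewrite mulrAC mulVf ?gt_eqF // mul1r; lra.
pose s := alpha - e; have s0 : 0 < s by rewrite /s; lra.
have sal : s < alpha by rewrite /s; lra.
have exp2 : expR (e * (L + C)) <= 2 :> R.
  have := expR_ge1Dx (- (e * (L + C))); rewrite expRN => h.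
  have := expR_gt0 (e * (L + C)); set E := expR _ in h *.
  move=> E0; have : 2^-1 <= E^-1 by lra.
  by rewrite lef_pV2 // posrE.
pose c := expR (2 * C * s).
have hb : (c%:E * psum SL s <= (2^-1)%:E)%E.
  have h1 : (psum SL s <= 2%:E * psum SL alpha)%E.
    apply: le_trans (esumZl_le _ _ _) => //; apply: le_esum => g [Gg].
    rewrite ler_norml => /andP[_ gL]; rewrite -EFinM lee_fin.
    apply: (@le_trans _ _ (expR (e * (L + C)) * expR (- alpha * len g))).
      rewrite -expRD ler_expR /s.
      have : e * len g <= e * (L + C) by rewrite ler_wpM2l; lra.
      lra.
    by rewrite ler_wpM2r // expR_ge0.
  apply: (@le_trans _ _ (c%:E * (2%:E * (expR (- (2 * C * alpha)) / 4)%:E))%E).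
    apply: lee_wpmul2l; first by rewrite lee_fin expR_ge0.
    by apply: le_trans h1 _; apply: lee_wpmul2l => //.
  rewrite -!EFinM lee_fin.
  have : c * expR (- (2 * C * alpha)) <= 1.
    rewrite -expRD -[leRHS]expR0 ler_expR.
    have : 2 * C * s <= 2 * C * alpha by rewrite ler_wpM2l; lra.
    lra.
  lra.
pose GR r := [set g | Gamma g /\ len g <= r].
pose A := psum (GR (L + C)) s.
(* The truncated sums must be finite before half of them can be moved to the other side. *)
have GRfin r : (psum (GR r) s < +oo)%E.
  apply: (@le_lt_trans _ _ ((expR (e * r))%:E * psum Gamma alpha)%E); last first.
    by rewrite lte_mul_pinfty ?lee_fin ?expR_ge0.
  apply: le_trans (esumZl_le _ (expR_ge0 _) (psum_term_ge0 alpha)).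
  apply: (@le_trans _ _ (\esum_(g in GR r) ((expR (e * r))%:E * (expR (- alpha * len g))%:E))%E).
    apply: le_esum => g [Gg gr]; rewrite -EFinM lee_fin -expRD ler_expR /s.
    have : e * len g <= e * r by rewrite ler_wpM2l; lra.
    lra.
  by apply: esum_subset => [g []//|g]; rewrite mule_ge0 // lee_fin expR_ge0.
have fP r : psum (GR r) s \is a fin_num.
  by rewrite ge0_fin_numE ?GRfin //; exact: esum_ge0.
have fA : A \is a fin_num by exact: fP.
(* Every long element factors as [h \o h'] with [h] of length about [L] and [h'] not
   longer than it, so that the truncated series is at most [A] plus half of itself. *)
have GR_rec r : (psum (GR r) s <= A + (2^-1)%:E * psum (GR r) s)%E.
  pose B := [set g | [/\ Gamma g, L + C < len g & len g <= r]].
  have sub : GR r `<=` GR (L + C) `|` B.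
    move=> g [Gg gr]; have [gL|gL] := leP (len g) (L + C); first by left.
    by right.
  apply: le_trans (esum_subset sub (psum_term_ge0 s)) _.
  apply: le_trans (esumU_le _ _ (psum_term_ge0 s)) _.
  apply: leeD2l.
  pose D := [set k : (X -> X) * (X -> X) | SL k.1 /\
     (GR r k.2 /\ len k.1 + len k.2 <= len (k.1 \o k.2) + 2 * C)].
  have Bimg : B `<=` (fun k : (X -> X) * (X -> X) => k.1 \o k.2) @` D.
    move=> g [Gg gL gr]; have [|h [Gh hL hg]] := hC g L Gg.
      by rewrite L0 /=; move: gL; rewrite /len; lra.
    have [h' [Gh' hh' h'h]] := invG GammaI Gh.
    have lh : len (h' \o g) = mdist (h x) (g x).
      by rewrite /len -(isometryG GammaI Gh) /= h'h.
    have E : h \o (h' \o g) = g by apply/funext => y /=; rewrite h'h.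
    exists (h, h' \o g) => //=; rewrite /D /= lh E; split; first by split.
    split; first split; first exact: compG.
      by rewrite lh; rewrite /len in gr gL; lra.
    by move: hL; rewrite ler_norml /len => /andP[? ?]; lra.
  apply: le_trans (esum_image_le Bimg (psum_term_ge0 s)) _.
  apply: (@le_trans _ _ (\esum_(k in SL `*`` (fun=> GR r))
      (c * expR (- s * len k.1) * expR (- s * len k.2))%:E)%E).
    apply: le_trans (esum_subset (_ : D `<=` SL `*`` (fun=> GR r)) _).
    - apply: le_esum => -[h h'] [_ [_ /= hh']]; rewrite lee_fin -!expRD ler_expR.
      have := ler_wpM2l (ltW s0) hh'; rewrite -/(len (h \o h')); lra.
    - by move=> [h h'] [? [? _]].
    - by move=> k; rewrite lee_fin !mulr_ge0 ?expR_ge0.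
  rewrite -(@esum_esum _ _ _ SL (fun=> GR r) (fun h h' =>
      (c * expR (- s * len h) * expR (- s * len h'))%:E)); last first.
    by move=> *; rewrite lee_fin !mulr_ge0 ?expR_ge0.
  apply: (@le_trans _ _ (\esum_(h in SL) ((fine (psum (GR r) s) * c)%:E *
      (expR (- s * len h))%:E))%E).
    apply: le_esum => h _; under eq_esum do rewrite EFinM.
    apply: le_trans (esumZl_le _ _ (psum_term_ge0 s)) _.
      by rewrite mulr_ge0 ?expR_ge0.
    by rewrite -/(psum (GR r) s) -{1}(fineK (fP r)) -!EFinM lee_fin mulrC mulrA.
  apply: le_trans (esumZl_le _ _ (psum_term_ge0 s)) _.
    by rewrite mulr_ge0 ?expR_ge0 ?fine_ge0 ?esum_ge0.
  rewrite mulrC EFinM fineK // muleAC lee_wpmul2r //.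
  exact: esum_ge0.
have P2A r : (psum (GR r) s <= 2%:E * A)%E.
  have := GR_rec r; rewrite -(fineK (fP r)) -(fineK fA) -!EFinM -EFinD !lee_fin; lra.
have : (psum Gamma s <= 2%:E * A)%E.
  apply: ge_ereal_sup => _ [E [finE EG] <-].
  have [r hr] := finite_set_ub len finE; apply: le_trans (P2A r).
  rewrite -esum_fset //; apply: esum_subset (psum_term_ge0 s) => g Eg.
  by split; [exact: EG|exact: hr].
rewrite poincare_infty // leye_eq => /eqP.
by rewrite -(fineK fA) -EFinM.
Qed.

End cocompact.
End poincare_series.

(** * Branching of the orbit and positivity of the critical exponent *)

Section critical_exponent_positive.
Context {R : realType} {X : metricType R}.
Variable delta : R.
Hypothesis hX : hyperbolic delta X.
Hypothesis properX : proper_space X.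
Hypothesis geodesicX : geodesic_space X.
Variables (Gamma : set (X -> X)) (x : X) (alpha : R).
Hypothesis GammaI : isometry_group Gamma.
Hypothesis crit : critical_exponent Gamma x = alpha%:E.
Hypothesis qc : quasiconvex_cocompact Gamma x.
Hypothesis nonel : nonelementary Gamma x.
Implicit Types (y z : X) (u v w : gbdry X) (g h : X -> X) (s t : R).

Let len g := mdist x (g x).

Lemma limit_set_triple : exists (xi : 'I_3 -> gbdry X) (r : R), 0 <= r /\
  (forall i, limit_set Gamma x (xi i)) /\
  forall i j, i != j -> ~ gge x (inB (xi i)) (inB (xi j)) r.
Proof.
have [u [v [w [[uL vL wL] [uv vw uw]]]]] := three_points nonel.
have [r1 h1] := gge_neq hX x uv; have [r2 h2] := gge_neq hX x vw.
have [r3 h3] := gge_neq hX x uw.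
pose r := Num.max 0 (Num.max r1 (Num.max r2 r3)).
have le1 : r1 <= r by rewrite !le_max lexx !orbT.
have le2 : r2 <= r by rewrite !le_max lexx !orbT.
have le3 : r3 <= r by rewrite !le_max lexx !orbT.
exists (fun i => if i == 0%N :> nat then u else if i == 1%N :> nat then v else w), r.
split; first by rewrite le_max lexx.
split=> [i|i j]; first by do 2 case: ifP => _ //.
case: i j => [[|[|[|//]]] ?] [[|[|[|//]]] ?] // _ /= h.
- exact: h1 (gge_le h le1).
- exact: h3 (gge_le h le3).
- exact: h1 (gge_le (gge_sym h) le1).
- exact: h2 (gge_le h le2).
- exact: h3 (gge_le (gge_sym h) le3).
- exact: h2 (gge_le (gge_sym h) le2).
Qed.

(* Seen from any point [z], at most one of three separated directions is the direction
   of [z]; the other two give group elements of length about [T] that move away from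
   [z]. *)
Lemma orbit_branching : exists r C : R, [/\ 0 <= r, 0 <= C & forall T, r <= T ->
  forall z, exists h1 h2, [/\ Gamma h1 /\ Gamma h2,
    T - C <= len h1 <= T + C /\ T - C <= len h2 <= T + C,
    gromov x (h1 x) z <= r /\ gromov x (h2 x) z <= r &
    gromov x (h1 x) (h2 x) <= r]].
Proof.
have [xi [r0 [r00 [xiL xir]]]] := limit_set_triple.
have d0 := hyperbolic_ge0 hX x.
have xi01 : xi ord0 <> xi ord_max.
  by move=> E; apply: (xir ord0 ord_max) => //; rewrite E; exact: gge_diag hX _ _ _.
have [C C0 hC] := limit_point_conical hX properX geodesicX GammaI qc (xiL ord0) (xiL ord_max) xi01.
exists (r0 + 3 * delta + 1 + C), C; split => // [|T rT z]; first lra.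
have T0 : 0 <= T by lra.
have /choice[ga hga] : forall i, exists g, [/\ Gamma g, mdist x (g x) <= T + C &
    gge x (inB (xi i)) (inX (g x)) (T - C)] by move=> i; exact: hC.
have lenT i : T - C <= len (ga i) <= T + C.
  by have [_ h1 h2] := hga i; apply/andP; split; [exact: gge_ub h2|exact: h1].
have far i p : r0 + 2 * delta + 1 < gromov x (ga i x) p ->
    gge x (inB (xi i)) (inX p) (r0 + delta).
  move=> h; have [_ _ h2] := hga i.
  have h3 : gge x (inX (ga i x)) (inX p) (r0 + 2 * delta) by apply: pt_gge; lra.
  have h2' : gge x (inB (xi i)) (inX (ga i x)) (r0 + 2 * delta).
    by refine (gge_le h2 _); lra.
  by refine (gge_le (gge_tri hX h2' h3) _); lra.
have sep i j : i != j -> gromov x (ga i x) (ga j x) <= r0 + 3 * delta + 1 + C.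
  move=> ij; rewrite leNgt; apply/negP => h; apply: (xir i j ij).
  have h1 : gge x (inB (xi i)) (inX (ga j x)) (r0 + delta) by apply: far; lra.
  have [_ _ h2] := hga j.
  have h2' : gge x (inX (ga j x)) (inB (xi j)) (r0 + delta).
    by apply: gge_sym; refine (gge_le h2 _); lra.
  by refine (gge_le (gge_tri hX h1 h2') _); lra.
have one i j : i != j -> gromov x (ga i x) z <= r0 + 3 * delta + 1 + C \/
    gromov x (ga j x) z <= r0 + 3 * delta + 1 + C.
  move=> ij; have [|hi] := leP (gromov x (ga i x) z) (r0 + 3 * delta + 1 + C); first by left.
  right; rewrite leNgt; apply/negP => hj; apply: (xir i j ij).
  have h1 : gge x (inB (xi i)) (inX z) (r0 + delta) by apply: far; lra.
  have h2 : gge x (inX z) (inB (xi j)) (r0 + delta) by apply: gge_sym; apply: far; lra.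
  by refine (gge_le (gge_tri hX h1 h2) _); lra.
have [i [j [ij hi hj]]] : exists i j, [/\ i != j,
    gromov x (ga i x) z <= r0 + 3 * delta + 1 + C &
    gromov x (ga j x) z <= r0 + 3 * delta + 1 + C].
  pose i1 : 'I_3 := inord 1.
  have i01 : ord0 != i1 by rewrite -val_eqE /= inordK.
  have i12 : i1 != ord_max by rewrite -val_eqE /= inordK.
  have i02 : (ord0 : 'I_3) != ord_max by [].
  have [a|a] := one _ _ i01.
    have [b|b] := one _ _ i12; first by exists ord0, i1.
    by exists ord0, ord_max.
  have [b|b] := one _ _ i02; first by exists ord0, i1.
  by exists i1, ord_max.
exists (ga i), (ga j); split; last exact: sep.
- by have [? _ _] := hga i; have [? _ _] := hga j.
- by split; exact: lenT.
- by [].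
Qed.

(** If [alpha] were 0, the series would converge at every positive exponent. But every [g] has two
    children, longer by at most [T + C], with disjoint shadows inside its own, so at a small
    exponent the sum over a shadow exceeds every power of 3/2. *)
Lemma critical_exponent_gt0 : 0 < alpha.
Proof.
rewrite lt_neqAle (critical_exponent_ge0 crit) andbT; apply/eqP => alE.
have d0 := hyperbolic_ge0 hX x.
have [r [C [r0 C0 branch]]] := orbit_branching.
pose r2 := r + delta.
(* Children must be longer than [g] by enough that their shadows see past [g x] and past the point
   where the two branches separate. *)
pose T := C + 3 * r + r2 + delta + 1.
have rT : r <= T by rewrite /T /r2; lra.
pose Sh g := [set h | Gamma h /\ len g - r2 <= gromov x (g x) (h x)].
have children g : Gamma g -> exists h1 h2, [/\ Gamma h1 /\ Gamma h2,
    len h1 <= len g + (T + C) /\ len h2 <= len g + (T + C),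
    Sh h1 `<=` Sh g, Sh h2 `<=` Sh g & Sh h1 `&` Sh h2 = set0].
  move=> Gg; have [k [Gk gk kg]] := invG GammaI Gg.
  have [h1 [h2 [[G1 G2] [/andP[l1 l1'] /andP[l2 l2']] [z1 z2] h12]]] := branch T rT (k x).
  have lk : mdist x (k x) = len g by rewrite -(isometryG GammaI Gg) kg metric_sym.
  have lenE h : len (g \o h) = mdist (h x) (k x).
    by rewrite /len -(isometryG GammaI Gg (h x)) kg metric_sym.
  have len_ub h : len (g \o h) <= len g + len h.
    rewrite lenE -lk /len; have := metric_triangle (h x) x (k x).
    by rewrite (metric_sym (h x) x); lra.
  have len_lb h : gromov x (h x) (k x) <= r -> len g + len h - 2 * r <= len (g \o h).
    by rewrite lenE /gromov -lk /len; lra.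
  have dE h : mdist (g x) (g (h x)) = len h by rewrite (isometryG GammaI Gg).
  have sub h : T - C <= len h -> gromov x (h x) (k x) <= r -> Sh (g \o h) `<=` Sh g.
    move=> lh zh f [Gf hf]; split => //.
    have lb := len_lb h zh.
    have h3 : len g - r <= gromov x (g x) (g (h x)).
      by rewrite /gromov dE -/(len g) -/(len (g \o h)); lra.
    have h4 : len g - r <= gromov x (g (h x)) (f x).
      by apply: le_trans hf; rewrite /T in lh; lra.
    by have := hyperbolicP hX h3 h4; rewrite /r2; lra.
  exists (g \o h1), (g \o h2); split; [|split| exact: sub | exact: sub |].
  - by split; exact: compG.
  - by have := len_ub h1; lra.
  - by have := len_ub h2; lra.
  apply/seteqP; split => // f [[_ f1] [_ f2]].
  have lb1 := len_lb h1 z1; have lb2 := len_lb h2 z2.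
  have f1' : len g + r + delta + 1 <= gromov x (g (h1 x)) (f x).
    by apply: le_trans f1; rewrite /T in l1; lra.
  have f2' : len g + r + delta + 1 <= gromov x (f x) (g (h2 x)).
    by rewrite gromovC; apply: le_trans f2; rewrite /T in l2; lra.
  have := hyperbolicP hX f1' f2'.
  have : gromov (g x) (g (h1 x)) (g (h2 x)) = gromov x (h1 x) (h2 x).
    exact/gromov_isom/(isometryG GammaI).
  have := gromov_base x (g x) (g (h1 x)) (g (h2 x)); rewrite -/(len g); lra.
have TC0 : 0 < T + C by rewrite /T /r2; lra.
(* With [s * (T + C) = 1/4], the growth factor [2 * expR (- 1/4)] is at least
   [2 * (1 - 1/4) = 3/2]. *)
pose s := (T + C)^-1 / 4.
have s0 : 0 < s by rewrite !divr_gt0 ?invr_gt0.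
have sTC : s * (T + C) = 4^-1 by rewrite /s mulrAC mulVf ?gt_eqF // mul1r.
pose a g : \bar R := (expR (- s * len g))%:E.
have a0 g : (0 <= a g)%E by rewrite lee_fin expR_ge0.
have theta : (3 / 2 : R) <= 2 * expR (- (s * (T + C))).
  have := expR_ge1Dx (- (s * (T + C))); rewrite sTC; lra.
have grow n : forall g, Gamma g ->
    (((3 / 2) ^+ n * expR (- s * len g))%:E <= \esum_(h in Sh g) a h)%E.
  elim: n => [|n IH] g Gg.
    rewrite expr0 mul1r -/(a g) -(esum_set1 (a0 g)).
    apply: esum_subset => // _ ->; split => //.
    by rewrite /gromov metric_structure.mdistxx -/(len g) /r2; lra.
  have [h1 [h2 [[G1 G2] [l1 l2] s1 s2 s12]]] := children g Gg.
  apply: (@le_trans _ _ (\esum_(h in Sh h1 `|` Sh h2) a h)%E); last first.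
    by apply: esum_subset => // h [/s1|/s2].
  rewrite -esumU_disjoint //.
  apply: le_trans (leeD (IH h1 G1) (IH h2 G2)).
  rewrite -EFinD lee_fin -mulrDr exprSr -mulrA ler_wpM2l ?exprn_ge0 //.
  pose E := expR (- s * (len g + (T + C))).
  have E1 h : len h <= len g + (T + C) -> E <= expR (- s * len h).
    by move=> lh; rewrite ler_expR; have := ler_wpM2l (ltW s0) lh; lra.
  have EE : E = expR (- s * len g) * expR (- (s * (T + C))).
    by rewrite /E -expRD; congr expR; lra.
  have := E1 _ l1; have := E1 _ l2; rewrite EE.
  have := ler_wpM2r (expR_ge0 (- s * len g)) theta; lra.
have Pfin : (\esum_(g in Gamma) a g < +oo)%E by apply: (poincare_fin crit); rewrite -alE.
have fP : (\esum_(g in Gamma) a g)%E \is a fin_num.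
  by rewrite ge0_fin_numE //; exact: esum_ge0.
pose P := fine (\esum_(g in Gamma) a g)%E.
have ub n : (3 / 2) ^+ n <= P.
  rewrite -lee_fin /P fineK //.
  have := grow n id (idG GammaI); rewrite /len metric_structure.mdistxx mulr0 expR0 mulr1.
  by move=> /le_trans; apply; apply: esum_subset => // h [].
have lb n : n%:R / 2 <= (3 / 2) ^+ n :> R.
  suff : 1 + n%:R / 2 <= (3 / 2) ^+ n :> R by lra.
  elim: n => [|n IH]; first by rewrite expr0; lra.
  rewrite exprSr -natr1; have : 0 <= n%:R :> R by []; lra.
have := le_trans (lb (Num.truncn (2 * P)).+1) (ub _).
have := truncnS_gt (2 * P); lra.
Qed.

End critical_exponent_positive.

(** * Quasi-conformal densities *)

Section ae_bounds.
Context {d : measure_display} {T : measurableType d} {R : realType}.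
Variable mu : {measure set T -> \bar R}.
Local Open Scope ereal_scope.

(** Radon-Nikodym densities are bounded only almost everywhere, while comparison of integrals wants
    a sign everywhere; the maximum with 0 supplies it. *)
Lemma ae_pos_integral (A : set T) (g : T -> \bar R) : measurable A ->
  measurable_fun A g -> (\forall x \ae mu, A x -> 0 <= g x) ->
  \int[mu]_(x in A) g x = \int[mu]_(x in A) maxe (g x) 0.
Proof.
move=> mA mg g0; apply: ae_eq_integral => //.
  by apply: measurable_maxe => //; exact: measurable_cst.
by apply: filterS g0 => x h /h ?; rewrite max_l.
Qed.

Lemma integral_ae_lb (A : set T) (g : T -> \bar R) (c : R) : measurable A ->
  measurable_fun A g -> (0 <= c)%R -> (\forall x \ae mu, A x -> c%:E <= g x) ->
  c%:E * mu A <= \int[mu]_(x in A) g x.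
Proof.
move=> mA mg c0 cg; rewrite -integral_cst // (@ae_pos_integral A g) //; last first.
  by apply: filterS cg => x h /h h2; apply: le_trans h2; rewrite lee_fin.
apply: ae_ge0_le_integral => //.
- by move=> x _; rewrite le_max lexx orbT.
- by apply: measurable_maxe => //; exact: measurable_cst.
- by apply: filterS cg => x h /h h2; rewrite le_max h2.
Qed.

Lemma integral_ae_ub (A : set T) (g : T -> \bar R) (c : R) : measurable A ->
  measurable_fun A g -> (0 <= c)%R -> (\forall x \ae mu, A x -> 0 <= g x <= c%:E) ->
  \int[mu]_(x in A) g x <= c%:E * mu A.
Proof.
move=> mA mg c0 cg; rewrite -integral_cst // (@ae_pos_integral A g) //; last first.
  by apply: filterS cg => x h /h /andP[].
apply: ae_ge0_le_integral => //.
- by move=> x _; rewrite le_max lexx orbT.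
- by apply: measurable_maxe => //; exact: measurable_cst.
- by apply: filterS cg => x h /h /andP[? ?]; rewrite ge_max /= lee_fin c0 andbT.
Qed.

Lemma sum_measure_multiplicity (I : eqType) (s : seq I) (B : I -> set T) (D : set T)
    (M : R) : measurable D -> (forall i, measurable (B i)) ->
  (forall i, B i `<=` D) -> (0 <= M)%R ->
  (forall x, D x -> (\sum_(i <- s) \1_(B i) x <= M)%R) ->
  \sum_(i <- s) mu (B i) <= M%:E * mu D.
Proof.
move=> mD mB BD M0 hM.
rewrite (eq_bigr (fun i => \int[mu]_(x in D) (\1_(B i) x)%:E)); last first.
  by move=> i _; rewrite integral_indic // (setIidl (BD i)).
rewrite -ge0_integral_sum //; last first.
  by move=> i; apply/measurable_EFinP; exact: measurable_indic.
rewrite -integral_cst //; apply: ge0_le_integral => //.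
- by move=> x _; apply: sume_ge0 => i _; rewrite lee_fin.
- apply: emeasurable_sum => i; apply/measurable_EFinP; exact: measurable_indic.
- by move=> x Dx; rewrite sumEFin lee_fin; exact: hM.
Qed.

End ae_bounds.

(** * Borel sets of the boundary and visual balls *)

Section boundary_measurable.
Context {R : realType} {X : pmetricType R}.
Variables (delta eps : R) (x : X) (rho : gbdry X -> gbdry X -> R).
Hypothesis hX : hyperbolic delta X.
Hypothesis eps0 : 0 < eps.
Hypothesis vis : visual_metric x eps rho.
Implicit Types (u v w : gbdry X) (O : set (gbdry X)).

Definition bset (O : set (gbdry X)) : set (borel_gbar X) := inB @` O.

Lemma bsetC O : bset (~` O) = @bdry_set R X `\` bset O.
Proof.
apply/seteqP; split=> [_ [v Ov <-]|_ [[v _ <-] nO]].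
  by split; [exists v|move=> [w Ow [wv]]; apply: Ov; rewrite -wv].
by exists v => // Ov; apply: nO; exists v.
Qed.

Lemma bset_sub O : bset O `<=` @bdry_set R X.
Proof. by move=> _ [v _ <-]; exists v. Qed.

(** A neighbourhood of a boundary point in the compactification may also contain points of [X];
    adding all of [X] removes every condition except the one on the boundary. *)
Lemma gbar_open_bset O : (forall v, O v -> exists t, forall u,
    gge x (inB v) (inB u) t -> O u) ->
  @open (gbar X) (range (@inX R X) `|` (@inB R X) @` O).
Proof.
move=> hO; split.
  rewrite (_ : _ @^-1` _ = setT); first exact: openT.
  by apply/seteqP; split=> // y _; left; exists y.
move=> v [[y _] //|[w Ow [wv]]] y; subst w; have [t ht] := hO v Ow.
exists (t + mdist y x + 2 * delta + 3) => p /ltW/(gge_gprod hX).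
move=> /(@gge_base _ _ _ x) h; case: p h => [z|u] h; first by left; exists z.
by right; exists u => //; apply: ht; refine (gge_le h _); lra.
Qed.

Lemma measurable_bdry : measurable (@bdry_set R X).
Proof.
rewrite (_ : bdry_set = ~` (range (@inX R X))).
  apply: measurableC; apply: sub_sigma_algebra.
  have := @gbar_open_bset set0 (fun v h => match h with end).
  by rewrite image_set0 setU0.
apply/seteqP; split=> [_ [v _ <-] [y _] //|[y ny|v _]]; last by exists v.
by exfalso; apply: ny; exists y.
Qed.

Lemma measurable_bset O : (forall v, O v -> exists t, forall u,
    gge x (inB v) (inB u) t -> O u) -> measurable (bset O).
Proof.
move=> /gbar_open_bset oO.
rewrite (_ : bset O = (range (@inX R X) `|` (@inB R X) @` O) `&` bdry_set).
  by apply: measurableI; [exact: sub_sigma_algebra|exact: measurable_bdry].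
apply/seteqP; split=> [p Op|p [[[y _ <-] [v _] //|Op] _]] //.
by split; [right|exact: bset_sub Op].
Qed.

Lemma visual_gge : exists2 c : R, 1 <= c & forall u v t,
  (gge x (inB u) (inB v) t -> rho u v <= c * expR (- eps * t)) /\
  (rho u v < c^-1 * expR (- eps * t) -> gge x (inB u) (inB v) t).
Proof.
have [rhom [cm cm0 hcm]] := vis; have d0 := hyperbolic_ge0 hX x.
(* The exponential converts the additive loss of [gge_gprod] into a factor at the scale of [rho]. *)
pose c := Num.max 1 (cm * expR (eps * (2 * delta + 3))).
have c1 : 1 <= c by rewrite le_max lexx.
have c2 : cm * expR (eps * (2 * delta + 3)) <= c by rewrite le_max lexx orbT.
have e1 : 1 <= expR (eps * (2 * delta + 3)).
  by rewrite -[leLHS]expR0 ler_expR mulr_ge0 //; [exact: ltW|lra].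
exists c => // u v t; split=> [/gprod_gge h|h].
  have /andP[_] := hcm u v.
  have : (expeR (- (eps%:E * gprod x (inB u) (inB v))) <= (expR (- eps * t))%:E)%E.
    rewrite -[leRHS]/(expeR (- eps * t)%:E) ler_expeR mulNr EFinN leeN2 EFinM.
    by rewrite lee_pmul2l.
  move=> h1 h2; rewrite -lee_fin; apply: le_trans h2 _; rewrite EFinM.
  have cmc : cm <= c by apply: le_trans c2; rewrite ler_peMr // ltW.
  by apply: lee_pmul => //; rewrite ?expeR_ge0 ?lee_fin //; exact: ltW.
suff : ((t + 2 * delta + 3)%:E <= gprod x (inB u) (inB v))%E.
  by move=> /(gge_gprod hX) h'; refine (gge_le h' _); lra.
rewrite leNgt; apply/negP => h'; have /andP[h1 _] := hcm u v.
have h2 : cm^-1 * expR (- eps * (t + 2 * delta + 3)) <= rho u v.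
  rewrite -lee_fin; apply: le_trans h1; rewrite EFinM.
  apply: lee_wpmul2l; first by rewrite lee_fin invr_ge0 ltW.
  rewrite -[leLHS]/(expeR (- eps * (t + 2 * delta + 3))%:E) ler_expeR mulNr EFinN leeN2.
  by rewrite EFinM lee_pmul2l // ltW.
have h3 : c^-1 * expR (- eps * t) <= cm^-1 * expR (- eps * (t + 2 * delta + 3)).
  rewrite (_ : - eps * (t + 2 * delta + 3) = - eps * t - eps * (2 * delta + 3)); last by ring.
  rewrite expRD expRN mulrCA mulrC ler_wpM2l ?expR_ge0 // -invfM.
  by rewrite lef_pV2 // posrE ?mulr_gt0 ?expR_gt0 //; lra.
lra.
Qed.

Lemma visual_scale t : exists2 tau : R, 0 < tau & forall u v, rho u v < tau ->
  gge x (inB u) (inB v) t.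
Proof.
have [c c1 hc] := visual_gge.
exists (c^-1 * expR (- eps * t)); first by rewrite mulr_gt0 ?expR_gt0 ?invr_gt0 //; lra.
by move=> u v; have [_] := hc u v t.
Qed.

Lemma visual_scale_inv r : 0 < r -> exists t, forall u v,
  gge x (inB u) (inB v) t -> rho u v < r.
Proof.
move=> r0; have [c c1 hc] := visual_gge.
exists ((ln (c / r) + 1) / eps) => u v /(proj1 (hc u v _)).
have c0 : 0 < c by lra.
move=> /le_lt_trans; apply.
have -> : - eps * ((ln (c / r) + 1) / eps) = - ln (c / r) - 1.
  by rewrite mulNr mulrC divfK ?gt_eqF // opprD.
rewrite expRD expRN lnK ?posrE ?divr_gt0 // invf_div mulrA [c * _]mulrC divfK ?gt_eqF //.
by rewrite gtr_pMr // expR_lt1; lra.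
Qed.

Lemma rhoxx v : rho v v = 0. Proof. by have [[_ h _ _] _] := vis; apply/h. Qed.
Lemma rhoC u v : rho u v = rho v u. Proof. by have [[]] := vis. Qed.
Lemma rho_triangle u v w : rho u w <= rho u v + rho v w.
Proof. by have [[]] := vis. Qed.

Lemma measurable_rho_open O : (forall v, O v -> exists2 r, 0 < r &
    forall u, rho v u < r -> O u) -> measurable (bset O).
Proof.
move=> hO; apply: measurable_bset => v /hO[r r0 hr].
by have [t ht] := visual_scale_inv r0; exists t => u /ht/hr.
Qed.

Lemma measurable_rho_ball v r : measurable (bset [set u | rho v u < r]).
Proof.
apply: measurable_rho_open => u /= vu; exists (r - rho v u); first by rewrite subr_gt0.
by move=> z uz; have := rho_triangle v u z; rewrite /=; lra.
Qed.

End boundary_measurable.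

Section busemann_bounds.
Context {R : realType} {X : metricType R}.
Variable delta : R.
Hypothesis hX : hyperbolic delta X.
Implicit Types (x y : X) (p : gbar X).

Lemma busemann_le p x y : busemann p x y <= mdist x y.
Proof.
have := gprod_ub x p y; rewrite -gprod_fin lee_fin /busemann; lra.
Qed.

Lemma busemann_ge p x y : - mdist x y <= busemann p x y.
Proof.
have := gprod_gge (gge0 x p (inX y)); rewrite -gprod_fin lee_fin /busemann; lra.
Qed.

Lemma busemann_lb p x y t : gge x p (inX y) t -> 2 * t - mdist x y <= busemann p x y.
Proof.
move=> /gprod_gge; rewrite -gprod_fin lee_fin /busemann; lra.
Qed.

Lemma busemann_ub p x y t : ~ gge x p (inX y) t ->
  busemann p x y <= 2 * (t + 2 * delta + 3) - mdist x y.
Proof.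
move=> h; rewrite /busemann lerD2r ler_pM2l // -lee_fin gprod_fin leNgt.
apply/negP => /ltW/(gge_gprod hX) h'; apply: h; refine (gge_le h' _); lra.
Qed.

End busemann_bounds.

(** * Wandering sets, shadows and Ahlfors regularity *)

Section quasiconformal.
Context {R : realType} {X : pmetricType R}.
Variables (delta eps alpha : R) (x : X) (rho : gbdry X -> gbdry X -> R).
Variable Gamma : set (X -> X).
Variable mu : X -> {finite_measure set (borel_gbar X) -> \bar R}.
Hypothesis hX : hyperbolic delta X.
Hypothesis properX : proper_space X.
Hypothesis geodesicX : geodesic_space X.
Hypothesis GammaI : isometry_group Gamma.
Hypothesis crit : critical_exponent Gamma x = alpha%:E.
Hypothesis qc : quasiconvex_cocompact Gamma x.
Hypothesis nonel : nonelementary Gamma x.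
Hypothesis eps0 : 0 < eps.
Hypothesis vis : visual_metric x eps rho.
Hypothesis qcd : quasiconformal_density mu Gamma alpha.
Implicit Types (u v w : gbdry X) (O : set (gbdry X)) (A : set (borel_gbar X)).

Let d0 : 0 <= delta. Proof. exact: hyperbolic_ge0 hX x. Qed.
Let alpha_gt0 : 0 < alpha.
Proof. exact (critical_exponent_gt0 hX properX geodesicX GammaI crit qc nonel). Qed.

Lemma measurable_density y z : measurable_fun setT (density mu y z).
Proof.
have [[Cq _ /(_ y z)[_ dom _]] _] := qcd.
by have /integrableP[] := @Radon_Nikodym_integrable _ _ _
  (charge_of_finite_measure (mu z)) (mu y) dom.
Qed.

Lemma density_integral y z A : measurable A ->
  mu z A = (\int[mu y]_(p in A) density mu y z p)%E.
Proof.
move=> mA; have [[Cq _ /(_ y z)[_ dom _]] _] := qcd.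
exact: (@Radon_Nikodym_integral _ _ _ (charge_of_finite_measure (mu z)) (mu y)).
Qed.

Lemma density_bounds : exists2 Cq : R, 1 <= Cq & forall y,
  (forall A lo, measurable A -> (forall p, A p -> lo <= busemann p x y) ->
    ((Cq^-1 * expR (alpha * lo))%:E * mu x A <= mu y A)%E) /\
  (forall A up, measurable A -> (forall p, A p -> busemann p x y <= up) ->
    (mu y A <= (Cq * expR (alpha * up))%:E * mu x A)%E).
Proof.
have [[Cq0 Cq0_gt0 hCq] _] := qcd; pose Cq := Num.max 1 Cq0.
have Cq1 : 1 <= Cq by rewrite le_max lexx.
have CqC : Cq0 <= Cq by rewrite le_max lexx orbT.
exists Cq => // y; have [_ _ hae] := hCq x y.
have md A : measurable A -> measurable_fun A (density mu x y).
  by move=> mA; apply: measurable_funS (measurable_density x y).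
split=> A lo mA hA; rewrite (density_integral x y mA).
  apply: integral_ae_lb => //; first exact: md.
    by rewrite mulr_ge0 ?expR_ge0 // invr_ge0; lra.
  apply: (@filterS _ _ (ae_filter_ringOfSetsType (mu x)) _ _ _ hae) => p /andP[h _] /hA lop;
    apply: le_trans h; rewrite lee_fin.
  apply: ler_pM; rewrite ?expR_ge0 ?invr_ge0 //; first lra.
    by rewrite lef_pV2 // posrE; lra.
  by rewrite ler_expR ler_wpM2l // ltW.
apply: integral_ae_ub => //; first exact: md.
  by rewrite mulr_ge0 ?expR_ge0 //; lra.
apply: (@filterS _ _ (ae_filter_ringOfSetsType (mu x)) _ _ _ hae) => p /andP[h1 h2] /hA pup;
  apply/andP; split.
  by apply: le_trans h1; rewrite lee_fin mulr_ge0 ?expR_ge0 // invr_ge0 ltW.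
apply: le_trans h2 _; rewrite lee_fin; apply: ler_pM; rewrite ?expR_ge0 //.
  exact: ltW.
by rewrite ler_expR ler_wpM2l // ltW.
Qed.

Lemma measurable_gbar_map g A : Gamma g -> measurable A ->
  measurable ((gbar_map g : borel_gbar X -> borel_gbar X) @^-1` A).
Proof.
move=> Gg mA; have gc := continuous_gbar_map hX (isometryG GammaI Gg).
pose S := [set B : set (borel_gbar X) |
  measurable ((gbar_map g : borel_gbar X -> borel_gbar X) @^-1` B)].
suff : measurable `<=` S by apply.
apply: smallest_sub.
  split.
  - by rewrite /S /= preimage_set0; exact: measurable0.
  - by move=> B SB; rewrite /S /= setTD preimage_setC; exact: measurableC.
  - move=> F SF; rewrite /S /= preimage_bigcup; apply: bigcup_measurable => k _; exact: SF.
move=> U oU; apply: sub_sigma_algebra.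
by have /continuousP := gc; apply.
Qed.

(** By equivariance the preimage has mass [mu (g x) A], so only the Busemann function between [x]
    and [g x] matters. It is between minus and plus the distance, close to the upper value on the
    shadow of [g x] and to the lower value away from it. *)
Lemma quasi_invariance : exists2 C : R, 1 <= C & forall g A, Gamma g ->
  measurable A -> let P := (gbar_map g : borel_gbar X -> borel_gbar X) @^-1` A in
  [/\ ((C^-1 * expR (- alpha * mdist x (g x)))%:E * mu x A <= mu x P)%E,
      (mu x P <= (C * expR (alpha * mdist x (g x)))%:E * mu x A)%E,
      forall k, (forall p, A p -> gge x p (inX (g x)) (mdist x (g x) - k)) ->
        ((C^-1 * expR (alpha * (mdist x (g x) - 2 * k)))%:E * mu x A <= mu x P)%E &
      forall k, (forall p, A p -> ~ gge x p (inX (g x)) k) ->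
        (mu x P <= (C * expR (alpha * (2 * (k + 2 * delta + 3) - mdist x (g x))))%:E *
          mu x A)%E].
Proof.
have [C C1 hC] := density_bounds; exists C => // g A Gg mA P.
have -> : mu x P = mu (g x) A by have [_ <-] := qcd.
have [lb ub] := hC (g x); split.
- by rewrite mulNr -mulrN; apply: lb => // p _; exact: busemann_ge.
- by apply: ub => // p _; exact: busemann_le.
- by move=> k hk; apply: lb => // p /hk/busemann_lb; lra.
- by move=> k hk; apply: ub => // p /hk/(busemann_ub hX); lra.
Qed.

Lemma limit_set_two : exists v1 v2, [/\ limit_set Gamma x v1, limit_set Gamma x v2 & v1 <> v2].
Proof.
by have [u [v [w [[? ? _] [? _ _]]]]] := three_points nonel; exists u, v.
Qed.

(* The sum over the group of [exp (- s * d)] bounds the number of [g] whose inverses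
   move [x] into a given ball. *)
Lemma orbit_sum_bound s (inv : (X -> X) -> X -> X) g1 :
  (forall g, Gamma g -> [/\ Gamma (inv g), cancel g (inv g) & cancel (inv g) g]) ->
  Gamma g1 ->
  (\esum_(g in Gamma) (expR (- s * mdist (inv g1 x) (inv g x)))%:E <=
   \esum_(g in Gamma) (expR (- s * mdist x (g x)))%:E)%E.
Proof.
move=> hinv G1; have [Gi1 i1 i1'] := hinv _ G1.
pose psi h : \bar R := (expR (- s * mdist (inv g1 x) (h x)))%:E.
have psi0 h : (0 <= psi h)%E by rewrite lee_fin expR_ge0.
have invi : set_inj Gamma inv.
  move=> g h /set_mem Gg /set_mem Gh E; apply/funext => y.
  have [_ _ ig] := hinv g Gg; have [_ ih _] := hinv h Gh.
  by rewrite -{1}(ih y) -E ig.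
rewrite -(@esum_image _ _ _ Gamma inv psi invi).
apply: (@le_trans _ _ (\esum_(g in Gamma) psi g)%E).
  by apply: esum_subset => // _ [g Gg <-]; have [] := hinv g Gg.
apply: le_trans (@esum_image_le _ _ _ Gamma Gamma (fun k => inv g1 \o k) psi _ psi0) _.
  move=> g Gg; exists (g1 \o g); first exact: compG.
  by apply/funext => y /=; rewrite i1.
by apply: le_esum => g Gg; rewrite /psi /= (isometryG GammaI Gi1).
Qed.

Let m := mu x (@bdry_set R X).

Lemma bdry_fin : m \is a fin_num.
Proof. exact: fin_num_measure (@measurable_bdry R X delta x hX). Qed.

(** The preimages of [A] under the group overlap boundedly, so their masses have a finite sum; each
    is at least a multiple of [expR (- alpha * mdist x (g x))] times the mass of [A], and the
    Poincare series diverges. *)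
Lemma wandering_null A t : measurable A -> A `<=` @bdry_set R X ->
  (forall p g, A p -> Gamma g -> ~ gge x p (inX (g x)) t) -> mu x A = 0%E.
Proof.
move=> mA Ab wA; have [C C1 hC] := quasi_invariance.
have /choice[inv hinv] : forall g, exists h, Gamma g ->
    [/\ Gamma h, cancel g h & cancel h g].
  move=> g; have [/(invG GammaI)[h ?]|nG] := pselect (Gamma g); first by exists h.
  by exists id.
pose B g := (gbar_map g : borel_gbar X -> borel_gbar X) @^-1` A.
have mB g : Gamma g -> measurable (B g) by move=> Gg; exact: measurable_gbar_map.
have Bb g : B g `<=` @bdry_set R X.
  by move=> [y /Ab[? _] //|v _]; exists v.
pose s := alpha + 1; pose r := 2 * t + 10 * delta + 10.
(* If these two orbit points were far apart, then from one of them, as base point, [p] would be seen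
   in the direction of the other; applying [g] or [h] would put a point of [A] in a forbidden
   shadow. *)
have close p g h : Gamma g -> Gamma h -> B g p -> B h p ->
    mdist (inv g x) (inv h x) <= r.
  move=> Gg Gh Bg Bh; have [Gig ig ig'] := hinv g Gg; have [Gih ih ih'] := hinv h Gh.
  have [k [k1 k2]] := gge_swap hX p (inv g x) (inv h x).
  rewrite leNgt; apply/negP => hr.
  have [k1t|k1t] := leP (t + 5 * delta + 5) k.
    have := gge_isom hX (isometryG GammaI Gg) k1; rewrite /= ig'.
    move=> h1; apply: (wA _ (g \o inv h) Bg); first exact: compG.
    by refine (gge_le h1 _); lra.
  have := gge_isom hX (isometryG GammaI Gh) k2; rewrite /= ih'.
  move=> h1; apply: (wA _ (h \o inv g) Bh); first exact: compG.
  by refine (gge_le h1 _); rewrite /r in hr; lra.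
have Pfin := poincare_fin crit (_ : alpha < s).
have {Pfin}Pfin : (\esum_(g in Gamma) (expR (- s * mdist x (g x)))%:E < +oo)%E.
  by apply: Pfin; rewrite /s ltrDl.
set P := (\esum_(g in Gamma) _)%E in Pfin.
have P0 : (0 <= P)%E by apply: esum_ge0 => g _; rewrite lee_fin expR_ge0.
have fP : P \is a fin_num by rewrite ge0_fin_numE.
pose M := expR (s * r) * fine P.
have M0 : 0 <= M by rewrite mulr_ge0 ?expR_ge0 ?fine_ge0.
have s0 : 0 <= s by rewrite /s; have := alpha_gt0; lra.
(* Elements at distance at most [r] are counted by the series at [s = alpha + 1]: each of its terms
   is at least [expR (- s * r)]. *)
have mult (F : set (X -> X)) p : finite_set F -> F `<=` Gamma ->
    \sum_(g <- finmap.enum_fset (fset_set F)) \1_(B g) p <= M.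
  move=> finF FG; have [[g1 [Fg1 Bg1]]|nB] := pselect (exists g, F g /\ B g p); last first.
    rewrite big_seq big1 // => g; rewrite in_fset_set // inE => Fg.
    by rewrite indicE memNset // => Bg; apply: nB; exists g.
  have G1 := FG _ Fg1.
  rewrite -lee_fin -sumEFin.
  apply: (@le_trans _ _ (\sum_(g \in F) ((expR (s * r))%:E *
      (expR (- s * mdist (inv g1 x) (inv g x)))%:E))%E).
    rewrite fsbig_finite //= big_seq [leRHS]big_seq; apply: lee_sum => g.
    rewrite in_fset_set // inE => Fg; rewrite -EFinM lee_fin indicE.
    have [/set_mem Bg|_] := boolP (p \in B g); last by rewrite mulr_ge0 ?expR_ge0.
    rewrite -expRD -[leLHS]expR0 ler_expR.
    have := ler_wpM2l s0 (close p g1 g G1 (FG _ Fg) Bg1 Bg); lra.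
  rewrite -ge0_mule_fsumr; last by move=> g; rewrite lee_fin expR_ge0.
  rewrite /M EFinM fineK //; apply: lee_wpmul2l; first by rewrite lee_fin expR_ge0.
  apply: le_trans (orbit_sum_bound s hinv G1).
  by apply: ereal_sup_ubound; exists F.
have fA : mu x A \is a fin_num by exact: fin_num_measure.
apply/eqP; rewrite eq_le measure_ge0 andbT leNgt; apply/negP => A0.
have a0 : 0 < fine (mu x A) by rewrite fine_gt0 // A0 /= -ge0_fin_numE.
pose K := C * (M * fine m) / fine (mu x A).
have C0 : 0 < C by lra.
suff : (\esum_(g in Gamma) (expR (- alpha * mdist x (g x)))%:E <= K%:E)%E.
  have [v1 [v2 [v1L v2L v12]]] := limit_set_two.
  rewrite (poincare_diverges hX properX geodesicX GammaI crit qc v1L v2L v12 alpha_gt0).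
  by rewrite leye_eq.
apply: ge_ereal_sup => _ [F [finF FG] <-].
rewrite fsbig_finite //= sumEFin lee_fin.
rewrite ler_pdivlMr // mulr_suml -ler_pdivrMl // mulr_sumr.
pose BG g := if pselect (Gamma g) then B g else set0.
have FE g : g \in finmap.enum_fset (fset_set F) -> Gamma g.
  by rewrite in_fset_set // inE => /FG.
have : (\sum_(g <- finmap.enum_fset (fset_set F)) mu x (BG g) <= M%:E * mu x (@bdry_set R X))%E.
  apply: sum_measure_multiplicity => //.
  - exact: (measurable_bdry x hX).
  - by move=> g; rewrite /BG; case: pselect => [Gg|_] /=; [exact: mB|exact: measurable0].
  - by move=> g; rewrite /BG; case: pselect => [Gg|_] /=; [exact: Bb|exact: sub0set].
  move=> p _; apply: le_trans (mult F p finF FG); rewrite big_seq [leRHS]big_seq.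
  by apply: ler_sum => g /FE Gg; rewrite /BG; case: pselect.
rewrite -[mu x bdry_set]/m -(fineK bdry_fin) -EFinM => h.
rewrite -lee_fin; apply: le_trans h; rewrite -sumEFin big_seq [leRHS]big_seq.
apply: lee_sum => g /FE Gg; rewrite /BG; case: pselect => // ?.
have [h1 _ _ _] := hC g A Gg mA.
by rewrite mulrA EFinM fineK.
Qed.

(** A point off the limit set is outside all shadows of some level. The shadows are thickened into
    [rho]-open sets [O n] so that the complements, which wander at level [n], are measurable. *)
Lemma limit_set_full : (mu x).-negligible (bset (~` limit_set Gamma x)).
Proof.
pose V n := [set v | exists2 g, Gamma g & gge x (inB v) (inX (g x)) n%:R].
have /choice[tau htau] : forall n, exists t, 0 < t /\ forall u v, rho u v < t ->
    gge x (inB u) (inB v) n%:R.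
  by move=> n; have [t t0 ht] := visual_scale hX eps0 vis n%:R; exists t.
pose O n := [set u | exists2 v, V n v & rho u v < tau n].
have mO n : measurable (bset (O n)).
  apply: (measurable_rho_open hX eps0 vis) => u [v Vv uv]; exists (tau n - rho u v).
    by rewrite subr_gt0.
  move=> z uz; exists v => //; have := rho_triangle vis z u v; rewrite (rhoC vis z u); lra.
apply: (@negligibleS _ _ _ (mu x) (\bigcup_n (bset (~` O n)))).
  move=> _ [v nv <-].
  have [t ht] : exists t, forall g, Gamma g -> ~ gge x (inB v) (inX (g x)) t.
    apply: contrapT => h; apply: nv; apply/(limit_setP hX Gamma x v) => t.
    by apply: contrapT => ht; apply: h; exists t => g Gg hg; apply: ht; exists g.
  pose n := (Num.truncn (Num.max 0 (t + delta))).+1.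
  have tn : t + delta <= n%:R.
    apply: ltW; apply: le_lt_trans (truncnS_gt _).
    by rewrite le_max lexx orbT.
  exists n => //; exists v => // -[u [g Gg ug] /(proj2 (htau n)) vu].
  apply: (ht g Gg); refine (gge_le (gge_tri hX vu ug) _); lra.
apply: negligible_bigcup => n; exists (bset (~` O n)); split => //.
  by rewrite bsetC; apply: measurableD => //; exact: (measurable_bdry x hX).
apply: (@wandering_null _ n%:R).
- by rewrite bsetC; apply: measurableD => //; exact: (measurable_bdry x hX).
- exact: bset_sub.
move=> _ g [v nv <-] Gg h; apply: nv; exists v; first by exists g.
by rewrite (rhoxx vis); case: (htau n).
Qed.

(** Let [g x] go far towards a limit point other than [v0]. The preimage of the atom still has
    positive mass, hence contains [v0] and is at least as heavy as the atom; but [v0] is outside the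
    shadow of [g x], which makes it much lighter. *)
Lemma not_dirac v0 : (0 < mu x (bset [set v0]))%E ->
  mu x (bset (~` [set v0])) = 0%E -> False.
Proof.
move=> b0 nv0.
have mv0 : measurable (bset [set v0]).
  rewrite -(setCK [set v0]) bsetC; apply: measurableD.
    exact: (measurable_bdry x hX).
  apply: (measurable_bset hX (x := x)) => v nv.
  have [t ht] := gge_neq hX x (nv : v <> v0); exists t => u hu uv; apply: ht.
  by rewrite -uv.
have [C C1 hC] := quasi_invariance.
have [v1 [v2 [v1L v2L v12]]] := limit_set_two.
have [xi xiL xiv0] : exists2 xi, limit_set Gamma x xi & xi <> v0.
  have [E|] := pselect (v1 = v0); last by exists v1.
  by exists v2 => // E'; apply: v12; rewrite E E'.
have [k0 hk0] := gge_neq hX x xiv0; pose k := k0 + delta.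
(* Beyond this distance the contraction factor, [C] included, is at most [expR (- 1)]. *)
pose t := Num.max k (2 * (k + 2 * delta + 3) + (ln C + 1) / alpha).
have [g Gg hg] := (limit_setP hX Gamma x xi).1 xiL t.
have nv0g : ~ gge x (inB v0) (inX (g x)) k.
  move=> h; apply: hk0; rewrite -(addrK delta k0).
  apply: (gge_tri hX _ (gge_sym h)); refine (gge_le hg _).
  by rewrite le_max lexx.
have [h1 _ _ h4] := hC g _ Gg mv0; set P := _ @^-1` _ in h1 h4.
have mP : measurable P by exact: measurable_gbar_map.
have fb : mu x (bset [set v0]) \is a fin_num by exact: fin_num_measure.
have P0 : (0 < mu x P)%E.
  apply: lt_le_trans h1; rewrite mule_gt0 // lte_fin mulr_gt0 ?expR_gt0 ?invr_gt0 //.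
  lra.
have Pv0 : P (inB v0).
  apply: contrapT => nP; have : (mu x P <= mu x (bset (~` [set v0])))%E.
    apply: le_measure; rewrite ?inE //.
      rewrite bsetC; apply: measurableD => //; exact: (measurable_bdry x hX).
    move=> [y [v _ //]|v Pv]; exists v => // vE; apply: nP; rewrite /= in vE.
    by rewrite -vE.
  by rewrite nv0 leNgt P0.
have bP : (mu x (bset [set v0]) <= mu x P)%E.
  by apply: le_measure; rewrite ?inE // => _ [_ -> <-].
have := le_trans bP (h4 k _) => /(_ _)/wrap[|].
  by move=> _ [_ -> <-].
rewrite -(fineK fb) -EFinM lee_fin.
have bf : 0 < fine (mu x (bset [set v0])) by rewrite fine_gt0 // b0 -ge0_fin_numE.
rewrite -[X in X <= _ -> _]mul1r ler_pM2r //; apply/negP; rewrite -ltNge.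
have al0 := alpha_gt0; have C0 : 0 < C by lra.
apply: (@le_lt_trans _ _ (C * expR (- (ln C + 1)))).
  rewrite ler_pM2l // ler_expR.
  have : t <= mdist x (g x) by exact: gge_ub hg.
  rewrite ge_max => /andP[_ ht].
  have := ler_wpM2l (ltW al0) ht.
  rewrite [X in X <= _ -> _]mulrDr [alpha * (_ / _)]mulrC divfK ?gt_eqF //; lra.
rewrite opprD expRD expRN lnK ?posrE // mulrA divff ?gt_eqF // mul1r expR_lt1; lra.
Qed.

(* If shadows of orbit points could have arbitrarily small complement, the measure
   would be concentrated at one boundary point. *)
Lemma coshadow_mass : (0 < m)%E -> exists k c0 : R, [/\ 0 <= k, 0 < c0 &
  forall g A, Gamma g -> measurable A ->
    (forall u, ~ gge x (inB u) (inX (g x)) k -> A (inB u)) -> (c0%:E <= mu x A)%E].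
Proof.
move=> m0; apply: contrapT => /forallNP nk.
have fm : 0 < fine m by rewrite fine_gt0 // m0 ltey_eq bdry_fin.
(* The bound [fine m / n.+3%:R] is at most a third of the total, so that two of these sets never
   cover the boundary: any two shadows share a point and the orbit points converge to some [v0]. It
   also tends to 0, which leaves no mass away from [v0]. *)
have /choice[ga hga] : forall n : nat, exists gA : (X -> X) * set (borel_gbar X),
    [/\ Gamma gA.1, measurable gA.2,
     forall u, ~ gge x (inB u) (inX (gA.1 x)) n%:R -> gA.2 (inB u) &
     (mu x gA.2 < (fine m / n.+3%:R)%:E)%E].
  move=> n; apply: contrapT => h; apply: (nk n%:R); exists (fine m / n.+3%:R).
  split; [by []|by rewrite divr_gt0|move=> g A Gg mA hA; rewrite leNgt].
  by apply/negP => small; apply: h; exists (g, A).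
pose a n := (ga n).1 x; pose A n := (ga n).2.
have common n k : exists u, ~ A n (inB u) /\ ~ A k (inB u).
  apply: contrapT => /forallNP h.
  have [_ mn _ An] := hga n; have [_ mk _ Ak] := hga k.
  have : (m <= mu x (A n `|` A k))%E.
    apply: le_measure; rewrite ?inE; [exact: (measurable_bdry x hX)|exact: measurableU|].
    move=> _ [u _ <-]; apply: contrapT => nu; apply: (h u).
    by split=> ?; apply: nu; [left|right].
  apply/negP; rewrite -ltNge; apply: (le_lt_trans (@measureU2 _ _ _ (mu x) (A n) (A k) mn mk)).
  apply: lt_le_trans (lteD An Ak) _; rewrite -EFinD -[leRHS](fineK bdry_fin) lee_fin.
  have third j : fine m / j.+3%:R <= fine m / 3.
    by rewrite ler_pM2l // lef_pV2 ?posrE // ler_nat.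
  move: (third n) (third k); move: (fine m / n.+3%:R) (fine m / k.+3%:R) => p q; lra.
have in_shadow n u : ~ A n (inB u) -> gge x (inB u) (inX (a n)) n%:R.
  by move=> nu; apply: contrapT => h; apply: nu; have [_ _ + _] := hga n; exact.
have aa n k : Num.min n%:R k%:R - delta <= gromov x (a n) (a k).
  have [u [/in_shadow h1 /in_shadow h2]] := common n k.
  apply: gge_pt; apply: (gge_tri hX (q := inB u)).
    by apply: gge_sym; refine (gge_le h1 _); rewrite ge_min lexx.
  by refine (gge_le h2 _); rewrite ge_min lexx orbT.
have ga_a : gequiv a a.
  apply/gequivP => y M; pose N := (Num.truncn (Num.max 0 (M + delta + mdist x y))).+1.
  have hN : M + delta + mdist x y <= N%:R.
    by apply: ltW; apply: le_lt_trans (truncnS_gt _); rewrite le_max lexx orbT.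
  exists N => i j Ni Nj; have := gromov_base x y (a i) (a j); have := aa i j.
  have : N%:R <= Num.min i%:R j%:R :> R by rewrite le_min !ler_nat Ni.
  lra.
have cga : exists2 b, gequiv b b & gclass a = gclass b by exists a.
pose v0 : gbdry X := exist _ (gclass a) cga.
have v0a : seq_tends a (inB v0) by split.
have to_v0 n u : ~ A n (inB u) -> gge x (inB u) (inB v0) (n%:R - 4 * delta - 2).
  move=> /in_shadow h1.
  have h2 : gge x (inX (a n)) (inB v0) ((n%:R - delta) - 2 * delta - 2).
    apply: (gge_rep hX (seq_tends_cst (a n)) v0a); exists n => i j _ nj.
    by apply: le_trans (aa n j); rewrite lerD2r le_min lexx ler_nat.
  have h1' : gge x (inB u) (inX (a n)) ((n%:R - delta) - 2 * delta - 2).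
    by refine (gge_le h1 _); have := d0; lra.
  by refine (gge_le (gge_tri hX h1' h2) _); lra.
have mnv : measurable (bset (~` [set v0])).
  apply: (measurable_bset hX (x := x)) => v nv.
  have [t ht] := gge_neq hX x (nv : v <> v0); exists t => u hu uv; apply: ht.
  by rewrite -uv.
have nv0 : mu x (bset (~` [set v0])) = 0%E.
  apply: measure_negligible => //.
  pose I N := \bigcap_(n in [set n | (N <= n)%N]) A n.
  apply: (@negligibleS _ _ _ (mu x) (\bigcup_N I N)).
    move=> _ [u uv0 <-]; have [t ht] := gge_neq hX x (uv0 : u <> v0).
    pose N := (Num.truncn (Num.max 0 (t + 4 * delta + 2))).+1.
    have hN : t + 4 * delta + 2 <= N%:R.
      by apply: ltW; apply: le_lt_trans (truncnS_gt _); rewrite le_max lexx orbT.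
    exists N => // n /= Nn; apply: contrapT => /to_v0 h; apply: ht.
    by refine (gge_le h _); have : N%:R <= n%:R :> R by [rewrite ler_nat]; lra.
  apply: negligible_bigcup => N.
  have mI : measurable (I N).
    by apply: bigcap_measurable => [|n _]; [exists N => /=|have [] := hga n].
  exists (I N); split => //; apply/eqP; rewrite eq_le measure_ge0 andbT.
  apply/lee_addgt0Pr => e e0; rewrite add0e.
  pose n := maxn N (Num.truncn (fine m / e)).+1.
  have [_ mn _ An] := hga n.
  apply: (@le_trans _ _ (mu x (A n))).
    by apply: le_measure; rewrite ?inE // => p; apply => /=; exact: leq_maxl.
  apply: le_trans (ltW An) _; rewrite lee_fin ler_pdivrMr // mulrC -ler_pdivrMr //.
  apply: ltW; apply: lt_le_trans (truncnS_gt _) _; rewrite ler_nat.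
  by apply: (leq_trans (leq_maxr N _)); rewrite -/n; do 3 apply: ltnW.
apply: (@not_dirac v0 _ nv0); rewrite lt0e measure_ge0 andbT; apply/eqP => b0.
move: m0; rewrite ltNge => /negP; apply.
rewrite /m (_ : bdry_set = bset [set v0] `|` bset (~` [set v0])); last first.
  apply/seteqP; split=> [_ [v _ <-]|p [|] /bset_sub //].
  by have [->|vv] := pselect (v = v0); [left; exists v0|right; exists v].
have mv0 : measurable (bset [set v0]).
  have := measurableD (measurable_bdry x hX) mnv; rewrite -bsetC setCK; exact.
apply: (le_trans (@measureU2 _ _ _ (mu x) _ _ mv0 mnv)).
by rewrite [X in (_ + X <= _)%E]nv0 [X in (X + _ <= _)%E]b0 adde0.
Qed.

Lemma ahlfors_upper : exists2 C : R, 0 < C & forall v r, limit_set Gamma x v -> 0 < r ->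
  (mu x (bset [set u | (rho v u < r)%R]) <= (C * r `^ (alpha / eps))%:E)%E.
Proof.
have [C C1 hC] := quasi_invariance; have [c c1 hc] := visual_gge hX eps0 vis.
have [v1 [v2 [v1L v2L v12]]] := limit_set_two.
have [C' C'0 hC'] := limit_point_conical hX properX geodesicX GammaI qc v1L v2L v12.
have fm0 : 0 <= fine m by rewrite fine_ge0 // /m measure_ge0.
have al0 := alpha_gt0; pose k := 2 * C' + delta.
pose E := (fine m + 1) * (C * expR (alpha * (2 * k + C'))).
have c0 : 0 < c by lra.
have k0 : 0 <= k by rewrite /k; have := d0; lra.
have E1 : 1 <= C * expR (alpha * (2 * k + C')).
  apply: (le_trans C1); rewrite ler_peMr //; first lra.
  by rewrite -[leLHS]expR0 ler_expR mulr_ge0 //; lra.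
exists (E * c `^ (alpha / eps)) => [|v r vL r0].
  by rewrite mulr_gt0 ?powR_gt0 // mulr_gt0 //; lra.
have rE : (c * r) `^ (alpha / eps) = c `^ (alpha / eps) * r `^ (alpha / eps).
  by rewrite powRM // ltW.
rewrite -mulrA -rE; set B := bset _.
have mB : measurable B by apply: (measurable_rho_ball hX eps0 vis).
have Bm : (mu x B <= (fine m)%:E)%E.
  by rewrite fineK ?bdry_fin //; apply: le_measure; rewrite ?inE //;
    [exact: (measurable_bdry x hX)|exact: bset_sub].
have cr0 : 0 < c * r by rewrite mulr_gt0.
have crE : (c * r) `^ (alpha / eps) = expR (alpha / eps * ln (c * r)).
  by rewrite /powR gt_eqF.
(* For large radii only the total mass is available, hence the factor [fine m + 1] in [E]. *)
have [r1|r1] := leP 1 (c * r).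
  apply: le_trans Bm _; rewrite lee_fin.
  have h1 : 1 <= (c * r) `^ (alpha / eps).
    by rewrite crE -[leLHS]expR0 ler_expR mulr_ge0 // ?ln_ge0 // divr_ge0 // ltW.
  apply: (@le_trans _ _ (fine m + 1)); first lra.
  rewrite /E -[leRHS]mulrA ler_peMr //; first lra.
  exact: mulr_ege1.
pose t := - ln (c * r) / eps.
have t0 : 0 <= t by rewrite divr_ge0 ?ltW // oppr_gt0 ln_lt0 // cr0.
have [g [Gg g1 g2]] := hC' v t vL t0.
have g_lb : t - C' <= mdist x (g x) by exact: gge_ub g2.
have [_ _ h3 _] := hC g B Gg mB; set P := _ @^-1` B in h3.
have mP : measurable P by exact: measurable_gbar_map.
have Pm : (mu x P <= (fine m)%:E)%E.
  rewrite fineK ?bdry_fin //; apply: le_measure; rewrite ?inE //.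
    exact: (measurable_bdry x hX).
  by move=> [y /bset_sub[? _] //|u _]; exists u.
have {h3}h3 := h3 k.
have : ((C^-1 * expR (alpha * (mdist x (g x) - 2 * k)))%:E * mu x B <= (fine m)%:E)%E.
  apply: le_trans Pm; apply: h3 => _ [u ur <-].
  have uv : gge x (inB u) (inB v) t.
    apply: (hc u v t).2; rewrite (rhoC vis) (_ : c^-1 * _ = r) //.
    have -> : - eps * t = ln (c * r) by rewrite /t; field; rewrite gt_eqF.
    by rewrite lnK ?posrE // mulKf ?gt_eqF.
  have uv' : gge x (inB u) (inB v) (t - C') by refine (gge_le uv _); lra.
  by refine (gge_le (gge_tri hX uv' g2) _); rewrite /k; lra.
have fB : mu x B \is a fin_num by exact: fin_num_measure.
rewrite -(fineK fB) -EFinM !lee_fin => h.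
have C0 : 0 < C by lra.
have F0 : 0 < C^-1 * expR (alpha * (mdist x (g x) - 2 * k)).
  by rewrite mulr_gt0 ?expR_gt0 ?invr_gt0.
have {h} : fine (mu x B) <= (C^-1 * expR (alpha * (mdist x (g x) - 2 * k)))^-1 * fine m.
  by rewrite -ler_pdivrMl ?invr_gt0 // invrK.
move=> /le_trans; apply.
have crt : (c * r) `^ (alpha / eps) = expR (- alpha * t).
  by rewrite crE /t; congr expR; field; rewrite gt_eqF.
rewrite crt invfM invrK -expRN.
have -> : E * expR (- alpha * t) =
    C * expR (alpha * (2 * k + C') - alpha * t) * (fine m + 1).
  by rewrite expRD /E mulNr; ring.
apply: ler_pM => //; first by rewrite mulr_ge0 ?expR_ge0 // ltW.
  rewrite ler_pM2l // ler_expR.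
  have := ler_wpM2l (ltW al0) g_lb; lra.
lra.
Qed.

(** The inverse [h] of [g] has a shadow whose complement carries mass at least [b], and [g] maps
    that complement into the ball around [v]. The crude bound on the density then limits how much
    smaller the ball can be. *)
Lemma ahlfors_lower : (0 < m)%E -> exists2 c : R, 0 < c &
  forall v r, limit_set Gamma x v -> 0 < r <= 1 ->
  ((c * r `^ (alpha / eps))%:E <= mu x (bset [set u | (rho v u < r)%R]))%E.
Proof.
move=> m0; have [k [b [k0 b0 hb]]] := coshadow_mass m0.
have [C C1 hC] := quasi_invariance; have [c c1 hc] := visual_gge hX eps0 vis.
have [v1 [v2 [v1L v2L v12]]] := limit_set_two.
have [C' C'0 hC'] := limit_point_conical hX properX geodesicX GammaI qc v1L v2L v12.
have al0 := alpha_gt0; have dd0 := d0; pose k' := C' + k + 9 * delta + 8.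
have c0 : 0 < c by lra. have C0 : 0 < C by lra.
exists (b / C * expR (- alpha * (C' + k')) * (2 * c)^-1 `^ (alpha / eps)).
  by rewrite !mulr_gt0 ?expR_gt0 ?powR_gt0 ?invr_gt0 ?mulr_gt0.
move=> v r vL /andP[r0 r1]; have c20 : 0 <= (2 * c)^-1 by rewrite invr_ge0; lra.
rewrite -mulrA -powRM //; last exact: ltW.
set B := bset _; have mB : measurable B by apply: (measurable_rho_ball hX eps0 vis).
have q0 : 0 < (2 * c)^-1 * r by rewrite mulr_gt0 // invr_gt0 mulr_gt0.
have q1 : (2 * c)^-1 * r <= 1.
  rewrite mulrC ler_pdivrMr ?mulr_gt0 //; lra.
have qE : ((2 * c)^-1 * r) `^ (alpha / eps) = expR (alpha / eps * ln ((2 * c)^-1 * r)).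
  by rewrite /powR gt_eqF.
(* The extra depth [k'] compensates all additive losses, and the factor 2 leaves the image within
   [r / 2], hence in the open ball. *)
pose t := k' - ln ((2 * c)^-1 * r) / eps.
have t0 : 0 <= t.
  rewrite /t subr_ge0; apply: (@le_trans _ _ 0); last by rewrite /k'; lra.
  by rewrite mulr_le0_ge0 ?invr_ge0 ?ln_le0 // ltW.
have [g [Gg g1 g2]] := hC' v t vL t0.
have g_lb : t - C' <= mdist x (g x) by exact: gge_ub g2.
have [h [Gh gh hg]] := invG GammaI Gg.
have [_ h2 _ _] := hC g B Gg mB; set P := _ @^-1` B in h2.
have mP : measurable P by exact: measurable_gbar_map.
have dxh : mdist x (h x) = mdist x (g x).
  by rewrite -(isometryG GammaI Gg) hg metric_sym.
have bP : (b%:E <= mu x P)%E.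
  apply: (hb h) => // u nu; rewrite /P /=; exists (gbdry_map g u) => //=.
  have [s [s1 s2]] := gge_swap hX (inB u) x (h x).
  have sk : s - 3 * delta - 3 < k.
    by rewrite ltNge; apply/negP => sk; apply: nu; refine (gge_le s1 _).
  have := gge_isom hX (isometryG GammaI Gg) s2; rewrite /= hg dxh => s2'.
  have s3 : gge x (inB (gbdry_map g u)) (inX (g x)) (t - C' - k - 8 * delta - 8).
    by refine (gge_le s2' _); lra.
  have g2' : gge x (inX (g x)) (inB v) (t - C' - k - 8 * delta - 8).
    by apply: gge_sym; refine (gge_le g2 _); lra.
  have s4 : gge x (inB (gbdry_map g u)) (inB v) (t - k').
    by refine (gge_le (gge_tri hX s3 g2') _); rewrite /k'; lra.
  rewrite (rhoC vis); apply: le_lt_trans ((hc _ _ _).1 s4) _.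
  have -> : - eps * (t - k') = ln ((2 * c)^-1 * r) by rewrite /t; field; rewrite gt_eqF.
  have -> : c * expR (ln ((2 * c)^-1 * r)) = r / 2.
    by rewrite lnK ?posrE //; field; rewrite gt_eqF.
  lra.
have fB : mu x B \is a fin_num by exact: fin_num_measure.
have := le_trans bP h2; rewrite -(fineK fB) -EFinM lee_fin => h'.
have F0 : 0 < C * expR (alpha * mdist x (g x)) by rewrite mulr_gt0 ?expR_gt0.
have {h'} : (C * expR (alpha * mdist x (g x)))^-1 * b <= fine (mu x B).
  by rewrite ler_pdivrMl.
move=> h3; rewrite lee_fin; apply: le_trans h3; rewrite [(C * _)^-1]invfM -expRN qE.
have -> : alpha / eps * ln ((2 * c)^-1 * r) = - alpha * (t - k').
  by rewrite /t; field; rewrite gt_eqF.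
have -> : b / C * expR (- alpha * (C' + k')) * expR (- alpha * (t - k')) =
    C^-1 * expR (- (alpha * (t + C'))) * b.
  rewrite -[LHS]mulrA -expRD (_ : _ + _ = - (alpha * (t + C'))); first by ring.
  by ring.
rewrite ler_pM2r // ler_pM2l ?invr_gt0 // ler_expR lerN2 ler_pM2l //; lra.
Qed.

End quasiconformal.

(** * Lebesgue points *)

Section measure_limits.
Context {d : measure_display} {T : measurableType d} {R : realType}.
Variable mu : {finite_measure set T -> \bar R}.

Lemma measure_decreasing_empty (F : (set T)^nat) (e : R) :
  (forall n, measurable (F n)) -> (forall n m, (n <= m)%N -> F m `<=` F n) ->
  \bigcap_n F n = set0 -> 0 < e -> exists n, (mu (F n) <= e%:E)%E.
Proof.
move=> mF dF F0 e0.
have F0fin : (mu (F 0%N) < +oo)%E by rewrite ltey_eq fin_num_measure.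
have mI : measurable (\bigcap_n F n) by rewrite F0.
have := @nonincreasing_cvg_mu _ _ _ mu F F0fin mF mI.
move=> /(_ _)/wrap[|]; first by move=> n m nm; apply/subsetPset; exact: dF.
rewrite F0 measure0 => /fine_cvgP[fin /cvgrPdist_lt/(_ e e0)[N _ hN]].
exists N; have := hN N (leqnn _); rewrite /= sub0r normrN => h.
have fN : mu (F N) \is a fin_num by exact: fin_num_measure.
by rewrite -(fineK fN) lee_fin; apply: le_trans (ltW h); exact: ler_norm.
Qed.

Lemma measure_liminf_le (G : (set T)^nat) (K : R) :
  (forall n, measurable (G n)) -> (forall n, (mu (G n) <= K%:E)%E) ->
  (mu (\bigcup_N \bigcap_(n in [set n | (N <= n)%N]) G n) <= K%:E)%E.
Proof.
move=> mG GK; pose I N := \bigcap_(n in [set n | (N <= n)%N]) G n.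
have mI N : measurable (I N) by apply: bigcap_measurable => [|n _ //]; exists N => /=.
have := @nondecreasing_cvg_mu _ _ _ mu I mI (bigcup_measurable (fun n _ => mI n)).
move=> /(_ _)/wrap[|].
  move=> n m nm; apply/subsetPset => p Ip k /= mk; apply: Ip => /=.
  exact: leq_trans mk.
move=> h; rewrite -(cvg_lim _ h) //; apply: lime_le; first by apply/cvg_ex; exists (mu (\bigcup_n I n)).
apply: nearW => n /=; apply: le_trans (GK n).
by apply: le_measure; rewrite ?inE // => p; apply => /=.
Qed.

Lemma negligible_small (E : set T) :
  (forall e : R, 0 < e -> exists G, [/\ measurable G, E `<=` G & (mu G <= e%:E)%E]) ->
  mu.-negligible E.
Proof.
move=> h; have /choice[G hG] : forall n : nat, exists G,
    [/\ measurable G, E `<=` G & (mu G <= (n.+1%:R^-1)%:E)%E].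
  by move=> n; apply: h; rewrite invr_gt0.
have mG : measurable (\bigcap_n G n) by apply: bigcap_measurable => // n _; have [] := hG n.
exists (\bigcap_n G n); split => //; last by move=> p Ep n _; have [_ + _] := hG n; apply.
apply/eqP; rewrite eq_le measure_ge0 andbT; apply/lee_addgt0Pr => e e0; rewrite add0e.
pose n := Num.truncn e^-1; have [mGn _ Gn] := hG n.
apply: (@le_trans _ _ (mu (G n))); first by apply: le_measure; rewrite ?inE // => p; apply.
apply: le_trans Gn _; rewrite lee_fin -[leRHS]invrK lef_pV2 ?posrE ?invr_gt0 //.
exact/ltW/truncnS_gt.
Qed.

End measure_limits.

(** * Outer regularity for the visual metric *)

Section boundary_regularity.
Context {R : realType} {X : pmetricType R}.
Variables (delta eps : R) (x : X) (rho : gbdry X -> gbdry X -> R).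
Hypothesis hX : hyperbolic delta X.
Hypothesis eps0 : 0 < eps.
Hypothesis vis : visual_metric x eps rho.
Variable mu : {finite_measure set (borel_gbar X) -> \bar R}.
Implicit Types (u v w : gbdry X) (O : set (gbdry X)) (A : set (borel_gbar X)).

Definition rho_open O := forall v, O v -> exists2 r, 0 < r &
  forall u, rho v u < r -> O u.

Lemma rho_openI O1 O2 : rho_open O1 -> rho_open O2 -> rho_open (O1 `&` O2).
Proof.
move=> h1 h2 v [/h1[r1 r10 hr1] /h2[r2 r20 hr2]].
exists (Num.min r1 r2); first by rewrite lt_min r10.
by move=> u; rewrite lt_min => /andP[/hr1 ? /hr2 ?]; split.
Qed.

Lemma rho_open_bigcup (F : nat -> set (gbdry X)) : (forall n, rho_open (F n)) ->
  rho_open (\bigcup_n F n).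
Proof. by move=> h v [n _ /h[r r0 hr]]; exists r => // u /hr ?; exists n. Qed.

Lemma rho_open_bigcap (F : nat -> set (gbdry X)) n : (forall n, rho_open (F n)) ->
  rho_open (\bigcap_(i in [set i | (i < n)%N]) F i).
Proof.
move=> h; elim: n => [|n IH].
  by move=> v _; exists 1 => // u _ i.
move=> v hv; have [|r1 r10 hr1] := IH v.
  by move=> i /= iN; apply: hv => /=; exact: ltnW.
have [r2 r20 hr2] := h n v (hv n (ltnSn n)).
exists (Num.min r1 r2); first by rewrite lt_min r10.
move=> u; rewrite lt_min => /andP[u1 u2] i /=; rewrite ltnS leq_eqVlt => /orP[/eqP->|iN].
  exact: hr2.
exact: hr1.
Qed.

Let mopen O : rho_open O -> measurable (bset O).
Proof. exact: (measurable_rho_open hX eps0 vis). Qed.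

Lemma trace_rho_open (U : set (gbar X)) : gbar_open U ->
  rho_open [set v | U (inB v)].
Proof.
move=> [_ oU] v /(oU v)/(_ x)[r hr].
have [tau tau0 htau] := visual_scale hX eps0 vis (r + 1).
exists tau => // u /htau/gprod_gge h; apply: hr; apply: lt_le_trans h.
by rewrite lte_fin ltrDl.
Qed.

(** The set and its complement are enlarged together, and the error is the overlap: this symmetric
    form of outer regularity passes to complements at once. *)
Let regular A := forall e : R, 0 < e -> exists O1 O2, [/\ rho_open O1, rho_open O2,
  (forall v, A (inB v) -> O1 v), (forall v, ~ A (inB v) -> O2 v) &
  (mu (bset (O1 `&` O2)) <= e%:E)%E].

Let regular_open (U : set (gbar X)) : gbar_open U -> regular U.
Proof.
move=> oU e e0; have oO := trace_rho_open oU; set O := [set v | U (inB v)] in oO.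
pose O2 n := [set v | exists2 u, ~ O u & rho v u < n.+1%:R^-1].
have oO2 n : rho_open (O2 n).
  move=> v [u nu vu]; exists (n.+1%:R^-1 - rho v u); first by rewrite subr_gt0.
  move=> z vz; exists u => //; have := rho_triangle vis z v u.
  by rewrite (rhoC vis z v) => h; apply: le_lt_trans h _; rewrite addrC -ltrBrDl.
have [n hn] : exists n, (mu (bset (O `&` O2 n)) <= e%:E)%E.
  apply: (@measure_decreasing_empty _ _ _ mu (fun n => bset (O `&` O2 n))) => //.
  - by move=> n; apply: mopen; exact: rho_openI.
  - move=> n m nm _ [v [Ov [u nu vu]] <-]; exists v => //; split => //; exists u => //.
    by apply: lt_le_trans vu _; rewrite lef_pV2 ?posrE // ler_nat ltnS.
  apply/seteqP; split=> // p Ip; have [v [Ov _] vp] := Ip 0%N I; subst p.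
  have [r r0 hr] := oO v Ov.
  have [w [_ [u nu wu]] [wv]] := Ip (Num.truncn r^-1) I; subst w.
  apply: nu; apply: hr; apply: lt_le_trans wu _.
  rewrite -[leRHS]invrK lef_pV2 ?posrE ?invr_gt0 //; exact/ltW/truncnS_gt.
exists O, (O2 n); split => // v nv; exists v => //.
by rewrite (rhoxx vis) invr_gt0.
Qed.

(** The complement would need an infinite intersection of open sets. Only the first [n] are
    intersected, and the extra overlap is in [F n], the part of the union not yet reached, whose
    mass tends to 0. *)
Let regular_bigcup (A : (set (borel_gbar X))^nat) :
  (forall n, measurable (A n)) -> (forall n, regular (A n)) -> regular (\bigcup_n A n).
Proof.
move=> mA rA e e0; have e2 : 0 < e / 2 by rewrite divr_gt0.
have /choice[V0 hO] : forall n, exists O : set (gbdry X) * set (gbdry X),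
    [/\ rho_open O.1, rho_open O.2, (forall v, A n (inB v) -> O.1 v),
     (forall v, ~ A n (inB v) -> O.2 v) &
     (mu (bset (O.1 `&` O.2)) <= ((e / 2) / (2 ^ n.+1)%:R)%:E)%E].
  move=> n; have [|U1 [U2 h]] := rA n (e / 2 / (2 ^ n.+1)%:R).
    by rewrite divr_gt0 // ltr0n expn_gt0.
  by exists (U1, U2).
pose P n := bset ((V0 n).1 `&` (V0 n).2).
have mP n : measurable (P n) by apply: mopen; have [? ? _ _ _] := hO n; exact: rho_openI.
have mUP : measurable (\bigcup_n P n) by exact: bigcup_measurable.
have UP : (mu (\bigcup_n P n) <= (e / 2)%:E)%E.
  apply: le_trans (@measure_sigma_subadditive _ _ _ mu _ _ mP mUP (@subset_refl _ _)) _.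
  apply: le_trans (epsilon_trick0 xpredT (ltW e2)).
  by apply: lee_nneseries => // n _; have [_ _ _ _] := hO n.
pose F n := (bdry_set `&` \bigcup_k A k) `\` \bigcup_(i in [set i | (i < n)%N]) A i.
have mF n : measurable (F n).
  apply: measurableD; first apply: measurableI.
  - exact: (measurable_bdry x hX).
  - exact: bigcup_measurable.
  - exact: bigcup_measurable.
have [n hn] : exists n, (mu (F n) <= (e / 2)%:E)%E.
  apply: measure_decreasing_empty => //.
    move=> n m nm p [? np]; split => // -[i /= iN Ai]; apply: np; exists i => //=.
    exact: leq_trans nm.
  apply/seteqP; split=> // p Ip; have [[_ [k _ Ak]] _] := Ip 0%N I.
  by have [_] := Ip k.+1 I; apply; exists k => /=.
exists (\bigcup_k (V0 k).1), (\bigcap_(i in [set i | (i < n)%N]) (V0 i).2); split.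
- by apply: rho_open_bigcup => k; have [] := hO k.
- by apply: rho_open_bigcap => k; have [] := hO k.
- by move=> v [k _ Ak]; exists k => //; have [_ _ + _ _] := hO k; exact.
- move=> v nA i _; have [_ _ _ + _] := hO i; apply => Ai; apply: nA; exists i => //.
have sub : bset (\bigcup_k (V0 k).1 `&` \bigcap_(i in [set i | (i < n)%N]) (V0 i).2) `<=`
    \bigcup_k P k `|` F n.
  move=> _ [v [[k _ Ov] hv] <-].
  have [[j Oj]|nP] := pselect (exists j, ((V0 j).1 `&` (V0 j).2) v).
    by left; exists j => //; exists v.
  right; split.
    split; first by exists v.
    exists k => //; apply: contrapT => nA; apply: nP; exists k; split => //.
    by have [_ _ _ + _] := hO k; exact.
  move=> [i /= iN Ai]; apply: nP; exists i; split; last exact: hv.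
  by have [_ _ + _ _] := hO i; exact.
apply: (@le_trans _ _ (mu (\bigcup_k P k `|` F n))).
  apply: le_measure sub; rewrite inE; last exact: measurableU.
  apply: mopen; apply: rho_openI.
    by apply: rho_open_bigcup => k; have [] := hO k.
  by apply: rho_open_bigcap => k; have [] := hO k.
apply: le_trans (@measureU2 _ _ _ mu _ _ mUP (mF n)) _.
by apply: le_trans (leeD UP hn) _; rewrite -EFinD -splitr.
Qed.

Lemma outer_regular A (e : R) : measurable A -> 0 < e -> exists O, [/\ rho_open O,
  (forall v, A (inB v) -> O v) & (mu (bset O `\` A) <= e%:E)%E].
Proof.
move=> mA e0.
have /(_ A mA)[_ /(_ e e0)[U1 [U2 [V1 V2 h1 h2 h]]]] :
    measurable `<=` [set B : set (borel_gbar X) | measurable B /\ regular B].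
  apply: smallest_sub; last first.
    by move=> U oU; split; [exact: sub_sigma_algebra|exact: regular_open].
  split.
  - split; first exact: measurable0.
    move=> e' e'0; exists set0, setT; split => //; first by move=> v _; exists 1.
    by rewrite set0I /bset image_set0 measure0 lee_fin ltW.
  - move=> B [mB rB]; rewrite setTD; split; first exact: measurableC.
    move=> e' e'0; have [U1 [U2 [V1 V2 h1 h2 h]]] := rB e' e'0.
    exists U2, U1; split => //; first by move=> v nB; apply: h1; exact: contrapT.
    by rewrite setIC.
  - move=> F hF; have mF n : measurable (F n : set (borel_gbar X)) by have [] := hF n.
    split; first exact: bigcup_measurable.
    by apply: regular_bigcup => // n; have [] := hF n.
exists U1; split => //; apply: le_trans h; apply: le_measure; rewrite ?inE.
- by apply: measurableD => //; exact: mopen.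
- by apply: mopen; exact: rho_openI.
by move=> _ [[v U1v <-] nA]; exists v => //; split => //; exact: h2.
Qed.

End boundary_regularity.

(** * Vitali covering and differentiation with respect to powers of the radius *)

Section lebesgue_points.
Context {R : realType} {X : pmetricType R}.
Variables (delta eps : R) (x : X) (rho : gbdry X -> gbdry X -> R).
Hypothesis hX : hyperbolic delta X.
Hypothesis eps0 : 0 < eps.
Hypothesis vis : visual_metric x eps rho.
Variable mu : {finite_measure set (borel_gbar X) -> \bar R}.
Variables (L : set (gbdry X)) (C D : R).
Hypothesis C0 : 0 < C.
Hypothesis D0 : 0 < D.
Hypothesis upper : forall v (r : R), L v -> 0 < r ->
  (mu (bset [set u | (rho v u < r)%R]) <= (C * r `^ D)%:E)%E.
Implicit Types (u v w : gbdry X) (O : set (gbdry X)) (A : set (borel_gbar X)).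

Let rad (k : nat) : R := 2^-1 ^+ k.
Let rad_gt0 k : 0 < rad k. Proof. by rewrite exprn_gt0 // invr_gt0. Qed.
Let rad_le j k : (j <= k)%N -> rad k <= rad j.
Proof. by move=> jk; rewrite ler_wiXn2l // ?invr_ge0 ?invf_le1 // ler1n. Qed.

Let rball (i : gbdry X * nat) : set (gbdry X) := [set u | rho i.1 u < rad i.2].
Let mball i : measurable (bset (rball i)).
Proof. exact: (measurable_rho_ball hX eps0 vis). Qed.

Section vitali.
Variable h : borel_gbar X -> R.
Hypothesis h0 : forall p, 0 <= h p.
Hypothesis hi : mu.-integrable setT (EFin \o h).

Let nu A : \bar R := (\int[mu]_(p in A) (h p)%:E)%E.

Let mh A : measurable A -> measurable_fun A (EFin \o h).
Proof. by move=> mA; apply: measurable_funS (measurable_int _ hi). Qed.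

Let nu_fin A : measurable A -> nu A \is a fin_num.
Proof. by move=> mA; apply: integrable_fin_num => //; exact: integrableS hi. Qed.

Let nu_le A B : measurable A -> measurable B -> A `<=` B -> (nu A <= nu B)%E.
Proof.
move=> mA mB; apply: ge0_subset_integral => //; first exact: mh.
by move=> p _; rewrite lee_fin.
Qed.

Section covering.
Variables (O : set (gbdry X)) (lam : R) (N : nat).
Hypothesis lam0 : 0 < lam.
Hypothesis mO : measurable (bset O).

(** The cap [N] on the level bounds from below the mass [nu] of a good ball, so a disjoint family of
    good balls has bounded size and a largest selection exists. *)
Let good (i : gbdry X * nat) := [/\ L i.1, rball i `<=` O, (i.2 <= N)%N &
  ((lam * rad i.2 `^ D)%:E < nu (bset (rball i)))%E].

Let meets (i j : gbdry X * nat) := rball i `&` rball j !=set0.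

(** The last clause is the Vitali invariant: a good ball that meets the selection meets a member of
    at least its own radius, a smaller level being a larger ball. *)
Let greedy (s : seq (gbdry X * nat)) := [/\ uniq s, (forall i, i \in s -> good i),
  trivIset [set` s] rball &
  forall i, good i -> (exists2 j, j \in s & meets i j) ->
    exists j, [/\ j \in s, meets i j & (j.2 <= i.2)%N]].

Let greedy_sum s : uniq s -> (forall i, i \in s -> good i) -> trivIset [set` s] rball ->
  (\sum_(i <- s) nu (bset (rball i)) <= nu (bset O))%E.
Proof.
move=> us gs ts; have tb : trivIset [set` s] (fun i => bset (rball i)).
  move=> i j si sj [_ [[u iu <-] [w jw [wu]]]]; apply: ts => //.
  by exists u; split => //; rewrite -wu.
have mU : measurable (\big[setU/set0]_(i <- s) bset (rball i)).
  exact: bigsetU_measurable.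
rewrite /nu -(@ge0_integral_bigsetU _ _ _ mu _ (fun i => bset (rball i))) //.
- apply: nu_le => //; rewrite big_seq; elim/big_ind: _ => //.
    by move=> A B hA hB p [/hA|/hB].
  by move=> i /gs[_ iO _ _] _ [v iv <-]; exists v => //; exact: iO.
- exact: mh.
- by move=> p _; rewrite lee_fin.
Qed.

Let greedy_size s : uniq s -> (forall i, i \in s -> good i) -> trivIset [set` s] rball ->
  (size s)%:R * (lam * rad N `^ D) <= fine (nu (bset O)).
Proof.
move=> us gs ts; rewrite -lee_fin fineK ?nu_fin //.
apply: le_trans (greedy_sum us gs ts).
have -> : ((size s)%:R * (lam * rad N `^ D))%:E =
    (\sum_(i <- s) (lam * rad N `^ D)%:E)%E.
  by rewrite sumEFin big_const_seq count_predT iter_addr_0 mulr_natl.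
rewrite big_seq [leRHS]big_seq; apply: lee_sum => i /gs[_ _ iN il].
apply: le_trans (ltW il); rewrite lee_fin ler_pM2l //.
by apply: ge0_ler_powR; rewrite ?nnegrE ?(ltW D0) ?(ltW (rad_gt0 _)) ?rad_le.
Qed.

Let greedy_exists : exists s, greedy s /\ forall i, good i ->
  exists j, [/\ j \in s, meets i j & (j.2 <= i.2)%N].
Proof.
pose P n := `[< exists s, greedy s /\ size s = n >].
have exP : exists n, P n.
  exists 0%N; apply/asboolP; exists [::]; split=> //; split=> //.
  by move=> i _ [].
pose K := Num.truncn (fine (nu (bset O)) / (lam * rad N `^ D)).
have q0 : 0 < lam * rad N `^ D by rewrite mulr_gt0 ?powR_gt0.
have ubP n : P n -> (n <= K)%N.
  move=> /asboolP[s [[us gs ts _] <-]]; rewrite /K.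
  have nu0 : 0 <= fine (nu (bset O)).
    by rewrite fine_ge0 // integral_ge0 // => p _; rewrite lee_fin.
  rewrite truncn_ge_nat ?divr_ge0 ?(ltW q0) // ler_pdivlMr //; exact: greedy_size.
have [s0 [[gs ss] mx]] : exists s, (greedy s /\ True) /\ forall s', greedy s' -> (size s' <= size s)%N.
  case: (ex_maxnP exP ubP) => n /asboolP[s [gs sn]] mx; exists s; split => // s' gs'.
  by rewrite sn; apply: mx; apply/asboolP; exists s'.
exists s0; split => // i gi; have [us gds ts sat] := gs.
apply: (sat i gi); apply: contrapT => nm.
(* A good ball of smallest level disjoint from all those of [s0] could be added. *)
pose Q k := `[< exists i, [/\ good i, (forall j, j \in s0 -> ~ meets i j) & i.2 = k] >].
have exQ : exists k, Q k.
  exists i.2; apply/asboolP; exists i; split => // j js ij; apply: nm; exists j => //.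
case: (ex_minnP exQ) => k /asboolP[i0 [g0 n0 k0]] mn.
have gr : greedy (i0 :: s0); last first.
  by have := mx _ gr; rewrite /= ltnn.
have meet0 j : good j -> meets j j.
  by move=> _; exists j.1; rewrite /rball /= (rhoxx vis); split; exact: rad_gt0.
have i0s : i0 \notin s0.
  by apply/negP => /[dup] i0s /n0; apply; exact: meet0.
split.
- by rewrite /= i0s.
- by move=> j; rewrite inE => /orP[/eqP->|/gds].
- move=> j1 j2 /=; rewrite !inE => /orP[/eqP->|j1s] /orP[/eqP->|j2s] // j12.
  + by case: (n0 j2).
  + by case: (n0 j1) => //; case: j12 => z [? ?]; exists z.
  + exact: ts.
- move=> j gj [j' ]; rewrite inE => /orP[/eqP->|j's] jj'.
    have [[j1 j1s jj1]|nj] := pselect (exists2 j1, j1 \in s0 & meets j j1).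
      have [//|j2 [j2s jj2 le2]] := sat j gj; first by exists j1.
      by exists j2; split => //; rewrite inE j2s orbT.
    exists i0; split => //; first by rewrite mem_head.
    rewrite k0; apply: mn; apply/asboolP; exists j; split => // j1 j1s jj1.
    by apply: nj; exists j1.
  have [//|j2 [j2s jj2 le2]] := sat j gj; first by exists j'.
  by exists j2; split => //; rewrite inE j2s orbT.
Qed.

(** [G] is the union of the tripled selected balls. Tripling costs [3]^
    D[by upper regularity, and]rad k [^ D] is traded for [nu] by goodness of the selected balls,
    which are disjoint inside [O]. *)
Lemma vitali_covering : exists G : set (borel_gbar X), [/\ measurable G,
  (forall v k, L v -> (k <= N)%N -> rball (v, k) `<=` O ->
    ((lam * rad k `^ D)%:E < nu (bset (rball (v, k))))%E -> G (inB v)) &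
  (mu G <= (C * 3 `^ D / lam)%:E * nu (bset O))%E].
Proof.
have [s [[us gs ts _] hs]] := greedy_exists.
pose B3 (i : gbdry X * nat) := bset [set u | rho i.1 u < 3 * rad i.2].
have mB3 i : measurable (B3 i) by exact: (measurable_rho_ball hX eps0 vis).
have mG : measurable (\big[setU/set0]_(i <- s) B3 i) by exact: bigsetU_measurable.
exists (\big[setU/set0]_(i <- s) B3 i); split => //.
  move=> v k Lv kN vO vlam; have [|[w n] [js [z [vz jz]] jk]] := hs (v, k) => //.
  rewrite -bigcup_seq; exists (w, n) => //; exists v => //.
  change (rho w v < 3 * rad n).
  have vz' : rho v z < rad k by [].
  have jz' : rho w z < rad n by [].
  have kj : rad k <= rad n := rad_le jk.
  have := rho_triangle vis w z v; rewrite (rhoC vis z v); have := rad_gt0 n; lra.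
apply: (@le_trans _ _ (\sum_(i <- s) mu (B3 i))%E).
  elim: s {us gs ts hs mG} => [|i s IH]; first by rewrite !big_nil measure0.
  rewrite !big_cons; apply: le_trans (@measureU2 _ _ _ mu _ _ (mB3 i) _) _.
    exact: bigsetU_measurable.
  by rewrite leeD2l.
have c0 : 0 <= C * 3 `^ D / lam by rewrite !mulr_ge0 ?powR_ge0 ?invr_ge0 ?ltW.
apply: (@le_trans _ _ ((C * 3 `^ D / lam)%:E * \sum_(i <- s) nu (bset (rball i)))%E);
  last by apply: lee_wpmul2l; [rewrite lee_fin|exact: greedy_sum].
rewrite ge0_sume_distrr; last by move=> i _; apply: integral_ge0 => p _; rewrite lee_fin.
rewrite big_seq [leRHS]big_seq; apply: lee_sum => i /gs[Li _ _ il].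
apply: le_trans (upper Li _) _; first by rewrite mulr_gt0.
apply: (@le_trans _ _ ((C * 3 `^ D / lam)%:E * (lam * rad i.2 `^ D)%:E)%E).
  rewrite -EFinM lee_fin powRM ?(ltW (rad_gt0 _)) // !mulrA divfK ?gt_eqF //.
by apply: lee_wpmul2l; [rewrite lee_fin|exact: ltW].
Qed.

End covering.

(** Since [h] vanishes on [A], an open set around [A] can have arbitrarily small [nu], and the
    covering lemma bounds the exceptional set inside it. *)
Lemma density_zero A : measurable A -> (forall p, A p -> h p = 0) ->
  mu.-negligible (bset [set v | [/\ L v, A (inB v) &
    exists2 lam, 0 < lam & forall k0, exists2 k, (k0 <= k)%N &
      ((lam * rad k `^ D)%:E < nu (bset (rball (v, k))))%E]]).
Proof.
move=> mA hA.
pose E lam := bset [set v | [/\ L v, A (inB v) &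
  forall k0, exists2 k, (k0 <= k)%N &
    ((lam * rad k `^ D)%:E < nu (bset (rball (v, k))))%E]].
suff nE n : mu.-negligible (E n.+1%:R^-1).
  apply: (negligibleS _ (negligible_bigcup nE)) => _ [v [Lv Av [lam lam0 hlam]] <-].
  exists (Num.truncn lam^-1) => //; exists v => //; split => // k0.
  have [k k0k hk] := hlam k0; exists k => //; apply: le_lt_trans hk.
  rewrite lee_fin ler_wpM2r ?powR_ge0 // -[leRHS]invrK lef_pV2 ?posrE ?invr_gt0 //.
  exact/ltW/truncnS_gt.
set lam := n.+1%:R^-1; have lam0 : 0 < lam by rewrite invr_gt0.
apply: negligible_small => e e0.
pose K := C * 3 `^ D / lam.
have K0 : 0 < K by rewrite !mulr_gt0 ?powR_gt0 ?invr_gt0.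
have [tau [tau0 htau]] := integral_normr_continuous hi (divr_gt0 e0 K0).
have tau2 : 0 < tau / 2 by rewrite divr_gt0.
have [U [oU AU UA]] := outer_regular hX eps0 vis mu mA tau2.
have mU : measurable (bset U) by exact: (measurable_rho_open hX eps0 vis).
have nuU : (nu (bset U) <= (e / K)%:E)%E.
  have mUA : measurable (bset U `\` A) by exact: measurableD.
  have mUI : measurable (bset U `&` A) by exact: measurableI.
  have -> : nu (bset U) = nu (bset U `\` A).
    rewrite /nu -{1}(setUIDK (bset U) A) ge0_integral_setU //.
    - rewrite (_ : (\int[mu]_(p in bset U `&` A) (h p)%:E)%E = 0%E) ?add0e //.
      by apply: integral0_eq => p [_ /hA ->].
    - by rewrite setUIDK; exact: mh.
    - by move=> p _; rewrite lee_fin.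
    - by rewrite disj_set2E; apply/eqP; apply/seteqP; split => // p [[_ ?] [_ ?]].
  have := htau _ mUA; rewrite /Rintegral => /(_ _)/wrap[|].
    by apply: le_lt_trans UA _; rewrite lte_fin ltr_pdivrMr // ltr_pMr // ltr1n.
  under eq_integral do rewrite ger0_norm //.
  by move=> /ltW; rewrite -lee_fin fineK // nu_fin.
(* The covers for different caps are unrelated, but an exceptional point belongs to all of them once
   the cap exceeds the level of one of its bad balls; hence the lower limit. *)
have /choice[G hG] := fun N => vitali_covering N lam0 mU.
exists (\bigcup_N \bigcap_(n in [set n | (N <= n)%N]) G n); split.
- apply: bigcup_measurable => N _; apply: bigcap_measurable => [|m _].
    by exists N => /=.
  by have [] := hG m.
- move=> _ [v [Lv Av hv] <-]; have [r r0 hr] := oU v (AU v Av).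
  have [k0 hk0] : exists k0, rad k0 < r.
    have [k0 _ h1] : \forall k \near \oo, rad k < r.
      have /cvgrPdist_lt/(_ r r0) : rad k @[k --> \oo] --> (0 : R).
        by apply: cvg_expr; rewrite ger0_norm ?invr_ge0 // invf_lt1 // ltr1n.
      by apply: filterS => k; rewrite sub0r normrN ger0_norm // ltW.
    by exists k0; apply: h1 => /=.
  have [k k0k hk] := hv k0; exists k => // m /= km; have [_ + _] := hG m.
  apply; [exact: Lv|exact: km| |exact: hk].
  move=> u /= uv; apply: hr; apply: lt_le_trans uv _.
  exact: le_trans (rad_le k0k) (ltW hk0).
apply: measure_liminf_le => N; have [mG _ hN] := hG N; first exact: mG.
apply: le_trans hN _; apply: (@le_trans _ _ (K%:E * (e / K)%:E)%E).
  by apply: lee_wpmul2l => //; rewrite lee_fin ltW.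
by rewrite -EFinM lee_fin mulrC divfK // gt_eqF.
Qed.

End vitali.

Let ballk v k := bset [set u | rho v u < 2^-1 ^+ k].

(* The means are normalized by [r `^ D] rather than by the mass of the balls, so that
   the upper regularity is enough. Off a null set, [g] is within [a] of a rational [q] at
   [v], and the part of [|g - q|] exceeding [a] is negligible around [v] by
   [density_zero]. *)
Lemma lebesgue_point (g : borel_gbar X -> R) : mu.-integrable setT (EFin \o g) ->
  mu.-negligible (bset [set v | L v /\ ~ forall eta, 0 < eta -> exists k0, forall k,
    (k0 <= k)%N -> (\int[mu]_(p in ballk v k) `|g p - g (inB v)|%:E <=
      (eta * (2^-1 ^+ k) `^ D)%:E)%E]).
Proof.
move=> gi; have mg : measurable_fun setT g by apply/measurable_EFinP; exact: measurable_int gi.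
pose a (n : nat) : R := n.+1%:R^-1.
have a0 n : 0 < a n by rewrite invr_gt0.
pose A (i : rat * nat) := [set p | `|g p - ratr i.1| <= a i.2].
have mgq (q : R) : measurable_fun setT (fun p => `|g p - q|).
  by apply: measurableT_comp => //; apply: measurable_funB => //; exact: measurable_cst.
have mA i : measurable (A i).
  rewrite (_ : A i = setT `&` (fun p => `|g p - ratr i.1|) @^-1` `]-oo, a i.2]%classic).
    by apply: mgq => //; exact: measurable_itv.
  by rewrite setTI; apply/seteqP; split=> p /=; rewrite in_itv.
pose h (i : rat * nat) p := `|g p - ratr i.1| * \1_(~` A i) p.
have h0 i p : 0 <= h i p by rewrite mulr_ge0 // indicE.
have hi i : mu.-integrable setT (EFin \o h i).
  have gqi : mu.-integrable setT (fun p => (g p)%:E - (ratr i.1)%:E)%E.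
    by apply: integrableB => //; exact: finite_measure_integrable_cst.
  apply: (le_integrable _ _ _ gqi) => //.
    apply/measurable_EFinP; apply: measurable_funM => //.
    by apply: measurable_indic; exact: measurableC.
  move=> p _; rewrite /= lee_fin /h normrM normr_id ler_piMr // indicE.
  by case: (_ \in _); rewrite ?normr1 ?normr0.
have hA i p : A i p -> h i p = 0.
  by move=> Ap; rewrite /h indicE memNset ?mulr0.
pose bad i := bset [set v | [/\ L v, A i (inB v) & exists2 lam, 0 < lam &
  forall k0, exists2 k, (k0 <= k)%N &
    ((lam * (2^-1 ^+ k) `^ D)%:E < \int[mu]_(p in ballk v k) (h i p)%:E)%E]].
have nbad i : mu.-negligible (bad i) by exact (density_zero (h0 i) (hi i) (mA i) (hA i)).
pose F (n : nat) := if unpickle n is Some i then bad i else set0.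
have nF n : mu.-negligible (F n).
  by rewrite /F; case: unpickle => // ; exact: negligible_set0.
apply: (negligibleS _ (negligible_bigcup nF)) => _ [v [Lv nv] <-].
apply: contrapT => nFv; apply: nv => eta eta0.
have C20 : 0 < 4 * C by rewrite mulr_gt0.
(* Around [v] the integrand is at most [h + 2 * a n]; this [n] makes the constant part contribute at
   most [eta / 2]. *)
pose n := Num.truncn (4 * C / eta).
have an : 2 * C * a n <= eta / 2.
  have h1 := truncnS_gt (4 * C / eta); rewrite -/n ltr_pdivrMr // in h1.
  rewrite /a ler_pdivrMr // mulrAC ler_pdivlMr //.
  by rewrite mulrC; move: (n.+1%:R) h1 => z; rewrite (mulrC eta); lra.
have [q hq] : exists q : rat, `|g (inB v) - ratr q| <= a n.
  have ltq : g (inB v) - a n < g (inB v) + a n by have := a0 n; lra.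
  have [q] := rat_in_itvoo ltq.
  rewrite in_itv /= => /andP[q1 q2]; exists q; rewrite ler_norml; apply/andP; split; lra.
have nb : ~ bad (q, n) (inB v).
  by move=> b; apply: nFv; exists (pickle (q, n)); [|rewrite /F pickleK].
have [k0 hk0] : exists k0, forall k, (k0 <= k)%N ->
    (\int[mu]_(p in ballk v k) (h (q, n) p)%:E <= (eta / 2 * (2^-1 ^+ k) `^ D)%:E)%E.
  apply: contrapT => nk; apply: nb; exists v => //; split => //.
  exists (eta / 2); first by rewrite divr_gt0.
  move=> k0; apply: contrapT => nk'; apply: nk; exists k0 => k k0k.
  by rewrite leNgt; apply/negP => lt; apply: nk'; exists k.
exists k0 => k k0k.
have mb : measurable (ballk v k) by exact: (measurable_rho_ball hX eps0 vis).
apply: (@le_trans _ _ (\int[mu]_(p in ballk v k) ((h (q, n) p)%:E + (2 * a n)%:E))%E).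
  apply: ge0_le_integral => //.
  - by apply/measurable_EFinP; exact: measurable_funTS (mgq _).
  - apply: emeasurable_funD; last exact: measurable_cst.
    exact: measurable_funTS (measurable_int _ (hi (q, n))).
  move=> p _; rewrite -EFinD lee_fin.
  have := ler_normD (g p - ratr q) (ratr q - g (inB v)).
  rewrite addrA subrK (distrC (ratr q)) => tri.
  rewrite /h /=; have [Ap|nAp] := pselect (A (q, n) p).
    rewrite indicE memNset ?mulr0 //.
    by rewrite /A /= in Ap; lra.
  by rewrite indicE mem_set // mulr1; have := a0 n; lra.
have ha : 0 <= 2 * a n by rewrite mulr_ge0 // ltW.
have -> : (\int[mu]_(p in ballk v k) ((h (q, n) p)%:E + (2 * a n)%:E) =
    \int[mu]_(p in ballk v k) (h (q, n) p)%:E +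
    \int[mu]_(p in ballk v k) (cst (2 * a n)%:E p))%E.
  have mh : measurable_fun (ballk v k) (EFin \o h (q, n)).
    exact: measurable_funTS (measurable_int _ (hi (q, n))).
  by apply: (ge0_integralD mu mb) => // p _; rewrite lee_fin.
rewrite integral_cst //.
set z := (2^-1 ^+ k) `^ D.
apply: (@le_trans _ _ ((eta / 2 * z)%:E + (2 * a n)%:E * (C * z)%:E)%E).
  apply: leeD; first exact: hk0.
  by apply: lee_wpmul2l => //; apply: upper; rewrite ?exprn_gt0 ?invr_gt0.
rewrite -EFinM -EFinD lee_fin; have z0 : 0 <= z by exact: powR_ge0.
have := ler_wpM2r z0 an; lra.
Qed.

End lebesgue_points.

(** * The square root of the Poisson kernel *)

Section poisson_kernel.
Context {R : realType} {X : pmetricType R}.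
Variables (delta eps alpha : R) (x : X) (rho : gbdry X -> gbdry X -> R).
Variable Gamma : set (X -> X).
Variable mu : X -> {finite_measure set (borel_gbar X) -> \bar R}.
Hypothesis hX : hyperbolic delta X.
Hypothesis properX : proper_space X.
Hypothesis geodesicX : geodesic_space X.
Hypothesis GammaI : isometry_group Gamma.
Hypothesis crit : critical_exponent Gamma x = alpha%:E.
Hypothesis qc : quasiconvex_cocompact Gamma x.
Hypothesis nonel : nonelementary Gamma x.
Hypothesis eps0 : 0 < eps.
Hypothesis vis : visual_metric x eps rho.
Hypothesis qcd : quasiconformal_density mu Gamma alpha.
Implicit Types (u v : gbdry X) (y : X) (p : borel_gbar X).

Let d0 : 0 <= delta. Proof. exact: hyperbolic_ge0 hX x. Qed.
Let alpha_gt0 : 0 < alpha.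
Proof. exact (critical_exponent_gt0 hX properX geodesicX GammaI crit qc nonel). Qed.
Let D := alpha / eps.
Let D0 : 0 < D. Proof. by rewrite divr_gt0. Qed.
Let n y := mdist x y.

(** As [poisson] is the density to the power [alpha^-1], this is the square root of the density,
    comparable with the exponential of [alpha / 2] times the Busemann function. *)
Definition sqrt_poisson y p := poisson mu alpha x y p `^ (alpha / 2).
Let K := sqrt_poisson.

Lemma measurable_sqrt_poisson y : measurable_fun setT (K y).
Proof.
rewrite /K /sqrt_poisson /poisson; apply: measurableT_comp (measurable_powR _) _.
apply: measurableT_comp (measurable_powR _) _.
apply: measurableT_comp; first exact: fine_measurable.
exact: (measurable_density qcd).
Qed.

Lemma sqrt_poisson_ge0 y p : 0 <= K y p. Proof. exact: powR_ge0. Qed.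

Lemma sqrt_poisson_busemann : exists2 C : R, 1 <= C & forall y, \forall p \ae mu x,
  C^-1 * expR (alpha / 2 * busemann p x y) <= K y p <= C * expR (alpha / 2 * busemann p x y).
Proof.
have [[Cq Cq0 hCq] _] := qcd.
pose C := Num.max 1 (Num.max (Cq `^ 2^-1) (Cq^-1 `^ 2^-1)^-1).
have C1 : 1 <= C by rewrite le_max lexx.
have CC : Cq `^ 2^-1 <= C by rewrite !le_max lexx !orbT.
have CC' : (Cq^-1 `^ 2^-1)^-1 <= C by rewrite !le_max lexx !orbT.
exists C => // y; have [_ _ hae] := hCq x y.
apply: (@filterS _ _ (ae_filter_ringOfSetsType (mu x)) _ _ _ hae) => p /andP[h1 h2].
have fd : density mu x y p \is a fin_num.
  by rewrite fin_numE; apply/andP; split; apply/eqP => E; rewrite E in h1 h2.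
rewrite -(fineK fd) !lee_fin in h1 h2.
have KE : K y p = fine (density mu x y p) `^ 2^-1.
  rewrite /K /sqrt_poisson /poisson -powRrM; congr (_ `^ _).
  by rewrite mulrA mulVf ?mul1r // gt_eqF.
have eE : expR (alpha / 2 * busemann p x y) = expR (alpha * busemann p x y) `^ 2^-1.
  by rewrite -expRM mulrAC.
have e0 := expR_gt0 (alpha * busemann p x y).
have a0 : 0 <= Cq^-1 * expR (alpha * busemann p x y) by rewrite mulr_ge0 ?invr_ge0 ?(ltW Cq0) ?(ltW e0).
have h0 := le_trans a0 h1.
rewrite KE eE; apply/andP; split.
  apply: (@le_trans _ _ ((Cq^-1 * expR (alpha * busemann p x y)) `^ 2^-1)).
    rewrite powRM ?invr_ge0 ?(ltW Cq0) ?(ltW e0) //; apply: ler_wpM2r; first exact: powR_ge0.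
    by rewrite -[leRHS]invrK lef_pV2 ?posrE ?invr_gt0 ?powR_gt0 ?invr_gt0 //; lra.
  by apply: ge0_ler_powR; rewrite ?nnegrE ?invr_ge0.
apply: (@le_trans _ _ ((Cq * expR (alpha * busemann p x y)) `^ 2^-1)).
  by apply: ge0_ler_powR; rewrite ?nnegrE ?invr_ge0 ?(le_trans h0 h2).
rewrite powRM ?(ltW Cq0) ?(ltW e0) //; apply: ler_wpM2r => //; exact: powR_ge0.
Qed.

(** Seen from [x], [w y] lies behind [y], so the product of [u] with [y] is at most that with [w y]
    up to a constant, and the visual metric turns the latter into a distance. *)
Lemma sqrt_poisson_upper (w : X -> gbdry X) : boundary_choice x w ->
  exists2 C : R, 1 <= C & forall y, \forall p \ae mu x, forall u, p = inB u ->
    K y p <= C * expR (alpha / 2 * n y) /\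
    forall s, 0 < s -> s <= rho (w y) u ->
      K y p <= C * expR (- (alpha / 2 * n y)) * s `^ (- D).
Proof.
move=> [cw cw0 hw]; have [C1 C11 hC1] := sqrt_poisson_busemann.
have [c c1 hc] := visual_gge hX eps0 vis.
have a2 : 0 < alpha / 2 by rewrite divr_gt0.
pose C3 := cw + 6 * delta + 6.
have c0 : 0 < c by lra.
pose E := expR (alpha * C3) * c `^ D.
have E1 : 1 <= E.
  rewrite mulr_ege1 //.
    by rewrite -[leLHS]expR0 ler_expR mulr_ge0 ?(ltW alpha_gt0) // /C3; have := d0; lra.
  by rewrite /powR gt_eqF // -[leLHS]expR0 ler_expR mulr_ge0 ?(ltW D0) ?ln_ge0.
exists (C1 * E) => [|y]; first by rewrite mulr_ege1.
apply: (@filterS _ _ (ae_filter_ringOfSetsType (mu x)) _ _ _ (hC1 y)) => p /andP[_ h] u pu.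
subst p; have C10 : 0 <= C1 by lra.
split.
  apply: le_trans h _; apply: ler_pM; rewrite ?expR_ge0 //.
    by rewrite ler_peMr.
  by rewrite ler_expR ler_pM2l // busemann_le.
move=> s s0 su; apply: le_trans h _.
rewrite -!mulrA; apply: ler_wpM2l => //.
pose g := fine (gprod x (inB u) (inX y)).
have gE : (g%:E = gprod x (inB u) (inX y))%E by rewrite /g gprod_fin.
have hg : gge x (inB u) (inX y) (g - 2 * delta - 3).
  by apply: (gge_gprod hX); rewrite gE.
have gn : g <= n y by rewrite -lee_fin gE; exact: gprod_ub.
have hwy := gge_gprod hX (hw y).
have hwu : gge x (inB (w y)) (inB u) (g - C3).
  have h1 : gge x (inB u) (inX y) (g - cw - 2 * delta - 3).
    by refine (gge_le hg _); lra.
  have h2 : gge x (inX y) (inB (w y)) (g - cw - 2 * delta - 3).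
    by refine (gge_le hwy _); rewrite /n in gn; lra.
  by apply: gge_sym; refine (gge_le (gge_tri hX h1 h2) _); rewrite /C3; have := d0; lra.
have sg : s <= c * expR (- eps * (g - C3)) by apply: le_trans su _; exact: (hc _ _ _).1.
have lnsg : ln s <= ln c - eps * (g - C3).
  by rewrite -mulNr -[X in _ + X]expRK -lnM ?posrE ?expR_gt0 // ler_ln ?posrE ?mulr_gt0 ?expR_gt0.
have sE : s `^ (- D) = expR (- (D * ln s)) by rewrite /powR gt_eqF // mulNr.
have cE : c `^ D = expR (D * ln c) by rewrite /powR gt_eqF.
rewrite /E sE cE -!expRD ler_expR /busemann -/g -/(n y).
have := ler_wpM2l (ltW D0) lnsg.
have -> : D * (ln c - eps * (g - C3)) = D * ln c - alpha * (g - C3).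
  by rewrite /D; field; rewrite gt_eqF.
lra.
Qed.

(** The centre is a limit point behind [y], supplied by [hull_endpoint], and not [w y]: mass is
    bounded from below only around limit points. *)
Lemma sqrt_poisson_lower : exists2 C : R, 0 < C & forall y, geodesic_hull Gamma x y ->
  exists2 xi, limit_set Gamma x xi & \forall p \ae mu x, forall u, p = inB u ->
    forall r, expR (- eps * n y) <= r -> rho xi u < r ->
      C * expR (- (alpha / 2 * n y)) * r `^ (- D) <= K y p.
Proof.
have [C1 C11 hC1] := sqrt_poisson_busemann.
have [c c1 hc] := visual_gge hX eps0 vis.
have a2 : 0 < alpha / 2 by rewrite divr_gt0.
have c0 : 0 < c by lra.
exists (C1^-1 * expR (- alpha * (3 * delta + 2)) * c `^ (- D)).
  by rewrite !mulr_gt0 ?expR_gt0 ?powR_gt0 ?invr_gt0 //; lra.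
move=> y /(hull_endpoint hX)[xi xiL hxi]; exists xi => //.
apply: (@filterS _ _ (ae_filter_ringOfSetsType (mu x)) _ _ _ (hC1 y)) => p /andP[h _] u pu r rn ur.
subst p; have r0 : 0 < r by apply: lt_le_trans rn; exact: expR_gt0.
pose s := - ln (c * r) / eps.
have cr0 : 0 < c * r by rewrite mulr_gt0.
have sE : expR (- eps * s) = c * r.
  have -> : - eps * s = ln (c * r) by rewrite /s; field; rewrite gt_eqF.
  by rewrite lnK // posrE.
have sn : s <= n y.
  rewrite -(ler_nM2l (_ : - eps < 0)) ?oppr_lt0 // -ler_expR sE.
  by apply: le_trans rn _; rewrite ler_peMl // ltW.
have h1 : gge x (inB xi) (inB u) s.
  by apply: (hc _ _ _).2; rewrite sE mulKf // gt_eqF.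
have h2 : gge x (inB u) (inX y) (s - 3 * delta - 2).
  have h1' : gge x (inB u) (inB xi) (s - 2 * delta - 2).
    by apply: gge_sym; refine (gge_le h1 _); have := d0; lra.
  have hxi' : gge x (inB xi) (inX y) (s - 2 * delta - 2).
    by refine (gge_le hxi _); rewrite /n in sn; lra.
  by refine (gge_le (gge_tri hX h1' hxi') _); lra.
apply: le_trans h; rewrite -!mulrA; apply: ler_wpM2l; first by rewrite invr_ge0; lra.
rewrite [c `^ _ * _]mulrCA -powRM ?(ltW c0) ?(ltW r0) //.
have -> : (c * r) `^ (- D) = expR (alpha * s).
  by rewrite /powR gt_eqF // /s /D; congr expR; field; rewrite gt_eqF.
rewrite -!expRD ler_expR; have := busemann_lb h2; rewrite -/(n y) => hb.
have := ler_wpM2l (ltW a2) hb; lra.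
Qed.

Lemma sqrt_poisson_integral : (0 < mu x bdry_set)%E -> exists2 C : R, 0 < C &
  forall y, geodesic_hull Gamma x y ->
    ((C * n y * expR (- (alpha / 2 * n y)))%:E <= \int[mu x]_(p in bdry_set) (K y p)%:E)%E.
Proof.
move=> m0.
have [Cu Cu0 hCu] := ahlfors_upper hX properX geodesicX GammaI crit qc nonel eps0 vis qcd.
have [Cl Cl0 hCl] := ahlfors_lower hX properX geodesicX GammaI crit qc nonel eps0 vis qcd m0.
have [C C0 hC] := sqrt_poisson_lower.
(* With this ratio, each annulus between consecutive radii keeps at least half of the lower bound
   for the mass of its outer ball. *)
have [th [th0 th1 hth]] : exists th : R, [/\ 0 < th, th < 1 & Cu * th `^ D <= Cl / 2].
  pose q := Num.min 2^-1 (Cl / 2 / Cu).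
  have q0 : 0 < q by rewrite lt_min invr_gt0 ltr0n /= !divr_gt0.
  have q1 : q < 1 by rewrite gt_min; apply/orP; left; rewrite invf_lt1 ?ltr1n.
  exists (q `^ D^-1); split; first exact: powR_gt0.
    rewrite /powR gt_eqF // -[ltRHS]expR0 ltr_expR pmulr_rlt0 ?invr_gt0 //.
    by rewrite ln_lt0 // q0.
  rewrite -powRrM mulVf ?gt_eqF // powRr1 ?(ltW q0) // mulrC -ler_pdivlMr //.
  by rewrite ge_min lexx orbT.
have lth : 0 < - ln th by rewrite oppr_gt0 ln_lt0 // th0.
(* [th ^+ k] stays above [expR (- eps * n y)] exactly for [k <= c * n y]: this counts the annuli on
   which the lower bound applies. *)
pose c := eps / - ln th.
have cgt0 : 0 < c by rewrite divr_gt0.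
exists (C * (Cl / 2) * c); first by rewrite !mulr_gt0 ?invr_gt0.
move=> y hy; have [xi xiL hK] := hC y hy.
have n0 : 0 <= n y by exact: mdist_ge0.
pose N := (Num.truncn (c * n y)).+1.
have Nn : c * n y <= N%:R by exact/ltW/truncnS_gt.
pose Bk (k : nat) := bset [set u | rho xi u < th ^+ k].
have mB k : measurable (Bk k) by exact: (measurable_rho_ball hX eps0 vis).
pose Ak k := Bk k `\` Bk k.+1.
have mA k : measurable (Ak k) by exact: measurableD.
have thk k : 0 < th ^+ k by rewrite exprn_gt0.
have BS j k : (j <= k)%N -> Bk k `<=` Bk j.
  move=> jk _ [u uk <-]; exists u => //; apply: lt_le_trans uk _.
  by rewrite ler_wiXn2l // ltW.
have powE k : (th ^+ k) `^ D = (th `^ D) ^+ k.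
  by rewrite -!powR_mulrn ?(ltW th0) ?powR_ge0 // -!powRrM mulrC.
have massA k : ((Cl / 2 * (th ^+ k) `^ D)%:E <= mu x (Ak k))%E.
  have fB j : mu x (Bk j) \is a fin_num by exact: fin_num_measure.
  have -> : mu x (Ak k) = (fine (mu x (Bk k)) - fine (mu x (Bk k.+1)))%:E.
    rewrite EFinB !fineK // measureD // ?ltey_eq ?fB //.
    by rewrite (setIidr (BS k k.+1 (leqnSn k))).
  have h1 : ((Cl * (th ^+ k) `^ D)%:E <= mu x (Bk k))%E.
    by apply: hCl => //; rewrite thk exprn_ile1 // ltW.
  have h2 : (mu x (Bk k.+1) <= (Cu * (th ^+ k.+1) `^ D)%:E)%E by exact: hCu.
  move: h1 h2; rewrite -(fineK (fB k)) -(fineK (fB k.+1)) !lee_fin /= => h1 h2.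
  have h3 : Cu * (th ^+ k.+1) `^ D <= Cl / 2 * (th ^+ k) `^ D.
    by rewrite !powE exprS mulrA ler_wpM2r // exprn_ge0 // powR_ge0.
  move: (fine _) (fine _) h1 h2 h3 => a b; move: (_ `^ _) (_ `^ _) => z z2; clear m0; lra.
have KA k : (k < N)%N -> ((C * expR (- (alpha / 2 * n y)) * (Cl / 2))%:E <=
    \int[mu x]_(p in Ak k) (K y p)%:E)%E.
  move=> kN; pose b := C * expR (- (alpha / 2 * n y)) * (th ^+ k) `^ (- D).
  have b0 : 0 <= b by rewrite !mulr_ge0 ?powR_ge0 ?expR_ge0 // ltW.
  apply: (@le_trans _ _ (b%:E * mu x (Ak k))%E).
    apply: (@le_trans _ _ (b%:E * (Cl / 2 * (th ^+ k) `^ D)%:E)%E).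
      rewrite -EFinM lee_fin /b powRN.
      have := powR_gt0 D (thk k); move: (_ `^ D) => z z0.
      by rewrite le_eqVlt; apply/orP; left; apply/eqP; field; rewrite gt_eqF.
    by apply: lee_wpmul2l => //; rewrite lee_fin.
  apply: integral_ae_lb => //.
    by apply/measurable_EFinP; exact: measurable_funS (measurable_sqrt_poisson y).
  apply: (@filterS _ _ (ae_filter_ringOfSetsType (mu x)) _ _ _ hK) => p hp [[u uk pu] _].
  rewrite lee_fin; apply: (hp u) => //.
  have lnE : ln (th ^+ k) = k%:R * ln th by rewrite lnXn // mulr_natl.
  rewrite -[leRHS]lnK ?posrE // ler_expR lnE.
  move: kN; rewrite ltnS -(ler_nat R) => kN.
  have h1 : k%:R <= c * n y by apply: le_trans kN _; rewrite truncn_le // mulr_ge0 // ltW.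
  have := ler_wpM2l (ltW lth) h1.
  have -> : - ln th * (c * n y) = eps * n y.
    by rewrite /c mulrA (mulrC (- ln th)) divfK // gt_eqF.
  clear m0; lra.
apply: (@le_trans _ _ (\int[mu x]_(p in \big[setU/set0]_(k <- iota 0 N) Ak k) (K y p)%:E)%E); last first.
  apply: ge0_subset_integral => //.
  - exact: bigsetU_measurable.
  - exact: (measurable_bdry x hX).
  - by apply/measurable_EFinP; exact: measurable_funS (measurable_sqrt_poisson y).
  - by move=> p _; rewrite lee_fin sqrt_poisson_ge0.
  - elim/big_ind: _ => // [A B hA hB p [/hA|/hB]//|k _].
    by move=> p [/bset_sub].
rewrite ge0_integral_bigsetU ?iota_uniq //; last 3 first.
- move=> i j _ _ [p [[iB niB] [jB njB]]].
  apply/eqP; rewrite eqn_leq; apply/andP; split; rewrite leqNgt; apply/negP => lt.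
    by apply: njB; apply: BS lt _ _.
  by apply: niB; apply: BS lt _ _.
- by apply/measurable_EFinP; exact: measurable_funS (measurable_sqrt_poisson y).
- by move=> p _; rewrite lee_fin sqrt_poisson_ge0.
apply: (@le_trans _ _ (\sum_(k <- iota 0 N) (C * expR (- (alpha / 2 * n y)) * (Cl / 2))%:E)%E).
  rewrite sumEFin big_const_seq count_predT size_iota iter_addr_0 lee_fin -[leRHS]mulr_natl.
  have F0 : 0 <= C * expR (- (alpha / 2 * n y)) * (Cl / 2).
    by rewrite !mulr_ge0 ?expR_ge0 ?divr_ge0 // ltW.
  have -> : C * (Cl / 2) * c * n y * expR (- (alpha / 2 * n y)) =
    c * n y * (C * expR (- (alpha / 2 * n y)) * (Cl / 2)) by ring.
  by apply: ler_wpM2r.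
rewrite big_seq [leRHS]big_seq; apply: lee_sum => k; rewrite mem_iota => /andP[_ kN].
exact: KA.
Qed.

End poisson_kernel.

Section weighted_integrals.
Context {d : measure_display} {T : measurableType d} {R : realType}.
Variable mu : {measure set T -> \bar R}.

Lemma weighted_integral_le (E : set T) (K G : T -> R) (I : Type) (s : seq I)
    (a : I -> R) (S : I -> set T) :
  measurable E -> measurable_fun E K -> measurable_fun E G ->
  (forall p, 0 <= K p) -> (forall p, 0 <= G p) ->
  (forall i, 0 <= a i) -> (forall i, measurable (S i)) -> (forall i, S i `<=` E) ->
  (\forall p \ae mu, E p -> K p <= \sum_(i <- s) a i * \1_(S i) p) ->
  (\int[mu]_(p in E) (K p * G p)%:E <=
   \sum_(i <- s) (a i)%:E * \int[mu]_(p in S i) (G p)%:E)%E.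
Proof.
move=> mE mK mG K0 G0 a0 mS SE hK.
pose f i p : \bar R := (a i * (\1_(S i) p * G p))%:E.
have f0 i p : (0 <= f i p)%E by rewrite lee_fin !mulr_ge0 // indicE.
have mf i : measurable_fun E (f i).
  apply/measurable_EFinP; apply: measurable_funM; first exact: measurable_cst.
  apply: measurable_funM => //; apply: measurable_funTS; exact: measurable_indic.
apply: (@le_trans _ _ (\int[mu]_(p in E) (\sum_(i <- s) f i p))%E).
  apply: ae_ge0_le_integral => //.
  - by move=> p _; rewrite lee_fin mulr_ge0.
  - by apply/measurable_EFinP; exact: measurable_funM.
  - by move=> p _; apply: sume_ge0.
  - exact: emeasurable_sum.
  apply: filterS hK => p hp /hp h; rewrite sumEFin lee_fin.
  under eq_bigr do rewrite mulrA; rewrite -mulr_suml.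
  exact: ler_wpM2r.
rewrite ge0_integral_sum //; apply: lee_sum => i _.
rewrite (@eq_integral _ _ _ mu E (fun p => ((a i)%:E * ((EFin \o G) \_ (S i)) p)%E)); last first.
  move=> p _; rewrite /f /patch /= indicE; case: (p \in S i) => /=.
    by rewrite mul1r EFinM.
  by rewrite mul0r mulr0 mule0.
rewrite ge0_integralZl //.
- by rewrite -integral_mkcondr (setIidr (SE i)).
- apply: (measurable_restrict _ (mS i) mE).1; apply/measurable_EFinP.
  by apply: measurable_funS mG => // p [].
- by move=> p _; rewrite /patch; case: ifP => // _; rewrite lee_fin.
- by rewrite lee_fin.
Qed.

Lemma bounded_mul_integrable (E : set T) (K G : T -> R) (M : R) : measurable E ->
  measurable_fun E K -> mu.-integrable E (EFin \o G) ->
  (\forall p \ae mu, E p -> `|K p| <= M) ->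
  mu.-integrable E (fun p => (K p * G p)%:E).
Proof.
move=> mE mK /integrableP[mG Gfin] hM; apply/integrableP.
have mG' : measurable_fun E G by apply/measurable_EFinP.
have M0 : 0 <= `|M| by [].
split; first by apply/measurable_EFinP; exact: measurable_funM.
apply: (@le_lt_trans _ _ (\int[mu]_(p in E) (`|M|%:E * `|(G p)%:E|))%E).
  apply: ae_ge0_le_integral => //.
  - apply: measurableT_comp => //; apply/measurable_EFinP; exact: measurable_funM.
  - apply: emeasurable_funM; first exact: measurable_cst.
    exact: measurableT_comp.
  apply: filterS hM => p hp /hp h; rewrite /= -EFinM lee_fin normrM.
  by apply: ler_wpM2r => //; apply: le_trans h (ler_norm _).
rewrite ge0_integralZl //; last by exact: measurableT_comp.
by rewrite lte_mul_pinfty.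
Qed.

End weighted_integrals.

Lemma le_term_sum (R : numDomainType) (I : eqType) (s : seq I) (F : I -> R) i :
  (forall j, 0 <= F j) -> i \in s -> F i <= \sum_(j <- s) F j.
Proof. by move=> F0 si; rewrite (big_rem i) //= lerDl sumr_ge0. Qed.

(** * Nontangential estimate of the averages *)

Section nontangential.
Context {R : realType} {X : pmetricType R}.
Variables (delta eps alpha : R) (x : X) (rho : gbdry X -> gbdry X -> R).
Variable Gamma : set (X -> X).
Variable mu : X -> {finite_measure set (borel_gbar X) -> \bar R}.
Hypothesis hX : hyperbolic delta X.
Hypothesis properX : proper_space X.
Hypothesis geodesicX : geodesic_space X.
Hypothesis GammaI : isometry_group Gamma.
Hypothesis crit : critical_exponent Gamma x = alpha%:E.
Hypothesis qc : quasiconvex_cocompact Gamma x.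
Hypothesis nonel : nonelementary Gamma x.
Hypothesis eps0 : 0 < eps.
Hypothesis vis : visual_metric x eps rho.
Hypothesis qcd : quasiconformal_density mu Gamma alpha.
Variable w : X -> gbdry X.
Hypothesis hw : boundary_choice x w.
Implicit Types (u v : gbdry X) (y : X) (p : borel_gbar X).

Let alpha_gt0 : 0 < alpha.
Proof. exact (critical_exponent_gt0 hX properX geodesicX GammaI crit qc nonel). Qed.
Let D := alpha / eps.
Let D0 : 0 < D. Proof. by rewrite divr_gt0. Qed.
Let q := eps / alpha.
Let q0 : 0 < q. Proof. by rewrite divr_gt0. Qed.
Let n y := mdist x y.
Let K := sqrt_poisson alpha x mu.
Let rad (k : nat) : R := 2^-1 ^+ k.
Let rad_gt0 k : 0 < rad k. Proof. by rewrite exprn_gt0 // invr_gt0. Qed.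
Let rad_le j k : (j <= k)%N -> rad k <= rad j.
Proof. by move=> jk; rewrite ler_wiXn2l // ?invr_ge0 ?invf_le1 // ler1n. Qed.
Let radS k : rad k = 2 * rad k.+1.
Proof. by rewrite /rad exprS mulrA divff ?mul1r. Qed.
Let B v k := bset [set u | rho v u < rad k].
Let mB v k : measurable (B v k). Proof. exact: (measurable_rho_ball hX eps0 vis). Qed.

Lemma approach_radius_small (c r : R) : 0 < c -> 0 < r -> exists2 t0, 1 <= t0 &
  forall t, t0 <= t -> c * t `^ q * expR (- eps * t) <= r.
Proof.
(* The tangent of the logarithm at [kap] bounds [q * ln t] by [eps * t / 2] plus a constant, that
   is, by half of the exponential decay. *)
move=> c0 r0; pose kap := 2 / alpha; have al0 := alpha_gt0.
have kap0 : 0 < kap by rewrite divr_gt0.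
pose t0 := 2 * (q * (ln kap - 1) - ln (r / c)) / eps.
exists (Num.max 1 t0) => [|t]; first by rewrite le_max lexx.
rewrite ge_max => /andP[t1 tt0]; have tgt0 : 0 < t by lra.
have lnt : ln t <= t / kap - 1 + ln kap.
  have := expR_ge1Dx (ln (t / kap)); rewrite lnK ?posrE ?divr_gt0 // ln_div ?posrE //; lra.
rewrite -mulrA mulrC -ler_pdivlMr // /powR gt_eqF // -expRD.
rewrite -[leRHS]lnK ?posrE ?divr_gt0 // ler_expR.
have h1 := ler_wpM2l (ltW q0) lnt.
have e1 : q * (t / kap - 1 + ln kap) = eps * t / 2 + q * (ln kap - 1).
  by rewrite /q /kap; field; rewrite gt_eqF.
have h2 : 2 * (q * (ln kap - 1) - ln (r / c)) <= eps * t.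
  by rewrite (mulrC eps t) -ler_pdivrMr.
move: h1 h2; rewrite e1 mulNr; move: (q * (ln kap - 1)) (ln (r / c)) (q * ln t) (eps * t) => *; lra.
Qed.

(** [None] is the ball near [v], [Some None] the far region and [Some (Some k)] the annulus of level
    [k]. The radii [rad k0 / 2] and [rad k / 4] are lower bounds for the distance to [w y]; the
    pieces may be larger than these regions because only an upper bound is sought. *)
Let weight (C b : R) k0 (i : option (option nat)) : R := match i with
  | None => C * expR b
  | Some None => C * expR (- b) * (rad k0 / 2) `^ (- D)
  | Some (Some k) => C * expR (- b) * (rad k / 4) `^ (- D) end.

Let piece v k1 (i : option (option nat)) : set (borel_gbar X) := match i with
  | None => B v k1
  | Some None => bdry_set
  | Some (Some k) => B v k end.

(* [K] is bounded by [exp (alpha n / 2)] near [v] and by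
   [exp (- alpha n / 2) * rho (w y) u `^ (- D)] elsewhere; the region is split into
   the ball whose radius is comparable with that of the approach region, dyadic annuli
   up to the scale [k0], and the rest. *)
Lemma nontangential_bound (c : R) : 1 <= c -> exists2 A : R, 0 <= A &
  forall (G : borel_gbar X -> R) v k0 (eta : R), (mu x).-integrable setT (EFin \o G) ->
  (forall p, 0 <= G p) -> 0 <= eta ->
  (forall k, (k0 <= k)%N -> (\int[mu x]_(p in B v k) (G p)%:E <=
    (eta * rad k `^ D)%:E)%E) ->
  exists2 N, 1 <= N & exists2 M, 0 <= M & forall y, N <= n y ->
    rho (w y) v <= c * n y `^ q * expR (- eps * n y) ->
    (\int[mu x]_(p in bdry_set) (K y p * G p)%:E <=
     (expR (- (alpha / 2 * n y)) * (A * eta * n y + M))%:E)%E.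
Proof.
move=> c1; have al0 := alpha_gt0.
have [C C1 hC] := sqrt_poisson_upper hX properX geodesicX GammaI crit qc nonel eps0 vis qcd hw.
have C0 : 0 < C by lra.
have c0 : 0 < c by lra.
have ln2 : 0 < ln 2 :> R by rewrite ln_gt0 // ltr1n.
(* The near ball gives the first term, the annuli the second. [A] is fixed before [G] and [eta], so
   that [eta] can later be chosen small against it; what depends on [G] goes into [N] and [M]. *)
pose A := C * (4 * c) `^ D + C * 4 `^ D * (eps / ln 2).
have A0 : 0 <= A.
  by rewrite addr_ge0 // !mulr_ge0 ?powR_ge0 ?divr_ge0 ?invr_ge0 // ltW.
exists A => // G v k0 eta Gi G0 eta0 hG.
have mbd := measurable_bdry x hX.
have mG E : measurable E -> measurable_fun E G.
  by move=> mE; apply/measurable_EFinP; exact: measurable_funS (measurable_int _ Gi).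
have fG : (\int[mu x]_(p in bdry_set) (G p)%:E)%E \is a fin_num.
  by apply: integrable_fin_num => //; exact: integrableS Gi.
pose IG := fine (\int[mu x]_(p in bdry_set) (G p)%:E)%E.
have IG0 : 0 <= IG by rewrite fine_ge0 // integral_ge0 // => p _; rewrite lee_fin.
have [N N1 hN] := approach_radius_small (mulr_gt0 (ltr0n R 2) c0) (rad_gt0 k0).
pose M := C * (rad k0 / 2) `^ (- D) * IG.
exists N => //; exists M; first by rewrite !mulr_ge0 ?powR_ge0 // ltW.
move=> y Ny wv; have n1 : 1 <= n y by lra.
(* Twice the radius of the approach region: [w y] is then within [R' / 2] of [v], and [k1] is the
   last level with [R' <= rad k1]. *)
pose R' := 2 * c * n y `^ q * expR (- eps * n y).
have R'k0 : R' <= rad k0 by exact: hN.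
have ngt0 : 0 < n y by lra.
have nq1 : 1 <= n y `^ q.
  by rewrite /powR gt_eqF // -[leLHS]expR0 ler_expR mulr_ge0 ?ln_ge0 // ltW.
have R'0 : 0 < R' by rewrite !mulr_gt0 ?expR_gt0 //; lra.
have R'e : expR (- eps * n y) <= R'.
  rewrite /R' ler_peMl ?expR_ge0 //.
  have h1 : 1 <= c * n y `^ q by exact: mulr_ege1.
  by rewrite -mulrA; lra.
have wvR : rho v (w y) <= R' / 2 by rewrite (rhoC vis) /R'; lra.
have exk : exists k, rad k.+1 < R'.
  have [k _ h1] : \forall k \near \oo, rad k < R'.
    have /cvgrPdist_lt/(_ R' R'0) : rad k @[k --> \oo] --> (0 : R).
      by apply: cvg_expr; rewrite ger0_norm ?invr_ge0 // invf_lt1 // ltr1n.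
    by apply: filterS => k; rewrite sub0r normrN ger0_norm // ltW.
  by exists k; apply: h1 => /=.
case: (ex_minnP exk) => k1 k1R k1min.
have Rk1 : R' <= rad k1.
  case: k1 {k1R} k1min => [_|k k1min].
    by apply: le_trans R'k0 _; exact: rad_le.
  by rewrite leNgt; apply/negP => /k1min; rewrite ltnn.
have k01 : (k0 <= k1)%N.
  rewrite -ltnS ltnNge; apply/negP => /rad_le h.
  by have := lt_le_trans k1R R'k0; rewrite ltNge h.
pose b := alpha / 2 * n y.
pose a := weight C b k0; pose S := piece v k1.
pose s := None :: Some None :: [seq Some (Some k) | k <- iota k0 (k1 - k0)].
have a0 i : 0 <= a i.
  by rewrite /a; case: i => [[k|]|] /=; rewrite !mulr_ge0 ?powR_ge0 ?expR_ge0 // ltW.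
have mS i : measurable (S i) by case: i => [[k|]|] //=; exact: mB.
have Sb i : S i `<=` bdry_set by case: i => [[k|]|] //=; exact: bset_sub.
have wfar u t : t <= rho v u -> t - R' / 2 <= rho (w y) u.
  by move=> tu; have := rho_triangle vis v (w y) u; lra.
have far p u : p = inB u -> (K y p <= C * expR b /\ forall s, 0 < s -> s <= rho (w y) u ->
      K y p <= C * expR (- b) * s `^ (- D)) -> K y p <= \sum_(i <- s) a i * \1_(S i) p.
  move=> pu [hK1 hK2]; subst p.
  suff [i si [Si Ki]] : exists2 i, i \in s & S i (inB u) /\ K y (inB u) <= a i.
    apply: le_trans Ki _.
    have := @le_term_sum R _ s (fun i => a i * \1_(S i) (inB u)) i.
    rewrite indicE mem_set // mulr1; apply => // j.
    by rewrite mulr_ge0 // indicE.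
  have [tk0|tk0] := leP (rad k0) (rho v u).
    exists (Some None); first by rewrite !inE.
    split; first by exists u.
    apply: hK2; first by rewrite divr_gt0.
    by have := wfar u _ tk0; lra.
  have [tk1|tk1] := leP (rad k1) (rho v u); last first.
    by exists None; rewrite ?inE //; split => //; exists u.
  have k01' : (k0 < k1)%N.
    by rewrite ltnNge; apply/negP => /rad_le h; have := le_lt_trans tk1 tk0; rewrite ltNge h.
  have exj : exists j, rad j.+1 <= rho v u.
    by exists k1.-1; rewrite prednK //; exact: leq_ltn_trans k01'.
  case: (ex_minnP exj) => j ju jmin.
  have uj : rho v u < rad j.
    case: j {ju} jmin => [_|j jmin]; first by apply: lt_le_trans tk0 _; exact: rad_le.
    by rewrite ltNge; apply/negP => /jmin; rewrite ltnn.
  have k0j : (k0 <= j)%N.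
    rewrite -ltnS ltnNge; apply/negP => /rad_le h.
    by have := le_lt_trans ju tk0; rewrite ltNge h.
  have jk1 : (j < k1)%N.
    rewrite -[k1]prednK; last exact: leq_ltn_trans k01'.
    rewrite ltnS; apply: jmin; rewrite prednK //; exact: leq_ltn_trans k01'.
  exists (Some (Some j)).
    by rewrite !inE /= mem_map; [rewrite mem_iota subnKC // k0j|move=> ? ? []].
  split; first by exists u.
  (* As [j < k1], [R'] is at most [rad j.+1]; moving the centre from [v] to [w y] costs half of the
     distance [rad j.+1] and leaves [rad j / 4]. *)
  apply: hK2; first by rewrite divr_gt0.
  have := wfar u _ ju; have := rad_le jk1; have := radS j; lra.
have := @weighted_integral_le _ _ _ (mu x) bdry_set (K y) G _ s a S mbd.
move=> /(_ _ _ _ G0 a0 mS Sb _)/wrap[||||].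
- by apply: measurable_funTS; exact: (measurable_sqrt_poisson x qcd y).
- exact: mG.
- by move=> p; exact: powR_ge0.
- apply: (@filterS _ _ (ae_filter_ringOfSetsType (mu x)) _ _ _ (hC y)) => p hp [u _ up].
  by apply: (far p u) => //; exact: hp.
move=> /le_trans; apply.
rewrite !big_cons big_map.
have near_le : ((a None)%:E * \int[mu x]_(p in S None) (G p)%:E <=
    (expR (- b) * (C * (4 * c) `^ D * eta * n y))%:E)%E.
  apply: (@le_trans _ _ ((a None)%:E * (eta * rad k1 `^ D)%:E)%E).
    by apply: lee_wpmul2l; [rewrite lee_fin|exact: hG].
  rewrite -EFinM lee_fin /a /weight.
  have h1 : rad k1 `^ D <= (4 * c) `^ D * (n y * expR (- alpha * n y)).
    apply: (@le_trans _ _ ((2 * R') `^ D)).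
      have rk : rad k1 <= 2 * R' by have := radS k1; lra.
      by apply: ge0_ler_powR => //; rewrite ?nnegrE; [exact: ltW|exact: ltW|lra].
    rewrite (_ : 2 * R' = (4 * c) * (n y `^ q * expR (- eps * n y))); last by rewrite /R'; ring.
    have c40 : 0 <= 4 * c by lra.
    rewrite (powRM D c40) ?mulr_ge0 ?powR_ge0 ?expR_ge0 //.
    rewrite (powRM D (powR_ge0 _ _) (expR_ge0 _)).
    rewrite -powRrM (_ : q * D = 1); last by rewrite /q /D; field; rewrite !gt_eqF.
    rewrite powRr1 ?(ltW ngt0) // -expRM (_ : - eps * n y * D = - alpha * n y) //.
    by rewrite /D; field; rewrite gt_eqF.
  have h2 := ler_wpM2l (mulr_ge0 (mulr_ge0 (ltW C0) (expR_ge0 b)) eta0) h1.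
  rewrite [leLHS]mulrA; apply: le_trans h2 _.
  have e1 : expR (- b) = expR b * expR (- alpha * n y).
    by rewrite -expRD; congr expR; rewrite /b; lra.
  by rewrite e1 le_eqVlt; apply/orP; left; apply/eqP; ring.
have far_le : ((a (Some None))%:E * \int[mu x]_(p in S (Some None)) (G p)%:E <=
    (expR (- b) * M)%:E)%E.
  rewrite /S /piece -(fineK fG) -EFinM lee_fin /a /weight /M -/IG.
  by rewrite le_eqVlt; apply/orP; left; apply/eqP; ring.
have ann_le : (\sum_(k <- iota k0 (k1 - k0)) (a (Some (Some k)))%:E *
     \int[mu x]_(p in S (Some (Some k))) (G p)%:E <=
    (expR (- b) * (C * 4 `^ D * (eps / ln 2) * eta * n y))%:E)%E.
  pose t := C * expR (- b) * 4 `^ D * eta.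
  have t0 : 0 <= t by rewrite !mulr_ge0 ?powR_ge0 ?expR_ge0 // ltW.
  apply: (@le_trans _ _ (\sum_(k <- iota k0 (k1 - k0)) t%:E)%E).
    rewrite big_seq [leRHS]big_seq; apply: lee_sum => k; rewrite mem_iota => /andP[k0k _].
    apply: (@le_trans _ _ ((a (Some (Some k)))%:E * (eta * rad k `^ D)%:E)%E).
      by apply: lee_wpmul2l; [rewrite lee_fin|exact: hG].
    rewrite -EFinM lee_fin /a /weight powRM ?invr_ge0 ?(ltW (rad_gt0 _)) //.
    rewrite -powR_inv1 // -powRrM mulN1r opprK powRN.
    have := powR_gt0 D (rad_gt0 k); move: (rad k `^ D) => z z0.
    by rewrite le_eqVlt; apply/orP; left; apply/eqP; rewrite /t; field; rewrite gt_eqF.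
  rewrite sumEFin big_const_seq count_predT size_iota iter_addr_0 lee_fin -[leLHS]mulr_natl.
  (* From [expR (- eps * n y) <= R' <= rad k1]: the number of annuli is at most linear in [n y]. *)
  have k1n : k1%:R <= eps / ln 2 * n y.
    have := le_trans R'e Rk1; rewrite -[rad k1]lnK ?posrE // ler_expR lnXn ?invr_gt0 //.
    rewrite lnV ?posrE // mulNrn mulNr lerN2 -[_ *+ _]mulr_natr => h.
    by rewrite mulrAC ler_pdivlMr // mulrC.
  have k1s : (k1 - k0)%:R <= k1%:R :> R by rewrite ler_nat leq_subr.
  have := ler_wpM2r t0 (le_trans k1s k1n) => /le_trans; apply.
  by rewrite le_eqVlt; apply/orP; left; apply/eqP; rewrite /t; ring.
apply: le_trans (leeD near_le (leeD far_le ann_le)) _.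
rewrite -!EFinD lee_fin -/b /A le_eqVlt; apply/orP; left; apply/eqP; ring.
Qed.

Lemma poisson_average (g : borel_gbar X -> R) v (Cw e : R) :
  (0 < mu x bdry_set)%E -> (mu x).-integrable setT (EFin \o g) -> 0 < e ->
  (forall eta, 0 < eta -> exists k0, forall k, (k0 <= k)%N ->
    (\int[mu x]_(p in B v k) `|g p - g (inB v)|%:E <= (eta * rad k `^ D)%:E)%E) ->
  exists N, forall y, geodesic_hull Gamma x y -> N <= n y ->
    rho (w y) v <= Cw * n y `^ q * expR (- eps * n y) ->
    `|(\int[mu x]_(p in bdry_set) (K y p * g p)) / (\int[mu x]_(p in bdry_set) K y p) -
      g (inB v)| <= e.
Proof.
have lin (a b m : R) : a <= b / 2 -> 2 * m <= b -> a + m <= b by lra.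
move=> m0 gi e0 hg; have mbd := measurable_bdry x hX; have al0 := alpha_gt0.
have [C C1 hC] := sqrt_poisson_upper hX properX geodesicX GammaI crit qc nonel eps0 vis qcd hw.
have [c2 c20 hc2] := sqrt_poisson_integral hX properX geodesicX GammaI crit qc nonel eps0 vis qcd m0.
have c1 : 1 <= Num.max 1 Cw by rewrite le_max lexx.
have [A A0 hA] := nontangential_bound c1.
pose h p := g p - g (inB v).
have hi : (mu x).-integrable setT (EFin \o h).
  apply: eq_integrable (integrableB measurableT gi
    (finite_measure_integrable_cst (mu x) (g (inB v)) measurableT)) => //.
have Ki y F : (mu x).-integrable setT (EFin \o F) ->
    (mu x).-integrable bdry_set (EFin \o (fun p => K y p * F p)).
  move=> Fi; apply: (bounded_mul_integrable (M := C * expR (alpha / 2 * n y)) mbd).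
  - by apply: measurable_funTS; exact: (measurable_sqrt_poisson x qcd y).
  - exact: integrableS Fi.
  apply: (@filterS _ _ (ae_filter_ringOfSetsType (mu x)) _ _ _ (hC y)) => p hp [u _ up].
  by rewrite ger0_norm ?powR_ge0 //; have [] := hp u (esym up).
(* The term [A * eta * n y] takes half of [e] times the lower bound of the denominator; the constant
   [M] takes the other half once [n y] is large. *)
pose eta := e * c2 / 2 / (A + 1).
have A1 : 0 < A + 1 by lra.
have eta0 : 0 < eta by rewrite !divr_gt0 ?mulr_gt0.
have [k0 hk0] := hg _ eta0.
have [N N1 [M M0 hM]] := hA (fun p => `|h p|) v k0 eta (integrable_norm hi)
  (fun p => normr_ge0 _) (ltW eta0) hk0.
exists (Num.max N (2 * M / (e * c2))) => y yh; rewrite ge_max => /andP[Ny My] wy.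
have ny1 : 1 <= n y by apply: le_trans N1 Ny.
have wy' : rho (w y) v <= Num.max 1 Cw * n y `^ q * expR (- eps * n y).
  apply: le_trans wy _; apply: ler_wpM2r; first exact: expR_ge0.
  by apply: ler_wpM2r; [exact: powR_ge0|rewrite le_max lexx orbT].
have iK := Ki y (cst 1) (finite_measure_integrable_cst (mu x) 1 measurableT).
have iKg := Ki y _ gi; have iKh := Ki y _ hi; have iKa := Ki y _ (integrable_norm hi).
have {}iK : (mu x).-integrable bdry_set (EFin \o K y).
  by apply: eq_integrable iK => // p _ /=; rewrite mulr1.
have toR F : (mu x).-integrable bdry_set (EFin \o F) ->
    (\int[mu x]_(p in bdry_set) (F p)%:E)%E = (\int[mu x]_(p in bdry_set) F p)%:E.
  by move=> Fi; rewrite /Rintegral fineK //; exact: integrable_fin_num.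
have := hM y Ny wy'; rewrite (toR (fun p => K y p * `|h p|)) // lee_fin.
have := hc2 y yh; rewrite (toR (K y)) // lee_fin.
set J := Rintegral _ _ _; set H := Rintegral _ _ _ => hJ hH.
have E0 := expR_gt0 (- (alpha / 2 * n y)).
have J0 : 0 < J by apply: lt_le_trans hJ; rewrite !mulr_gt0 //; exact: lt_le_trans ny1.
have HJ : H <= e * J.
  apply: (le_trans hH); apply: (@le_trans _ _ (e * (c2 * n y * expR (- (alpha / 2 * n y))))); last first.
    by rewrite ler_pM2l.
  rewrite [leRHS]mulrA (mulrC (e * _)) ler_pM2l //.
  have ec0 : 0 < e * c2 by rewrite mulr_gt0.
  have h1 : 2 * M <= e * c2 * n y by rewrite [leRHS]mulrC -ler_pdivrMr.
  have h2 : A * eta <= e * c2 / 2.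
    rewrite /eta mulrCA -[leRHS]mulr1 ler_pM2l; last exact: divr_gt0.
    by rewrite ler_pdivrMr // mul1r lerDl ler01.
  have h3 : A * eta * n y <= e * c2 / 2 * n y by apply: (ler_wpM2r (le_trans ler01 ny1)).
  have e3 : e * c2 / 2 * n y = (e * c2 * n y) / 2 by ring.
  by rewrite (mulrA e); apply: lin h1; rewrite -e3.
have -> : (\int[mu x]_(p in bdry_set) (K y p * g p)) / J - g (inB v) =
    (\int[mu x]_(p in bdry_set) (K y p * h p)) / J.
  have -> : (\int[mu x]_(p in bdry_set) (K y p * h p)) =
      \int[mu x]_(p in bdry_set) (K y p * g p - K y p * g (inB v)).
    by apply: eq_Rintegral => p _; rewrite /h mulrBr.
  rewrite RintegralB //; last first.
    apply: eq_integrable (integrableZr mbd (g (inB v)) iK) => //.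
  by rewrite RintegralZr // -/J mulrBl (mulrC J) mulfK ?gt_eqF.
rewrite normrM (ger0_norm (x := J^-1)) ?invr_ge0 ?(ltW J0) // ler_pdivrMr //.
apply: le_trans HJ; apply: le_trans (le_normr_Rintegral mbd iKh) _.
rewrite /H le_eqVlt; apply/orP; left; apply/eqP; apply: eq_Rintegral => p _.
by rewrite normrM ger0_norm // powR_ge0.
Qed.

End nontangential.

Lemma cvg_complexP (R : realType) (T : Type) (F : set_system T) {FF : Filter F}
    (g : T -> R[i]) (L : R[i]) :
  (forall e : R, 0 < e -> F [set y | `|complex.Re (g y) - complex.Re L| <= e]) ->
  (forall e : R, 0 < e -> F [set y | `|complex.Im (g y) - complex.Im L| <= e]) ->
  g y @[y --> F] --> (L : R[i]^o).
Proof.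
move=> hRe hIm U /nbhs_ballP [e e0 eU].
move: e0; rewrite /= ltcE /= => /andP[/eqP ie re].
have r3 : 0 < complex.Re e / 3 by rewrite divr_gt0.
change (F (g @^-1` U)).
apply: filterS (filterI (hRe _ r3) (hIm _ r3)) => y [/= h1 h2]; apply: eU.
rewrite /ball /= normc_def ltcE /= ie eqxx /=.
move: h1 h2; case: (g y) => a' b'; case: (L) => a b /= h1 h2.
have le : Num.sqrt ((a - a') ^+ 2 + (b - b') ^+ 2) <= `|a' - a| + `|b' - b|.
  rewrite -[leRHS]ger0_norm ?addr_ge0 // -sqrtr_sqr ler_sqrt ?sqr_ge0 //.
  have := real_normK (num_real (a' - a)); have := real_normK (num_real (b' - b)).
  have := normr_ge0 (a' - a); have := normr_ge0 (b' - b).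
  move: `|_| `|_| => s t s0 t0 e1 e2.
  have := mulr_ge0 s0 t0; rewrite sqrrD; nra.
by apply: le_lt_trans le _; lra.
Qed.

(** * Passage to complex functions and conclusion *)

Section conclusion.
Context {R : realType} {X : pmetricType R}.
Implicit Types (f : gbdry X -> R[i]) (v : gbdry X) (y : X).

Lemma approach_far (delta : R) (x : X) v (N : R) : hyperbolic delta X ->
  approach v [set y | N <= mdist x y].
Proof.
move=> hX; exists [set p | gge x (inB v) p N]; last by move=> y /= /gge_ub.
by apply/(nbhs_inBP hX v _ x); exists N.
Qed.

Lemma Re_P0 (mu : X -> {finite_measure set (borel_gbar X) -> \bar R}) alpha x f y :
  complex.Re (P0 mu alpha x f y) =
  (\int[mu x]_(p in bdry_set) (sqrt_poisson alpha x mu y p * complex.Re (extend0 f p))) /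
  \int[mu x]_(p in bdry_set) sqrt_poisson alpha x mu y p.
Proof.
rewrite /P0 -fmorphV /= mulr0 subr0; congr (_ / _).
apply: eq_Rintegral => p _; case: (extend0 f p) => a b /=.
by rewrite mul0r subr0.
Qed.

Lemma Im_P0 (mu : X -> {finite_measure set (borel_gbar X) -> \bar R}) alpha x f y :
  complex.Im (P0 mu alpha x f y) =
  (\int[mu x]_(p in bdry_set) (sqrt_poisson alpha x mu y p * complex.Im (extend0 f p))) /
  \int[mu x]_(p in bdry_set) sqrt_poisson alpha x mu y p.
Proof.
rewrite /P0 -fmorphV /= mulr0 add0r; congr (_ / _).
apply: eq_Rintegral => p _; case: (extend0 f p) => a b /=.
by rewrite mul0r addr0.
Qed.

Lemma integrable_bdry (delta : R) (mu : {finite_measure set (borel_gbar X) -> \bar R})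
    (x : X) (g : borel_gbar X -> R) : hyperbolic delta X ->
  (forall y, g (inX y) = 0) -> mu.-integrable bdry_set (EFin \o g) ->
  mu.-integrable setT (EFin \o g).
Proof.
move=> hX g0 /(integrable_mkcond _ (measurable_bdry x hX)).
congr (_.-integrable _ _); apply/funext => -[y|v]; rewrite /patch.
  by case: ifP => // _; rewrite /= g0.
by rewrite mem_set //; exists v.
Qed.

End conclusion.

Theorem theorem1p5 (R : realType) (X : pmetricType R) (delta eps alpha : R)
    (dvis : X -> gbdry X -> gbdry X -> R)
    (Gamma : set (X -> X))
    (mu : X -> {finite_measure set (borel_gbar X) -> \bar R})
    (x : X) (w : X -> gbdry X) (f : gbdry X -> R[i]) :
  proper_space X -> geodesic_space X -> hyperbolic delta X ->
  upper_gromov_bounded X ->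
  0 < eps <= 1 -> (forall y, visual_metric y eps (dvis y)) ->
  isometry_group Gamma -> discrete_group Gamma -> nonelementary Gamma x ->
  quasiconvex_cocompact Gamma x ->
  critical_exponent Gamma x = alpha%:E ->
  quasiconformal_density mu Gamma alpha -> continuous_density mu ->
  boundary_choice x w ->
  L1_bdry mu x f ->
  \forall p \ae mu x, forall v, p = inB v ->
    weak_nontangential_limit Gamma eps alpha x (dvis x) w
      (P0 mu alpha x f) v (f v).
Proof.
move=> properX geodesicX hX _ /andP[eps0 _] /(_ x) vis GammaI _ nonel qc crit qcd _ hw [f1 f2].
have al0 := critical_exponent_gt0 hX properX geodesicX GammaI crit qc nonel.
have mbd := measurable_bdry x hX.
pose lim p := forall v, p = inB v -> weak_nontangential_limit Gamma eps alpha x (dvis x) w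
  (P0 mu alpha x f) v (f v).
suff : (mu x).-negligible (~` [set p | lim p]) by [].
(* If the boundary is null, almost every point is in [X] and there is nothing to show; otherwise
   lower regularity is available. *)
have [m0|m0] := ltP 0%E (mu x bdry_set); last first.
  have bd0 : mu x bdry_set = 0%E by apply/eqP; rewrite eq_le m0 measure_ge0.
  have nbd : (mu x).-negligible bdry_set by apply/negligibleP.
  apply: (negligibleS _ nbd) => p /= np; apply: contrapT => nb.
  by apply: np => v pv; case: nb; exists v.
have [C C0 upper] := ahlfors_upper hX properX geodesicX GammaI crit qc nonel eps0 vis qcd.
have i1 := integrable_bdry x hX (fun _ => erefl) f1.
have i2 := integrable_bdry x hX (fun _ => erefl) f2.
have D0 : 0 < alpha / eps by rewrite divr_gt0.
have n0 := limit_set_full hX properX geodesicX GammaI crit qc nonel eps0 vis qcd.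
have n1 := lebesgue_point hX eps0 vis C0 D0 upper i1.
have n2 := lebesgue_point hX eps0 vis C0 D0 upper i2.
(* The exceptional points are those off the limit set and the limit points that fail to be Lebesgue
   points of the real or of the imaginary part. *)
apply: (negligibleS _ (negligibleU n0 (negligibleU n1 n2))) => p /= np.
apply: contrapT => good; apply: np => v pv; subst p.
have Lv : limit_set Gamma x v by apply: contrapT => nL; apply: good; left; exists v.
have {n1 i1} a1 Cw e e0 := poisson_average hX properX geodesicX GammaI crit qc nonel eps0 vis
  qcd hw (v := v) Cw (e := e) m0 i1 e0.
have {n2 i2} a2 Cw e e0 := poisson_average hX properX geodesicX GammaI crit qc nonel eps0 vis
  qcd hw (v := v) Cw (e := e) m0 i2 e0.
split=> // Cw Cw0.
have FF : Filter (approach v).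
  apply: filter_from_filter; first by exists setT; exact: filterT.
  by move=> U V hU hV; exists (U `&` V); [exact: filterI|].
apply: cvg_complexP => e e0.
  have [N hN] : exists N, forall y, geodesic_hull Gamma x y -> N <= mdist x y ->
      dvis x (w y) v <= Cw * mdist x y `^ (eps / alpha) * expR (- eps * mdist x y) ->
      `|complex.Re (P0 mu alpha x f y) - complex.Re (f v)| <= e.
    have [|N hN] := a1 Cw e e0.
      apply: contrapT => nh; apply: good; right; left; exists v => //; split => //.
    by exists N => y yh yN wy; rewrite Re_P0; exact: hN.
  by apply: filterS (approach_far x v N hX) => y yN [yh wy]; exact: hN.
have [N hN] : exists N, forall y, geodesic_hull Gamma x y -> N <= mdist x y ->
    dvis x (w y) v <= Cw * mdist x y `^ (eps / alpha) * expR (- eps * mdist x y) ->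
    `|complex.Im (P0 mu alpha x f y) - complex.Im (f v)| <= e.
  have [|N hN] := a2 Cw e e0.
    apply: contrapT => nh; apply: good; right; right; exists v => //; split => //.
  by exists N => y yh yN wy; rewrite Im_P0; exact: hN.
by apply: filterS (approach_far x v N hX) => y yN [yh wy]; exact: hN.
Qed.
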